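(* The cycle index sum of the class $\mathcal D$ of unlabeled (unrooted) dissections is $$Z(\mathcal D)=-\frac12\sum_{d\ge1}\frac{\varphi(d)}{d}\log\Big(\frac34-\frac14 s_d+\frac14\sqrt{s_d^2-6s_d+1}\Big)+\frac{s_2+s_1^2-4s_1-2}{16}+\frac{s_1^2-3s_1^2s_2+2s_1s_2}{16s_2^2}+\frac{3-s_1}{16}\sqrt{s_1^2-6s_1+1}-\frac1{16}\Big(1+\frac{s_1^2}{s_2^2}+\frac{2s_1}{s_2}\Big)\sqrt{s_2^2-6s_2+1},$$ where $\varphi$ is Euler's totient function.
   Context: For a group $A$ of permutations of $\{1,\dots,n\}$, its cycle index is $Z(A)=\frac1{|A|}\sum_{\alpha\in A}\prod_{k=1}^n s_k^{j_k(\alpha)}$, where $j_k(\alpha)$ is the number of $k$-cycles of $\alpha$ and $s_1,s_2,\dots$ are formal variables. For a graph $G$, $Z(G)$ is the cycle index of its automorphism group acting on its vertices, and for a class $\mathcal K$ of unlabeled graphs (one representative per isomorphism class) the cycle index sum is $Z(\mathcal K)=\sum_{K\in\mathcal K}Z(K)$. A dissection is a two-connected outerplanar graph with at least three vertices (equivalently a convex polygon together with non-crossing diagonals, the polygon being the unique Hamiltonian cycle). By convention the class $\mathcal D$ also contains the single edge $K_2$, but not the single vertex. *)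

(* Defs.v *)
From HB Require Import structures.
From mathcomp Require Import all_boot all_order all_algebra all_fingroup finmap.
From mathcomp Require Import boolp classical_sets cardinality fsbigop.
From mathcomp Require Import monalg.
From mathcomp Require Import zify.

Set Implicit Arguments.
Unset Strict Implicit.
Unset Printing Implicit Defensive.

Import GRing.Theory.
Local Open Scope ring_scope.

(* A monomial s_1^(m 1) s_2^(m 2) ... is m : {cmonom nat}.  The index type nat *)
(* also provides a variable s_0, which never occurs in a cycle index.          *)
Local Notation mon := {cmonom nat}.
Local Notation "m1 ** m2" := (mulcm m1 m2) (at level 40, left associativity).

Section Monomials.
Implicit Types m d : mon.

Lemma mulmI m : injective (mulcm m).
Proof.
move=> d1 d2 /eqP/cmP e; apply/eqP/cmP => i.
by move: (e i); rewrite !mulcmE => /addnI.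
Qed.

Lemma le_mdeg m i : (m i <= mdeg m)%N.
Proof.
rewrite mdegE; case: (finsuppP m i) => //= im.
by rewrite (big_fsetD1 i) //= leq_addr.
Qed.

Definition antidiag m : set (mon * mon) := [set p | p.1 ** p.2 = m].

Lemma finite_antidiag m : finite_set (antidiag m).
Proof.
pose c (f : {ffun finsupp m -> 'I_(mdeg m).+1}) : mon :=
  mkcmonom [fsfun i : finsupp m => f i : nat | 0%N].
apply: (@sub_finite_set _ _ [set` [seq (c f, divcm m (c f)) |
    f : {ffun finsupp m -> 'I_(mdeg m).+1}]]) => [[d e] /= dem|]; last first.
  by apply/finite_seqP; eexists.
have le i : (d i <= m i)%N by rewrite -dem mulcmE leq_addr.
have dE : d = c [ffun i => inord (d (val i))].
  apply/eqP/cmP => i; rewrite cmE fsfun_ffun.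
  case: insubP => [u _ <-|im] /=.
    by rewrite ffunE inordK // ltnS (leq_trans (le _)) ?le_mdeg.
  by apply/eqP; rewrite -leqn0 (leq_trans (le i)) // (fsfun_dflt im).
apply/mapP; exists [ffun i => inord (d (val i))]; first by rewrite mem_enum.
rewrite -dE; congr pair; apply/eqP/cmP => i.
by rewrite divcmE -dem mulcmE addKn.
Qed.

(* To show that series form an integral domain we compare monomials by degree, *)
(* then by their value as numerals in a base exceeding all exponents.          *)
Let mon_bound m := (\max_(k <- finsupp m) k).+1.
Definition mon_val (B : nat) m := (\sum_(k < mon_bound m) m k * B ^ k)%N.

Lemma mon_out m k : (mon_bound m <= k)%N -> m k = 0%N.
Proof.
case: (finsuppP m k) => // km; rewrite /mon_bound ltnNge.
by rewrite (@leq_bigmax_seq nat (enum_fset (finsupp m)) xpredT (fun k => k) k km isT).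
Qed.

Lemma mon_valE B m n : (mon_bound m <= n)%N ->
  mon_val B m = (\sum_(k < n) m k * B ^ k)%N.
Proof.
move=> mn; rewrite /mon_val (big_ord_widen n (fun k => m k * B ^ k)%N mn).
rewrite big_mkcond; apply: eq_bigr => k _; case: ifPn => //.
by rewrite -leqNgt => /mon_out ->.
Qed.

Lemma mon_valM B m d : mon_val B (m ** d) = (mon_val B m + mon_val B d)%N.
Proof.
pose n := (mon_bound (m ** d) + mon_bound m + mon_bound d)%N.
rewrite !(@mon_valE B _ n); try by rewrite /n; lia.
by rewrite -big_split; apply: eq_bigr => k _; rewrite mulcmE mulnDl.
Qed.

Lemma mon_val_inj B m d : (forall k, m k < B)%N -> (forall k, d k < B)%N ->
  mon_val B m = mon_val B d -> m = d.
Proof.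
have digits n (u v : nat -> nat) : (forall k, u k < B)%N -> (forall k, v k < B)%N ->
    (\sum_(k < n) u k * B ^ k = \sum_(k < n) v k * B ^ k)%N ->
    forall k, (k < n)%N -> u k = v k.
  elim: n u v => // n IHn u v uB vB; rewrite !big_ord_recl !expn0 !muln1.
  have shift (w : nat -> nat) : (\sum_(i < n) w (lift ord0 i) * B ^ lift ord0 i
      = (\sum_(i < n) w i.+1 * B ^ i) * B)%N.
    by rewrite big_distrl; apply: eq_bigr => i _; rewrite /= expnSr mulnA.
  rewrite !shift => e.
  have B0 : (0 < B)%N := leq_ltn_trans (leq0n _) (uB 0%N).
  have := congr1 (modn^~ B) e; rewrite ![(_ + _ * B)%N]addnC !modnMDl !modn_small // => e0.
  move: e; rewrite e0 => /addnI/eqP; rewrite eqn_pmul2r // => /eqP e [//|k] kn.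
  exact: (IHn (fun k => u k.+1) (fun k => v k.+1)).
move=> mB dB; pose n := (mon_bound m + mon_bound d)%N.
rewrite !(@mon_valE B _ n); try by rewrite /n; lia.
move=> e; apply/eqP/cmP => k.
have [kn|nk] := ltnP k n; first exact: digits e k kn.
by rewrite !mon_out //; rewrite /n in nk; lia.
Qed.

Lemma mon_min (mu : mon -> nat) (P : mon -> Prop) : (exists m, P m) ->
  exists m, P m /\ forall d, P d -> (mu m <= mu d)%N.
Proof.
move=> [m0 Pm0].
have ex : exists n, `[< exists2 m, P m & mu m = n >].
  by exists (mu m0); apply/asboolP; exists m0.
case: (ex_minnP ex) => n /asboolP[m Pm <-] min_n; exists m; split=> // d Pd.
by apply: min_n; apply/asboolP; exists d.
Qed.

End Monomials.

(* Formal power series over rat in the variables s_k, as coefficient functions. *)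
Record fps : predArgType := Fps { fcoef : mon -> rat }.

HB.instance Definition _ := [isNew for fcoef].
HB.instance Definition _ := [Choice of fps by <:].

Section Ring.
Implicit Types f g h : fps.

Lemma fpsP f g : (forall m, fcoef f m = fcoef g m) <-> f = g.
Proof.
by split=> [e|->//]; apply: val_inj; apply: funext => m; exact: e.
Qed.

Definition fps0 := Fps (fun=> 0).
Definition fps_opp f := Fps (fun m => - fcoef f m).
Definition fps_add f g := Fps (fun m => fcoef f m + fcoef g m).
Definition fps1 := Fps (fun m => (m == onecm nat)%:R).
Definition fps_mul f g :=
  Fps (fun m => \sum_(p \in antidiag m) fcoef f p.1 * fcoef g p.2).
Definition fps_scale (c : rat) f := Fps (fun m => c * fcoef f m).

Fact fps_addA : associative fps_add.
Proof. by move=> f g h; apply/fpsP => m /=; rewrite addrA. Qed.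
Fact fps_addC : commutative fps_add.
Proof. by move=> f g; apply/fpsP => m /=; rewrite addrC. Qed.
Fact fps_add0 : left_id fps0 fps_add.
Proof. by move=> f; apply/fpsP => m /=; rewrite add0r. Qed.
Fact fps_addN : left_inverse fps0 fps_opp fps_add.
Proof. by move=> f; apply/fpsP => m /=; rewrite addNr. Qed.

HB.instance Definition _ :=
  GRing.isZmodule.Build fps fps_addA fps_addC fps_add0 fps_addN.

Let AD m := fset_set (antidiag m).

Let mem_AD m p : (p \in AD m) = (p.1 ** p.2 == m).
Proof. by rewrite (in_fset_set (finite_antidiag m)); apply/idP/eqP; rewrite inE. Qed.

Lemma fcoef_mul f g m :
  fcoef (fps_mul f g) m = \sum_(p <- AD m) fcoef f p.1 * fcoef g p.2.
Proof. by rewrite /= (fsbig_finite _ _ (finite_antidiag m)). Qed.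

Lemma perm_AD_swap m : perm_eq (AD m) [seq (p.2, p.1) | p <- AD m].
Proof.
have swI : injective (fun p : mon * mon => (p.2, p.1)) by move=> [a b] [c d] [-> ->].
apply: uniq_perm; rewrite ?map_inj_uniq ?fset_uniq // => -[a b].
by rewrite -[(a, b)]/((fun p : mon * mon => (p.2, p.1)) (b, a)) mem_map //= !mem_AD mulcmC.
Qed.

Fact fps_mulC : commutative fps_mul.
Proof.
move=> f g; apply/fpsP => m; rewrite !fcoef_mul (perm_big _ (perm_AD_swap m)).
by rewrite big_map; apply: eq_bigr => p _; rewrite mulrC.
Qed.

Let uniq_triples (h : mon * mon -> mon * mon -> mon * mon * mon) m
    (t : mon * mon -> {fset mon * mon}) :
  (forall p q p' q', p \in AD m -> q \in t p -> p' \in AD m -> q' \in t p' ->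
     h p q = h p' q' -> p = p' /\ q = q') ->
  uniq [seq h p q | p <- AD m, q <- t p].
Proof.
move=> hI; apply: allpairs_uniq_dep => [|p _|]; rewrite ?fset_uniq //.
move=> _ _ /allpairsPdep[p [q [pA qt ->]]] /allpairsPdep[p' [q' [pA' qt' ->]]].
by rewrite /= => e; case: (hI p q p' q' pA qt pA' qt' e) => -> ->.
Qed.

Lemma perm_AD_assoc m :
  perm_eq [seq (p.1, q.1, q.2) | p <- AD m, q <- AD p.2]
          [seq (q.1, q.2, p.2) | p <- AD m, q <- AD p.1].
Proof.
apply: uniq_perm.
- apply: uniq_triples => -[p1 p2] [q1 q2] [p1' p2'] [q1' q2'] /=.
  rewrite !mem_AD /= => /eqP<- /eqP<- _ /eqP<-.
  by case=> <- <- <-.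
- apply: uniq_triples => -[p1 p2] [q1 q2] [p1' p2'] [q1' q2'] /=.
  rewrite !mem_AD /= => /eqP<- /eqP<- _ /eqP<-.
  by case=> <- <- <-.
move=> [[a b] c]; apply/allpairsPdep/allpairsPdep => -[[p1 p2] [[q1 q2]]].
  rewrite !mem_AD /= => -[/eqP<- /eqP<- [-> -> ->]].
  by exists (p1 ** q1, q2), (p1, q1); rewrite !mem_AD /= mulcmA !eqxx.
rewrite !mem_AD /= => -[/eqP<- /eqP<- [-> -> ->]].
by exists (q1, q2 ** p2), (q2, p2); rewrite !mem_AD /= mulcmA !eqxx.
Qed.

Fact fps_mulA : associative fps_mul.
Proof.
move=> f g h; apply/fpsP => m; rewrite !fcoef_mul.
pose F (t : mon * mon * mon) := fcoef f t.1.1 * fcoef g t.1.2 * fcoef h t.2.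
transitivity (\sum_(t <- [seq (p.1, q.1, q.2) | p <- AD m, q <- AD p.2]) F t).
  rewrite big_allpairs_dep; apply: eq_bigr => p _; rewrite fcoef_mul mulr_sumr.
  by apply: eq_bigr => q _; rewrite mulrA.
rewrite (perm_big _ (perm_AD_assoc m)) big_allpairs_dep.
by apply: eq_bigr => p _; rewrite fcoef_mul mulr_suml.
Qed.

Fact fps_mul1 : left_id fps1 fps_mul.
Proof.
move=> f; apply/fpsP => m; rewrite fcoef_mul.
have mAD : (onecm nat, m) \in AD m by rewrite mem_AD /= mul0cm.
rewrite (big_fsetD1 _ mAD) /= eqxx mul1r big_seq big1 ?addr0 // => -[a b].
rewrite in_fsetD1 mem_AD /= => /andP[ne /eqP abm].
have [a1|_] := eqVneq a (onecm nat); last by rewrite mul0r.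
by move: abm ne; rewrite a1 mul0cm => ->; rewrite eqxx.
Qed.

Fact fps_mulDl : left_distributive fps_mul fps_add.
Proof.
move=> f g h; apply/fpsP => m; have -> : fcoef (fps_add (fps_mul f h) (fps_mul g h)) m =
  fcoef (fps_mul f h) m + fcoef (fps_mul g h) m by [].
by rewrite !fcoef_mul -big_split /=; apply: eq_bigr => p _; rewrite mulrDl.
Qed.

Fact fps1_neq0 : fps1 != 0.
Proof. by apply/eqP => /fpsP/(_ (onecm nat)) /=; rewrite eqxx. Qed.

HB.instance Definition _ := GRing.Zmodule_isComNzRing.Build fps
  fps_mulA fps_mulC fps_mul1 fps_mulDl fps1_neq0.

Fact fps_scaleA a b f : fps_scale a (fps_scale b f) = fps_scale (a * b) f.
Proof. by apply/fpsP => m /=; rewrite mulrA. Qed.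
Fact fps_scale1 : left_id 1 fps_scale.
Proof. by move=> f; apply/fpsP => m /=; rewrite mul1r. Qed.
Fact fps_scaleDr : right_distributive fps_scale +%R.
Proof. by move=> a f g; apply/fpsP => m /=; rewrite mulrDr. Qed.
Fact fps_scaleDl f : {morph fps_scale^~ f : a b / a + b}.
Proof. by move=> a b; apply/fpsP => m /=; rewrite mulrDl. Qed.

HB.instance Definition _ := GRing.Zmodule_isLmodule.Build rat fps
  fps_scaleA fps_scale1 fps_scaleDr fps_scaleDl.

Fact fps_scaleAl (a : rat) (f g : fps) : a *: (f * g) = (a *: f) * g.
Proof.
apply/fpsP => m; have -> : fcoef (a *: (f * g)) m = a * fcoef (fps_mul f g) m by [].
rewrite [RHS]fcoef_mul fcoef_mul mulr_sumr.
by apply: eq_bigr => p _; rewrite mulrA.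
Qed.

HB.instance Definition _ := GRing.Lmodule_isLalgebra.Build rat fps fps_scaleAl.
HB.instance Definition _ := GRing.Lalgebra_isComAlgebra.Build rat fps.

Definition fps_unit : {pred fps} := fun f => `[< exists g, g * f = 1 >].
Definition fps_inv f : fps :=
  match pselect (exists g, g * f = 1) with
  | left e => projT1 (cid e)
  | right _ => f
  end.

Fact fps_mulVx : {in fps_unit, left_inverse 1 fps_inv *%R}.
Proof.
move=> f /asboolP uf; rewrite /fps_inv.
by case: pselect => // e; case: cid.
Qed.
Fact fps_unitPl f g : g * f = 1 -> fps_unit f.
Proof. by move=> gf; apply/asboolP; exists g. Qed.
Fact fps_inv_out : {in [predC fps_unit], fps_inv =1 id}.
Proof.
by move=> f /asboolPn uf; rewrite /fps_inv; case: pselect.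
Qed.

HB.instance Definition _ := GRing.ComNzRing_hasMulInverse.Build fps
  fps_mulVx fps_unitPl fps_inv_out.

Fact fps_integral f g : f * g = 0 -> (f == 0) || (g == 0).
Proof.
move=> fg0; apply/norP => -[/eqP f0 /eqP g0].
have supp h : h <> 0 -> exists m, fcoef h m != 0.
  move=> h0; apply: contrapT => /forallNP hz; apply: h0; apply/fpsP => m.
  by apply/eqP; apply: contrapT => /negP; exact: hz.
have [a0 [fa0 mina0]] := mon_min mdeg (supp f f0).
have [b0 [gb0 minb0]] := mon_min mdeg (supp g g0).
pose B := (mdeg a0 + mdeg b0).+1.
have [a [[fa da] mina]] := @mon_min (mon_val B)
  (fun m => fcoef f m != 0 /\ mdeg m = mdeg a0) (ex_intro _ a0 (conj fa0 erefl)).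
have [b [[gb db] minb]] := @mon_min (mon_val B)
  (fun m => fcoef g m != 0 /\ mdeg m = mdeg b0) (ex_intro _ b0 (conj gb0 erefl)).
have /fpsP/(_ (a ** b)) := fg0; rewrite fcoef_mul.
have abAD : (a, b) \in AD (a ** b) by rewrite mem_AD.
rewrite (big_fsetD1 _ abAD) /= big_seq big1 => [|[u v]].
  by move/eqP; rewrite addr0 mulf_eq0 (negbTE fa) (negbTE gb).
rewrite in_fsetD1 mem_AD /= => /andP[ne /eqP uv].
have [->|fu] := eqVneq (fcoef f u) 0; first by rewrite mul0r.
have [->|gv] := eqVneq (fcoef g v) 0; first by rewrite mulr0.
have lu := mina0 u fu; have lv := minb0 v gv.
have := congr1 mdeg uv; rewrite -[RHS]/(mdeg (mmul a b)) -[LHS]/(mdeg (mmul u v)).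
rewrite !mdegM da db => duv.
have du : mdeg u = mdeg a0 by lia.
have dv : mdeg v = mdeg b0 by lia.
have := congr1 (mon_val B) uv; rewrite !mon_valM => vuv.
have au := mina u (conj fu du); have bv := minb v (conj gv dv).
have ua : u = a.
  apply: (@mon_val_inj B) => [k|k|]; last by lia.
  - by apply: leq_ltn_trans (le_mdeg u k) _; lia.
  - by apply: leq_ltn_trans (le_mdeg a k) _; lia.
by move: uv ne; rewrite ua => /mulmI ->; rewrite eqxx.
Qed.

HB.instance Definition _ := GRing.ComUnitRing_isIntegral.Build fps fps_integral.
End Ring.

Definition fps_var (k : nat) : fps := Fps (fun m => (m == ucm k)%:R).

Notation "''s_' k" := (fps_var k) (at level 1, k at level 0, format "''s_' k").
Notation "f %:F" := (tofrac f).

(* Coefficientwise sum of a family indexed by D.  This is the formal sum only  *)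
(* when each monomial occurs in finitely many F k (otherwise the coefficient   *)
(* is set to 0); all families summed below are locally finite in this sense.   *)
Definition fps_sum (D : set nat) (F : nat -> fps) : fps :=
  Fps (fun m => \sum_(k \in D) fcoef (F k) m).

(* log(1 + u) and (1 + u)^(1/2), for u = f - 1 without constant term. *)
Definition fps_log (f : fps) : fps :=
  fps_sum [set k | (0 < k)%N]%classic (fun k => ((-1) ^+ k.+1 / k%:R) *: (f - 1) ^+ k).

Definition fps_sqrt (f : fps) : fps :=
  fps_sum setT (fun k =>
    ((\prod_(i < k) (1 / 2%:R - i%:R)) / (k`!)%:R) *: (f - 1) ^+ k).

Definition num_cycles n (k : nat) (a : 'S_n) : nat :=
  #|[set C in porbits a | #|C| == k]|.

Definition cycle_index n (A : {group 'S_n}) : fps :=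
  #|A|%:R^-1 *: \sum_(a in A) \prod_(1 <= k < n.+1) 's_k ^+ num_cycles k a.

Definition is_sgraph n (E : {set 'I_n * 'I_n}) : bool :=
  [forall x, (x, x) \notin E] &&
  [forall x, forall y, ((x, y) \in E) == ((y, x) \in E)].

(* Simple graphs with vertex set 'I_n. *)
Record sgraph n : predArgType :=
  SGraph { arcs : {set 'I_n * 'I_n}; _ : is_sgraph arcs }.

HB.instance Definition _ n := [isSub for @arcs n].
HB.instance Definition _ n := [Finite of sgraph n by <:].

Section Graphs.
Variable n : nat.
Implicit Types (G H : sgraph n) (p : 'S_n).

Definition adj G : rel 'I_n := fun x y => (x, y) \in arcs G.

Definition is_isom G H p : bool :=
  [forall x, forall y, adj H (p x) (p y) == adj G x y].

Definition isomorphic G H : bool := [exists p : 'S_n, is_isom G H p].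

Definition aut G : {set 'S_n} := [set p | is_isom G G p].

Fact aut_group_set G : group_set (aut G).
Proof.
apply/group_setP; split=> [|p q].
  by rewrite inE; apply/forallP => x; apply/forallP => y; rewrite !perm1.
rewrite !inE => /forallP hp /forallP hq; apply/forallP => x; apply/forallP => y.
rewrite !permM (eqP (forallP (hq (p x)) (p y))).
exact: (forallP (hp x) y).
Qed.

Canonical aut_group G := Group (aut_group_set G).

(* The subgraph of G induced by A is connected. *)
Definition connected_in G (A : {set 'I_n}) : bool :=
  [forall x in A, forall y in A,
     connect [rel u v | [&& u \in A, v \in A & adj G u v]] x y].

Definition two_connected G : bool :=
  connected_in G [set: 'I_n] && [forall v, connected_in G [set~ v]].

(* G can be drawn in a closed disc with every vertex on the boundary circle    *)
(* (so that all vertices lie on the outer face) and without crossing edges;    *)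
(* p x is the position of the vertex x around the circle, and two edges cross  *)
(* exactly when their endpoints alternate.                                     *)
Definition outerplanar G : bool :=
  [exists p : 'S_n, forall a, forall b, forall c, forall d,
     (adj G a b && adj G c d) ==> ~~ [&& p a < p c, p c < p b & p b < p d]%N].

Definition is_edge G : bool := (n == 2)%N && [exists x, exists y, adj G x y].

Definition is_dissection G : bool :=
  [&& (3 <= n)%N, two_connected G & outerplanar G].

Definition in_D G : bool := is_edge G || is_dissection G.

(* One graph from each isomorphism class of n-vertex graphs satisfying K. *)
Definition unlabeled (K : pred (sgraph n)) : {set sgraph n} :=
  let D := [set G | K G] in transversal (equivalence_partition isomorphic D) D.

End Graphs.

Definition cycle_index_sum (K : forall n, pred (sgraph n)) : fps :=
  fps_sum setT (fun n => \sum_(G in unlabeled (K n)) cycle_index (aut_group G)).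

(* Main.v *)
(* By uniqueness of the Hamiltonian cycle, isomorphisms between dissections of the convex
   n-gon are induced by the dihedral group, so Burnside's lemma writes the contribution of
   n-vertex dissections as 1/(2n) times the sum over dihedral p of the number of
   dissections fixed by p times the cycle monomial of p.

   Let D(x) be the generating function of dissections of a rooted polygon; removing the
   outermost arc at vertex 0 gives 2 D^2 - (1 + x) D + x = 0, whence
   sqrt(x^2 - 6x + 1) = 1 + x - 4 D.  Dissections of an n-gon fixed by the rotation by a
   proper divisor m of n are noncrossing arc systems of a punctured m-gon; their numbers
   b_m satisfy sum b_m x^m = x D' / (1 - D), so sum b_m x^m / m = - log (1 - D), and
   grouping rotations by their order d gives the totient sum.  The identity rotation is
   corrected using the antiderivative of D, which is again expressible by D and
   log (1 - D).  A dissection fixed by a reflection folds along the axis onto a dissection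
   of a polygon with half as many vertices, which gives the remaining terms. *)

From mathcomp Require Import all_boot all_order all_algebra all_fingroup cyclic.
From mathcomp Require Import zify ring.
Require Import Defs.

Set Implicit Arguments.
Unset Strict Implicit.
Unset Printing Implicit Defensive.

Import GRing.Theory.

(** * Noncrossing arc systems of a polygon and of a punctured polygon *)

(** Polygon and punctured polygon are treated alike: an arc system is an independent set for a
    crossing relation on a list of arcs, and both recursions come from deleting or choosing one arc,
    or one arc of a clique. Dissections fixed by a group match such sets once one chord per orbit is
    listed.

    Series in infinitely many variables have neither a distinguished d/dx nor division by ['s_2].
    Differential equations are therefore stated for the Euler derivation, which multiplies each
    coefficient by the degree of its monomial and forgets only the constant term. The quotient
    (D(s_2) - s_2) / s_2^2 enters as a series with its own coefficients, and only the last identity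
    passes to fractions. There the quarter in D = (1 + x - sqrt) / 4 meets the quarter left by
    Burnside's factor, which gives 16.

    The infinite sums over n and d are controlled by giving s_k the weight k: graphs on n vertices
    fill weight n, and in weight n > 0 only divisors d of n occur. The graph K_2 is out of reach of
    the polygon argument, but its cycle index equals the value of the rotation and reflection
    formulas at n = 2. *)

Fixpoint nindep_in (T : eqType) (c : rel T) (ok : pred T) (s : seq T) : nat :=
  if s is x :: s' then
    (nindep_in c ok s' +
     (if ok x then nindep_in c (predI ok (predC (c x))) s' else 0))%N
  else 1%N.

(* The number of c-independent subsets of s. *)
Definition nindep (T : eqType) (c : rel T) s := nindep_in c predT s.

Lemma eq_nindep_in (T : eqType) (c : rel T) ok ok' s : ok =1 ok' ->
  nindep_in c ok s = nindep_in c ok' s.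
Proof.
elim: s ok ok' => //= x s IHs ok ok' e; rewrite e (IHs _ _ e).
by congr (_ + (if _ then _ else _)); apply: IHs => y /=; rewrite e.
Qed.

(** Carrying the constraints as a predicate keeps the recursion structural. Trading the predicate
    for a filter gives the rule used from here on: an independent set either avoids [x], or contains
    [x] and lives among the elements compatible with it. *)
Lemma nindep_in_filter (T : eqType) (c : rel T) ok ok' s :
  nindep_in c ok' [seq x <- s | ok x] = nindep_in c (predI ok ok') s.
Proof.
elim: s ok' => //= x s IHs ok'; case: (ok x) => /=; last by rewrite addn0.
rewrite !IHs; congr (_ + (if _ then _ else _)).
by apply: eq_nindep_in => y /=; rewrite andbA.
Qed.

Lemma nindep_cons (T : eqType) (c : rel T) x s :
  nindep c (x :: s) = (nindep c s + nindep c [seq y <- s | ~~ c x y])%N.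
Proof.
rewrite /nindep /= nindep_in_filter; congr (_ + _).
by apply: eq_nindep_in => y /=; rewrite andbT.
Qed.

Lemma nindep_swap (T : eqType) (c : rel T) x y s : symmetric c ->
  nindep c [:: x, y & s] = nindep c [:: y, x & s].
Proof.
move=> cC; rewrite !nindep_cons /= (cC y x); case: (c x y) => /=; first by rewrite addnAC.
rewrite !nindep_cons -!filter_predI !addnA; congr (_ + nindep c _)%N; first by rewrite addnAC.
by apply: eq_filter => z /=; rewrite andbC.
Qed.

Lemma nindep_catCA (T : eqType) (c : rel T) x s t : symmetric c ->
  nindep c (s ++ x :: t) = nindep c (x :: s ++ t).
Proof.
move=> cC; have [n] := ubnP (size s); elim: n s t => // n IHn [//|y s] t /= sn.
rewrite nindep_swap // !(nindep_cons c y) IHn //; congr (_ + _)%N.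
rewrite filter_cat /=; case: (c y x) => /=; first by rewrite filter_cat.
by rewrite IHn ?filter_cat // size_filter; apply: leq_ltn_trans (count_size _ _) sn.
Qed.

(** The recursion follows the order of the list; this freedom lets every decomposition below put the
    decisive arcs in front. *)
Lemma perm_nindep (T : eqType) (c : rel T) s t : symmetric c -> perm_eq s t ->
  nindep c s = nindep c t.
Proof.
move=> cC; have [n] := ubnP (size s); elim: n s t => // n IHn [|x s] t /= sn st.
  by move: st; rewrite perm_sym => /perm_nilP ->.
have xt : x \in t by rewrite -(perm_mem st) mem_head.
case/splitPr: xt st => t1 t2; rewrite perm_sym -[x :: t2]cat1s perm_catCA /= perm_cons perm_sym => st.
rewrite nindep_catCA // !nindep_cons (IHn s (t1 ++ t2)) //; congr (_ + _)%N.
apply: IHn; last exact: perm_filter.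
by rewrite size_filter; apply: leq_ltn_trans (count_size _ _) sn.
Qed.

Lemma eq_mem_nindep (T : eqType) (c : rel T) s t : symmetric c ->
  uniq s -> uniq t -> s =i t -> nindep c s = nindep c t.
Proof. by move=> cC us ut st; apply: perm_nindep => //; apply: uniq_perm. Qed.

Lemma nindep_cat (T : eqType) (c : rel T) s t :
  (forall x y, x \in s -> y \in t -> ~~ c x y) ->
  nindep c (s ++ t) = (nindep c s * nindep c t)%N.
Proof.
have [n] := ubnP (size s); elim: n s => // n IHn [|x s] /= sn cst; first by rewrite mul1n.
rewrite !nindep_cons mulnDl filter_cat.
have /all_filterP -> : all (fun y => ~~ c x y) t.
  by apply/allP => y; apply: cst; rewrite mem_head.
rewrite (IHn s) // => [|y z ys zt]; last by apply: cst => //; rewrite inE ys orbT.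
rewrite (IHn [seq y <- s | _]) // => [|y z].
  by rewrite size_filter; apply: leq_ltn_trans (count_size _ _) sn.
by rewrite mem_filter => /andP[_ ys] zt; apply: cst => //; rewrite inE ys orbT.
Qed.

Lemma nindep_map (T U : eqType) (c : rel T) (d : rel U) (f : T -> U) s :
  {in s &, forall x y, d (f x) (f y) = c x y} ->
  nindep d (map f s) = nindep c s.
Proof.
have [n] := ubnP (size s); elim: n s => // n IHn [|x s] /= sn cst //.
rewrite !nindep_cons filter_map /= IHn //; last first.
  by move=> y z ys zs; apply: cst; rewrite inE ?ys ?zs orbT.
rewrite -(IHn [seq y <- s | ~~ c x y]); last 2 first.
- by rewrite size_filter; apply: leq_ltn_trans (count_size _ _) sn.
- move=> y z; rewrite !mem_filter => /andP[_ ys] /andP[_ zs].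
  by apply: cst; rewrite inE ?ys ?zs orbT.
congr (_ + nindep d (map f _))%N; apply: eq_in_filter => y ys /=.
by rewrite cst ?mem_head // inE ys orbT.
Qed.

(** At most one member of a clique can be chosen, and choosing [x] in [r] excludes the rest of
    [r]. *)
Lemma nindep_clique (T : eqType) (c : rel T) r s :
  uniq r -> {in r &, forall x y, x != y -> c x y} ->
  nindep c (r ++ s) = (nindep c s + \sum_(x <- r) nindep c [seq y <- s | ~~ c x y])%N.
Proof.
elim: r => [|x r IHr] /= => [_ _|/andP[xr ur] cr]; first by rewrite big_nil addn0.
rewrite nindep_cons IHr // ?big_cons => [|y z yr zr]; last first.
  by apply: cr; rewrite inE ?yr ?zr orbT.
rewrite filter_cat [X in X ++ _](_ : _ = [::]) => [|]; first by rewrite /=; lia.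
apply/eqP; rewrite -[_ == _]negbK -has_filter; apply/hasPn => y yr; rewrite negbK.
apply: cr; rewrite ?mem_head ?inE ?yr ?orbT //.
by apply: contra xr => /eqP ->.
Qed.

(** * Arc systems of a polygon *)

Definition cross : rel (nat * nat) := fun p q =>
  [&& p.1 < q.1, q.1 < p.2 & p.2 < q.2] || [&& q.1 < p.1, p.1 < q.2 & q.2 < p.2].

Lemma crossC : symmetric cross.
Proof. by move=> p q; rewrite /cross orbC. Qed.

Definition arcs_in a b : seq (nat * nat) :=
  [seq (i, j) | i <- iota a (b - a), j <- iota i.+2 (b - i.+1)].

Lemma mem_arcs a b p : (p \in arcs_in a b) = [&& a <= p.1, p.1.+2 <= p.2 & p.2 <= b].
Proof.
apply/allpairsPdep/idP => [[i [j [+ + ->]]]|/and3P[ap pp pb]].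
  by rewrite !mem_iota /=; lia.
by exists p.1, p.2; rewrite !mem_iota; split; [lia|lia|case: (p)].
Qed.

Lemma uniq_arcs a b : uniq (arcs_in a b).
Proof.
apply: allpairs_uniq_dep => [|i _|[i j] [i' j'] _ _ /= [-> ->]//]; exact: iota_uniq.
Qed.

Definition inner_arcs n := [seq p <- arcs_in 0 n | p != (0, n)].

(* ndissect n counts the dissections of a polygon with n + 1 vertices. *)
Definition narcsets n := nindep cross (arcs_in 0 n).
Definition ndissect n := if n is 0 then 0 else nindep cross (inner_arcs n).

(** The outer arc (0, n) crosses nothing, so its presence is a free choice. For n < 2 it is not an
    arc, and both counts have boundary values instead. *)
Lemma narcsetsE n : 2 <= n -> narcsets n = 2 * ndissect n.
Proof.
move=> n2; have -> : ndissect n = nindep cross (inner_arcs n) by case: (n) n2.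
rewrite /narcsets (@eq_mem_nindep _ _ _ ((0, n) :: inner_arcs n) crossC) ?uniq_arcs //.
- rewrite nindep_cons mul2n -addnn; congr (_ + nindep _ _).
  apply/all_filterP/allP => -[i j]; rewrite mem_filter mem_arcs /cross /=.
  by lia.
- by rewrite /= mem_filter eqxx filter_uniq ?uniq_arcs.
- move=> [i j]; rewrite inE mem_filter; case: eqP => [[-> ->]|//].
  by rewrite mem_arcs /= n2 leqnn.
Qed.

Lemma narcsets_shift a n : nindep cross (arcs_in a (a + n)) = narcsets n.
Proof.
rewrite /narcsets -(@nindep_map _ _ cross cross (fun p => (a + p.1, a + p.2)) (arcs_in 0 n)); last first.
  by move=> [i j] [k l] _ _; rewrite /cross /= !ltn_add2l.
apply: eq_mem_nindep; rewrite ?uniq_arcs ?map_inj_uniq ?uniq_arcs //; first exact: crossC.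
  by move=> [i j] [k l] /= [/addnI -> /addnI ->].
move=> [i j]; rewrite mem_arcs; apply/idP/mapP => /= [ij|[[k l]]].
  exists (i - a, j - a); first by rewrite mem_arcs /=; lia.
  by congr pair => /=; lia.
by rewrite mem_arcs /= => kl [-> ->]; lia.
Qed.

(** The system is split at the farthest point i joined to 0, where i = 1 stands for the side.
    Beneath that arc lies a dissection of i + 1 vertices, beyond it an arbitrary system on the
    points from i to n. *)
Lemma narcsets_rec n : 0 < n -> narcsets n = \sum_(i < n.+1) ndissect i * narcsets (n - i).
Proof.
(* [A g] bounds the arcs at 0 by [g]. Raising the bound by one adds a single arc, the longest at 0,
   and hence a single summand. *)
move=> n0; pose A g := [seq p <- arcs_in 0 n | (p.1 == 0) ==> (p.2 <= g)].
have uA g : uniq (A g) by rewrite filter_uniq ?uniq_arcs.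
have mA g i j : ((i, j) \in A g) = [&& (i == 0) ==> (j <= g), i.+2 <= j & j <= n].
  by rewrite mem_filter mem_arcs.
suff IH g : g < n -> nindep cross (A g.+1) = \sum_(i < g.+2) ndissect i * narcsets (n - i).
  have := IH n.-1; rewrite prednK // => <- //.
  apply: eq_mem_nindep; rewrite ?uniq_arcs //; first exact: crossC.
  by move=> [i j]; rewrite mA mem_arcs /=; lia.
elim: g => [|g IHg] gn.
  rewrite !big_ord_recl big_ord0 mul0n add0n mul1n addn0 -(narcsets_shift 1) subnKC //.
  apply: eq_mem_nindep; rewrite ?uniq_arcs //; first exact: crossC.
  by move=> [i j]; rewrite mA mem_arcs /=; lia.
rewrite big_ord_recr -IHg ?(ltnW gn) //=.
rewrite (@eq_mem_nindep _ _ _ ((0, g.+2) :: A g.+1) crossC) ?uA //; last 2 first.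
- by rewrite /= uA mA; lia.
- by move=> [i j]; rewrite inE !mA xpair_eqE; lia.
rewrite nindep_cons -(narcsets_shift g.+2) subnKC //; congr (_ + _).
rewrite -nindep_cat => [|[i j] [k l]]; last first.
  by rewrite mem_filter !mem_arcs /cross /=; lia.
apply: eq_mem_nindep; rewrite ?(filter_uniq _ (uA _)) //; first exact: crossC.
  rewrite cat_uniq !filter_uniq ?uniq_arcs //= andbT.
  by apply/hasPn => -[i j]; rewrite mem_filter !mem_arcs /=; lia.
move=> [i j]; rewrite mem_cat mem_filter mA mem_filter !mem_arcs /cross xpair_eqE /=.
by lia.
Qed.

(* An arc from i to i + l, taken modulo m, of a circle with m points and a puncture. *)
Definition annular_arcs m : seq (nat * nat) :=
  [seq (i, l) | i <- iota 0 m, l <- iota 2 m.-1].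

(** Arcs are lifted to the universal cover. Both start in one period and have length at most m, so
    only lifts shifted by at most one period can cross. *)
Definition annular_cross m : rel (nat * nat) := fun p q =>
  [|| cross (p.1, p.1 + p.2) (q.1, q.1 + q.2),
      cross (p.1, p.1 + p.2) (m + q.1, m + (q.1 + q.2)) |
      cross (m + p.1, m + (p.1 + p.2)) (q.1, q.1 + q.2)].

Lemma annular_crossC m : symmetric (annular_cross m).
Proof.
move=> p q; rewrite /annular_cross !(crossC (q.1, _)) !(crossC (m + q.1, _)).
by rewrite orbCA orbC orbA orbC.
Qed.

Lemma mem_annular_arcs m p :
  (p \in annular_arcs m) = [&& p.1 < m, 1 < p.2 & p.2 <= m].
Proof.
apply/allpairsPdep/idP => [[i [j [+ + ->]]]|/and3P[ap pp pb]].
  by rewrite !mem_iota /=; lia.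
by exists p.1, p.2; rewrite !mem_iota; split; [lia|lia|case: (p)].
Qed.

Lemma uniq_annular_arcs m : uniq (annular_arcs m).
Proof.
apply: allpairs_uniq_dep => [|i _|[i j] [i' j'] _ _ /= [-> ->]//]; exact: iota_uniq.
Qed.

Definition nannular m := nindep (annular_cross m) (annular_arcs m).

(** The arcs beneath the arc of length g from i see a segment, not a circle: reducing their starting
    points modulo m neither creates nor destroys crossings. *)
Lemma annular_cross_rot m i g p q : g <= m -> m <= i + g -> i < m ->
  p \in arcs_in 0 g -> q \in arcs_in 0 g ->
  let f r := (if i + r.1 < m then i + r.1 else i + r.1 - m, r.2 - r.1) in
  annular_cross m (f p) (f q) = cross p q.
Proof.
case: p q => [p p'] [q q'] + + +; rewrite !mem_arcs /annular_cross /cross /= => *.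
case: ifP => ?; case: ifP => ?; apply/idP/idP.
all: try (case/or3P => /orP[] /and3P[]; lia).
all: case/orP => /and3P[? ? ?].
all: do ![apply/orP; try (by left; lia); right]; lia.
Qed.

(** In a noncrossing system the arcs over the step from m - 1 to m are nested, and the split is by
    the longest of them. If its length is i, it has i possible starting points, a dissection beneath
    it, and an arbitrary system on the points from its end round to its start. The case i = 1 stands
    for no such arc. *)
Lemma nannularE m : 0 < m ->
  nannular m = \sum_(i < m.+1) i * ndissect i * narcsets (m - i).
Proof.
move=> m0; pose A g := [seq p <- annular_arcs m | (m <= p.1 + p.2) ==> (p.2 <= g)].
have uA g : uniq (A g) by rewrite filter_uniq ?uniq_annular_arcs.
have mA g i j : ((i, j) \in A g) = [&& (m <= i + j) ==> (j <= g), i < m, 1 < j & j <= m].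
  by rewrite mem_filter mem_annular_arcs.
have xC := annular_crossC m.
suff IH g : g < m ->
    nindep (annular_cross m) (A g.+1) = \sum_(i < g.+2) i * ndissect i * narcsets (m - i).
  have := IH m.-1; rewrite prednK // => <- //.
  apply: eq_mem_nindep; rewrite ?uniq_annular_arcs //.
  by move=> [i j]; rewrite mA mem_annular_arcs /=; lia.
elim: g => [|g IHg] gm.
  rewrite !big_ord_recl big_ord0 /= !mul0n add0n !mul1n addn0 /narcsets subn1.
  rewrite -(@nindep_map _ _ cross (annular_cross m) (fun p => (p.1, p.2 - p.1))).
    apply: eq_mem_nindep; rewrite ?uA ?map_inj_in_uniq ?uniq_arcs //.
      by move=> [i j] [k l]; rewrite !mem_arcs /= => ? ? [? ?]; congr pair; lia.
    move=> [i j]; rewrite mA; apply/idP/mapP => [ij|[[k l]]].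
      exists (i, i + j); first by rewrite mem_arcs /=; lia.
      by congr pair => /=; lia.
    by rewrite mem_arcs /= => kl [-> ->]; lia.
  move=> [i j] [k l]; rewrite !mem_arcs /annular_cross /cross /=; lia.
(* The arcs of length g + 2 over that step. Any two of them cross, so at most one is chosen. *)
pose r := [seq (i, g.+2) | i <- iota (m - g.+2) g.+2].
have mr i j : ((i, j) \in r) = [&& j == g.+2, m <= i + g.+2 & i < m].
  apply/mapP/idP => [[k + [-> ->]]|/and3P[/eqP-> gi im]]; first by rewrite mem_iota; lia.
  by exists i; rewrite ?mem_iota //; lia.
have ur : uniq r by rewrite map_inj_uniq ?iota_uniq // => i j [].
rewrite big_ord_recr -IHg ?(ltnW gm) //=.
rewrite (@eq_mem_nindep _ _ _ (r ++ A g.+1) xC) ?uA //; last 2 first.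
- rewrite cat_uniq ur uA andbT /=.
  by apply/hasPn => -[i j]; rewrite mr mA; lia.
- by move=> [i j]; rewrite mem_cat !mr !mA; lia.
rewrite nindep_clique // => [|[i j] [k l]]; last first.
  by rewrite !mr xpair_eqE /annular_cross /cross /=; lia.
congr (_ + _); rewrite -mulnA; set X := (X in _ = _ * X).
rewrite big_map (eq_big_seq (fun=> X)) => [|i].
  by rewrite big_const_seq count_predT size_iota iter_addn_0 mulnC.
rewrite mem_iota => iP; have [{iP} im gi] : i < m /\ m <= i + g.+2 by lia.
(* [f] places the arcs beneath the chosen arc, wrapping past m. [f'] places the others between its
   end [e] and its start [i], where nothing wraps. *)
pose f p := (if i + p.1 < m then i + p.1 else i + p.1 - m, p.2 - p.1).
pose e := i + g.+2 - m; pose f' p := (e + p.1, p.2 - p.1).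
have eE : e + m = i + g.+2 by rewrite /e; lia.
rewrite /X /narcsets.
rewrite -(@nindep_map _ _ cross (annular_cross m) f (inner_arcs _)); last first.
  by move=> p q; rewrite !mem_filter => /andP[_ ?] /andP[_ ?]; apply: (annular_cross_rot gm).
rewrite -(@nindep_map _ _ cross (annular_cross m) f' (arcs_in _ _)); last first.
  move=> [p q] [p' q']; rewrite !mem_arcs /annular_cross /cross /f' /= => ? ?.
  by apply/idP/idP => [/or3P[] /orP[] /and3P[] *|/orP[] /and3P[] *]; apply/orP; lia.
rewrite -nindep_cat => [|_ _ /mapP[[p q] + ->] /mapP[[p' q'] + ->]]; last first.
  rewrite mem_filter !mem_arcs !xpair_eqE /annular_cross /cross /f /f' /= => ? ?.
  by case: ifP => ?; apply/negP => /or3P[] /orP[] /and3P[]; lia.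
apply: eq_mem_nindep; rewrite ?(filter_uniq _ (uA _)) //.
  rewrite cat_uniq !map_inj_in_uniq ?filter_uniq ?uniq_arcs //=; last 2 first.
  - move=> [p q] [p' q']; rewrite !mem_arcs /f' /= => ? ? [? ?].
    by congr pair; lia.
  - move=> [p q] [p' q']; rewrite !mem_filter !mem_arcs /f /= => ? ? [].
    by case: ifP; case: ifP => ? ? ? ?; congr pair; lia.
  rewrite andbT; apply/hasPn => _ /mapP[[p q] + ->]; apply: contraL => /mapP[[p' q']].
  rewrite mem_filter !mem_arcs /f /f' /= => ? [].
  by case: ifP => ?; lia.
move=> [k l]; rewrite mem_cat mem_filter mA; apply/idP/orP => [kl|[]/mapP[[p q]]].
(* Starting points from [i] on lie beneath the chosen arc; so do those before [e], after one turn.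
   The remaining ones lie outside. *)
- have [ik|ki] := leqP i k.
    left; apply/mapP; exists (k - i, k - i + l).
      rewrite mem_filter mem_arcs xpair_eqE; move: kl; rewrite /annular_cross /cross /=.
      by lia.
    by rewrite /f /=; case: ifP => ?; congr pair; lia.
  have [ke|ek] := ltnP k e.
    left; apply/mapP; exists (k + m - i, k + m - i + l).
      rewrite mem_filter mem_arcs xpair_eqE; move: kl; rewrite /annular_cross /cross /=.
      by lia.
    by rewrite /f /=; case: ifP => ?; congr pair; lia.
  right; apply/mapP; exists (k - e, k - e + l).
    by rewrite mem_arcs; move: kl; rewrite /annular_cross /cross /=; lia.
  by rewrite /f' /=; congr pair; lia.
- rewrite mem_filter !mem_arcs !xpair_eqE /annular_cross /cross /f /= => ? [-> ->].
  by case: ifP => ?; rewrite negb_or; lia.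
- rewrite !mem_arcs /annular_cross /cross /f' /= => ? [-> ->].
  by lia.
Qed.

Local Open Scope ring_scope.

(** * Dissections as noncrossing graphs on a polygon, and Burnside's lemma *)

Lemma modn_wrap n a : (a < 2 * n)%N -> (a %% n = if a < n then a else a - n)%N.
Proof.
case: (ltnP a n) => [/modn_small //|na a2].
by rewrite -[in LHS](subnK na) modnDr modn_small; lia.
Qed.

Lemma ord_gt0 n (x : 'I_n) : (0 < n)%N.
Proof. exact: leq_ltn_trans (ltn_ord x). Qed.

Definition ord_add n (c : nat) (x : 'I_n) : 'I_n := Ordinal (ltn_pmod (x + c) (ord_gt0 x)).
Definition ord_sub n (c : nat) (x : 'I_n) : 'I_n :=
  Ordinal (ltn_pmod (c + (n - x)) (ord_gt0 x)).

Lemma val_ordS n (x : 'I_n) : ordS x = (if x.+1 < n then x.+1 else 0)%N :> nat.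
Proof. by rewrite /= modn_wrap; have := ltn_ord x; [case: ifP|]; lia. Qed.

Lemma ord_add_inj n c : injective (@ord_add n c).
Proof.
move=> x y /(congr1 val)/eqP; rewrite eqn_modDr !modn_small // => /eqP.
exact: val_inj.
Qed.

Lemma ord_sub_inj n c : injective (@ord_sub n c).
Proof.
move=> x y /(congr1 val)/eqP; rewrite /= eqn_modDl => /eqP e; apply: val_inj => /=.
have := congr1 (fun z => (z + x + y) %% n)%N e; rewrite -!addnA !modnDml !addnA.
rewrite subnK ?(ltnW (ltn_ord x)) // -addnA (addnC x) addnA subnK ?(ltnW (ltn_ord y)) //.
by rewrite !modnDl !modn_small.
Qed.

Definition rot_perm n c : 'S_n := perm (@ord_add_inj n c).
Definition refl_perm n c : 'S_n := perm (@ord_sub_inj n c).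

Lemma rot_permE n c (x : 'I_n) : rot_perm n c x = ((x + c) %% n)%N :> nat.
Proof. by rewrite permE. Qed.

Lemma refl_permE n c (x : 'I_n) : refl_perm n c x = ((c + (n - x)) %% n)%N :> nat.
Proof. by rewrite permE. Qed.

Lemma rot_permD n b c : (rot_perm n b * rot_perm n c)%g = rot_perm n (b + c).
Proof.
by apply/permP => x; apply: val_inj; rewrite permM !permE /= modnDml addnA.
Qed.

Lemma rot_permX n c k : (rot_perm n c ^+ k)%g = rot_perm n (c * k).
Proof.
elim: k => [|k IHk]; last by rewrite expgSr IHk rot_permD mulnSr.
apply/permP => x; apply: val_inj.
by rewrite muln0 expg0 perm1 permE /= addn0 modn_small.
Qed.

(** * Isomorphisms and the relabelling action on graphs *)

Section Isomorphisms.
Variable n : nat.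
Implicit Types (G H : sgraph n) (p q : 'S_n).

Lemma adjC G : symmetric (adj G).
Proof.
case: G => E /=; rewrite /adj /= => i x y; case/andP: i => _ /forallP/(_ x)/forallP/(_ y)/eqP.
by [].
Qed.

Lemma adjxx G x : adj G x x = false.
Proof. by case: G => E i; rewrite /adj /=; case/andP: i => /forallP/(_ x)/negbTE. Qed.

Lemma sgraphP G H : (forall x y, adj G x y = adj H x y) <-> G = H.
Proof. by split=> [e|->//]; apply: val_inj; apply/setP => -[x y]; apply: e. Qed.

Lemma is_isomP G H p : reflect (forall x y, adj H (p x) (p y) = adj G x y) (is_isom G H p).
Proof.
apply: (iffP idP) => [/forallP i x y|e]; first by have /forallP/(_ y)/eqP := i x.
by apply/forallP => x; apply/forallP => y; rewrite e.
Qed.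

Lemma is_isom1 G : is_isom G G 1.
Proof. by apply/is_isomP => x y; rewrite !perm1. Qed.

Lemma is_isomM G H K p q : is_isom G H p -> is_isom H K q -> is_isom G K (p * q).
Proof.
by move=> /is_isomP ep /is_isomP eq; apply/is_isomP => x y; rewrite !permM eq ep.
Qed.

Lemma is_isomV G H p : is_isom G H p -> is_isom H G p^-1.
Proof.
by move=> /is_isomP ep; apply/is_isomP => x y; rewrite -ep !permKV.
Qed.

Lemma isomorphic_refl : reflexive (@isomorphic n).
Proof. by move=> G; apply/existsP; exists 1%g; apply: is_isom1. Qed.

Lemma isomorphic_sym : symmetric (@isomorphic n).
Proof.
move=> G H; apply/existsP/existsP => -[p i]; exists p^-1%g; exact: is_isomV.
Qed.

Lemma isomorphic_trans : transitive (@isomorphic n).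
Proof.
move=> H G K /existsP[p ip] /existsP[q iq]; apply/existsP; exists (p * q)%g.
exact: is_isomM iq.
Qed.

Lemma mem_aut G p : (p \in aut G) = is_isom G G p.
Proof. by rewrite inE. Qed.

Fact relabel_subproof G p :
  is_sgraph [set z : 'I_n * 'I_n | adj G (p^-1%g z.1) (p^-1%g z.2)].
Proof.
apply/andP; split; first by apply/forallP => x; rewrite inE adjxx.
by apply/forallP => x; apply/forallP => y; rewrite !inE adjC.
Qed.

Definition relabel G p : sgraph n := SGraph (relabel_subproof G p).

Lemma adj_relabel G p x y : adj (relabel G p) x y = adj G (p^-1%g x) (p^-1%g y).
Proof. by rewrite /adj /= inE. Qed.

Lemma is_isom_relabel G p : is_isom G (relabel G p) p.
Proof. by apply/is_isomP => x y; rewrite adj_relabel !permK. Qed.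

Lemma is_isomE G H p : is_isom G H p = (relabel G p == H).
Proof.
apply/idP/eqP => [i|<-]; last exact: is_isom_relabel.
apply/sgraphP => x y; rewrite adj_relabel.
by have /is_isomP <- := i; rewrite !permKV.
Qed.

Lemma relabel_is_action : is_action [set: 'S_n] relabel.
Proof.
split=> [p G H e|G p q _ _].
  have := is_isom_relabel H p; rewrite -e => iH; apply/sgraphP => x y.
  by have /is_isomP <- := is_isom_relabel G p; have /is_isomP <- := iH.
by apply/eqP; rewrite -is_isomE; apply: is_isomM (is_isom_relabel _ _); apply: is_isom_relabel.
Qed.

Canonical relabel_action := Action relabel_is_action.

Lemma aut_relabel G p : aut (relabel G p) = (aut G :^ p)%g.
Proof.
apply/setP => q; rewrite mem_conjg !inE conjgE invgK.
have i := is_isom_relabel G p; have i' := is_isomV i.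
apply/idP/idP => [iq|iq].
  exact: is_isomM i (is_isomM iq i').
have := is_isomM i' (is_isomM iq i).
by rewrite -!mulgA mulVg mulg1 mulKg.
Qed.

End Isomorphisms.

(** * Cycle monomials under conjugation *)

Lemma porbit_conj n (p q : 'S_n) x : porbit (q ^ p)%g (p x) = p @: porbit q x.
Proof.
apply/setP => y; apply/porbitP/imsetP => [[i ->]|[z /porbitP[i ->] ->]].
  by exists ((q ^+ i)%g x); rewrite ?mem_porbit // -conjXg conjgE !permM permK.
by exists i; rewrite -conjXg conjgE !permM permK.
Qed.

Lemma num_cycles_conj n k (p q : 'S_n) : num_cycles k (q ^ p)%g = num_cycles k q.
Proof.
rewrite /num_cycles -[RHS](card_imset _ (imset_inj (@perm_inj _ p))).
apply/eq_card => C; rewrite inE; apply/andP/imsetP => [[/imsetP[x _ ->] c]|[B + ->]]; last first.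
  rewrite inE => /andP[/imsetP[x _ ->] c]; rewrite card_imset ?c; last exact: perm_inj.
  by rewrite -porbit_conj imset_f.
exists (porbit q (p^-1%g x)); last by rewrite -porbit_conj permKV.
rewrite inE imset_f //=; move: c; rewrite -{1}[x](permKV p) porbit_conj card_imset //.
exact: perm_inj.
Qed.

Definition cycle_weight n (p : 'S_n) : fps := \prod_(1 <= k < n.+1) 's_k ^+ num_cycles k p.

Lemma cycle_weight_conj n (p q : 'S_n) : cycle_weight (q ^ p)%g = cycle_weight q.
Proof. by apply: eq_bigr => k _; rewrite num_cycles_conj. Qed.

Lemma cycle_indexE n (A : {group 'S_n}) :
  cycle_index A = #|A|%:R^-1 *: \sum_(a in A) cycle_weight a.
Proof. by []. Qed.

Lemma sum_weight_relabel n (G : sgraph n) p :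
  \sum_(a in aut (relabel G p)) cycle_weight a = \sum_(a in aut G) cycle_weight a.
Proof.
rewrite aut_relabel /conjugate big_imset /=; last by move=> x y _ _; apply: conjg_inj.
by apply: eq_bigr => a _; rewrite cycle_weight_conj.
Qed.

(** * Every dissection is isomorphic to one drawn on the standard polygon *)

Definition noncrossing n (E : rel 'I_n) :=
  forall a b c d : 'I_n, E a b -> E c d -> ~~ [&& (a < c)%N, (c < b)%N & (b < d)%N].

(** For n > 2 these are the labelled objects to be counted: dissections whose Hamiltonian cycle runs
    through 0, ..., n - 1 in this order. *)
Definition polygon n (G : sgraph n) : bool :=
  [forall x, adj G x (ordS x)] &&
  [forall a, forall b, forall c, forall d,
     (adj G a b && adj G c d) ==> ~~ [&& (a < c)%N, (c < b)%N & (b < d)%N]].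

Lemma polygonP n (G : sgraph n) :
  reflect ((forall x, adj G x (ordS x)) /\ noncrossing (adj G)) (polygon G).
Proof.
apply: (iffP andP) => [[/forallP s nc]|[s nc]]; split=> //.
- move=> a b c d ab cd.
  have /forallP/(_ b)/forallP/(_ c)/forallP/(_ d) := forallP nc a.
  by rewrite ab cd.
- exact/forallP.
- apply/forallP => a; apply/forallP => b; apply/forallP => c; apply/forallP => d.
  by apply/implyP => /andP[ab cd]; apply: nc.
Qed.

Lemma noncrossing_rot n c (E : rel 'I_n) : symmetric E -> noncrossing E ->
  noncrossing (fun x y => E (ord_add c x) (ord_add c y)).
Proof.
move=> EC nc a b u v Eab Euv; apply/negP => /and3P[au ub bv].
have n0 := ord_gt0 a.
pose e := (c %% n)%N; have en : (e < n)%N by rewrite ltn_pmod.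
have shift (x : 'I_n) : ord_add c x = (if x + e < n then x + e else x + e - n)%N :> nat.
  by rewrite /= -modnDmr modn_wrap // -/e; have := ltn_ord x; lia.
have Eba := Eab; rewrite EC in Eba; have Evu := Euv; rewrite EC in Evu.
(* A rotation may carry some of the four endpoints past zero. The linear order of the images is then
   a cyclic shift of the alternating pattern, and these are its four shifts. *)
have := nc _ _ _ _ Eab Euv; have := nc _ _ _ _ Euv Eba.
have := nc _ _ _ _ Eba Evu; have := nc _ _ _ _ Evu Eab.
have := ltn_ord v; rewrite !shift.
by do 4 (case: ifP => ?); lia.
Qed.

Lemma connect_invariant (T : finType) (e : rel T) (P : pred T) x y :
  (forall u v, e u v -> P u -> P v) -> connect e x y -> P x -> P y.
Proof.
move=> inv /connectP[s sp ->] {y}; elim: s x sp => //= z s IHs x /andP[xz sp] Px.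
exact: IHs sp (inv _ _ xz Px).
Qed.

(** Otherwise the farthest neighbour w of the first vertex u would separate u from the last vertex
    v. An edge leading from before w to after w, if it starts at u, contradicts the choice of w; if
    not, it crosses the edge from u to w. *)
Lemma two_connected_closed n (G : sgraph n) (q : 'S_n) u v : (2 < n)%N ->
  two_connected G -> noncrossing (fun x y => adj G (q^-1%g x) (q^-1%g y)) ->
  q u = 0%N :> nat -> q v = n.-1 :> nat -> adj G u v.
Proof.
move=> n2 /andP[conn /forallP cut] nc qu qv; apply: contraT => uv.
have ncq a b c d : adj G a b -> adj G c d -> ~~ [&& (q a < q c)%N, (q c < q b)%N & (q b < q d)%N].
  by move=> ab cd; apply: nc; rewrite !permK.
have ne_uv : u != v by apply/eqP => e; move: qu qv; rewrite e; lia.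
have [w0 uw0] : exists w, adj G u w.
  have /forall_inP/(_ u (in_setT _))/forall_inP/(_ v (in_setT _))/connectP[[|w s]] := conn.
    by move=> _ /= e; rewrite e eqxx in ne_uv.
  by case/andP => /and3P[_ _ uw] _ _; exists w.
case: (arg_maxnP (fun w => q w : nat) (P := adj G u) uw0) => w uw wmax.
have qI x y : q x = q y :> nat -> x = y by move=> /val_inj/perm_inj.
have wv : w != v by apply: contra uv => /eqP<-.
have wu : w != u by apply/eqP => e; rewrite e adjxx in uw.
have q0w : (0 < q w)%N by rewrite lt0n -qu; apply: contra wu => /eqP/qI ->.
have := cut w => /forall_inP/(_ u); rewrite in_setC1 eq_sym wu => /(_ isT).
move=> /forall_inP/(_ v); rewrite in_setC1 eq_sym wv => /(_ isT) c.
have := @connect_invariant _ _ [pred z | (q z < q w)%N] _ _ _ c; rewrite /= qu qv q0w.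
suff inv : forall x y, [&& x \in [set~ w], y \in [set~ w] & adj G x y] ->
    (q x < q w)%N -> (q y < q w)%N.
  by move/(_ inv isT); rewrite ltnNge -ltnS (ltn_predK n2) ltn_ord.
move=> x y; rewrite !in_setC1 => /and3P[xw yw xy] qxw.
rewrite ltnNge; apply/negP => qwy.
have {}qwy : (q w < q y)%N.
  by rewrite ltn_neqAle qwy andbT; apply: contra yw => /eqP/qI ->.
have [xu|xu] := eqVneq x u; first by have := wmax y; rewrite -xu => /(_ xy); rewrite /geq /= leqNgt qwy.
have qx0 : (0 < q x)%N by rewrite lt0n -qu; apply: contra xu => /eqP/qI ->.
by have := ncq u w x y uw xy; rewrite qu qx0 qxw qwy.
Qed.

Lemma dissection_polygon n (G : sgraph n) : is_dissection G ->
  exists p, polygon (relabel G p).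
Proof.
case/and3P=> n2 tc /existsP[p op]; exists p; apply/polygonP.
have nc : noncrossing (adj (relabel G p)).
  move=> a b c d; rewrite !adj_relabel => ab cd.
  have /forallP/(_ (p^-1%g b))/forallP/(_ (p^-1%g c))/forallP/(_ (p^-1%g d)) :=
    forallP op (p^-1%g a).
  by rewrite ab cd !permKV.
split=> // x; rewrite adj_relabel adjC.
(* This rotation puts the successor of [x] first and [x] last, so that every consecutive pair
   becomes a closing pair. *)
pose r := rot_perm n (n - x.+1).
have rV y : (r^-1)%g y = ord_add x.+1 y.
  apply: (perm_inj (s := r)); rewrite permKV permE; apply: val_inj => /=.
  by rewrite modnDml -addnA subnKC // modnDr modn_small.
apply: (@two_connected_closed _ _ (p * r)%g) => //.
- have := noncrossing_rot (c := x.+1) (adjC (relabel G p)) nc.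
  by move=> nc' a b c d; rewrite !invMg !permM !rV -!adj_relabel; apply: nc'.
- rewrite permM permKV rot_permE val_ordS; have := ltn_ord x.
  case: ifP => ? ?; first by rewrite subnKC // modnn.
  by rewrite add0n modn_small; lia.
- rewrite permM permKV rot_permE; have := ltn_ord x => xn.
  by rewrite modn_small; lia.
Qed.

Lemma connected_in_arc n (G : sgraph n) (A : {set 'I_n}) (b : 'I_n) m :
  (forall x, adj G x (ordS x)) ->
  (forall k, (k < m)%N -> ord_add k b \in A) ->
  (forall x, x \in A -> exists2 k, (k < m)%N & x = ord_add k b) ->
  connected_in G A.
Proof.
move=> side inA arcA; set e := [rel u v | [&& u \in A, v \in A & adj G u v]].
have eC : connect_sym e.
  by apply: sym_connect_sym => u v; rewrite /= adjC andbCA.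
have b0 : ord_add 0 b = b by apply: val_inj; rewrite /= addn0 modn_small.
have cb k : (k < m)%N -> connect e b (ord_add k b).
  elim: k => [|k IHk] km; first by rewrite b0.
  apply: connect_trans (IHk (ltnW km)) (connect1 _); rewrite /= !inA ?(ltnW km) //=.
  suff -> : ord_add k.+1 b = ordS (ord_add k b) by apply: side.
  by apply: val_inj; rewrite /= -[((b + k) %% n).+1]addn1 modnDml addn1 addnS.
apply/forall_inP => x /arcA[k km ->]; apply/forall_inP => y /arcA[l lm ->].
by apply: connect_trans (cb l lm); rewrite eC; apply: cb.
Qed.

Lemma polygon_dissection n (G : sgraph n) : (2 < n)%N -> polygon G -> is_dissection G.
Proof.
move=> n2 /polygonP[side nc]; apply/and3P; split=> //; last first.
  apply/existsP; exists 1%g; apply/forallP => a; apply/forallP => b.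
  apply/forallP => c; apply/forallP => d; rewrite !perm1.
  by apply/implyP => /andP[]; apply: nc.
have sub (b x : 'I_n) : x = ord_add ((x + (n - b)) %% n) b.
  by apply: val_inj; rewrite /= modnDmr addnCA subnKC ?(ltnW (ltn_ord b)) // modnDr modn_small.
apply/andP; split.
  pose b : 'I_n := Ordinal (ltn_trans (ltn0Sn 1) n2).
  apply: (@connected_in_arc _ _ _ b n) => // [k _|x _]; first by rewrite in_setT.
  by exists ((x + (n - b)) %% n)%N; [rewrite ltn_pmod ?(ord_gt0 b)|exact: sub].
apply/forallP => v; apply: (@connected_in_arc _ _ _ (ordS v) n.-1) => // [k kn|x].
  rewrite in_setC1 -val_eqE /= modnDml addSn -addnS.
  rewrite -{2}(modn_small (ltn_ord v)) -{2}[v : nat]addn0 eqn_modDl mod0n modn_small; lia.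
rewrite in_setC1 => xv; exists ((x + (n - ordS v)) %% n)%N; last exact: sub.
rewrite ltn_neqAle -ltnS prednK ?ltn_pmod ?andbT //; try lia.
apply: contra xv => /eqP e; apply/eqP; rewrite (sub (ordS v) x) e; apply: val_inj.
by rewrite /= modnDml addSnnS prednK ?modnDr ?modn_small //; lia.
Qed.

(** * The dihedral group, and isomorphisms between polygons *)

Definition sidep n : rel 'I_n := fun x y => (y == ordS x) || (x == ordS y).

Lemma sidepC n : symmetric (@sidep n).
Proof. by move=> x y; rewrite /sidep orbC. Qed.

Fact cycle_graph_subproof n :
  is_sgraph [set z : 'I_n * 'I_n | sidep z.1 z.2 && (z.1 != z.2)].
Proof.
apply/andP; split; first by apply/forallP => x; rewrite inE eqxx andbF.
by apply/forallP => x; apply/forallP => y; rewrite !inE /= sidepC (eq_sym x).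
Qed.

Definition cycle_graph n : sgraph n := SGraph (cycle_graph_subproof n).
Definition dihedral n : {group 'S_n} := aut_group (cycle_graph n).

Lemma adj_cycle_graph n (x y : 'I_n) : adj (cycle_graph n) x y = sidep x y && (x != y).
Proof. by rewrite /adj /= inE. Qed.

Lemma polygon_chord_cut n (G : sgraph n) (l r z z' : 'I_n) : polygon G ->
  adj G l r -> adj G z z' -> z' != l -> z' != r -> (l < z < r)%N -> (l < z' < r)%N.
Proof.
move=> /polygonP[_ nc] lr zz' zl zr /andP[lz zr'].
have z'z : adj G z' z by rewrite adjC.
have := nc _ _ _ _ z'z lr; have := nc _ _ _ _ lr zz'.
rewrite lz zr' /= !andbT -leqNgt -leqNgt => z'r lz'.
by rewrite !ltn_neqAle z'r lz' !val_eqE (eq_sym l) zl zr.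
Qed.

(* The vertices other than two consecutive ones form a path in G, while removing the ends
   of a chord of H separates the vertices on its two sides. *)
Lemma polygon_isom_side n (G H : sgraph n) p x : (2 < n)%N ->
  polygon G -> polygon H -> is_isom G H p -> sidep (p x) (p (ordS x)).
Proof.
move=> n2 pG pH /is_isomP i; have n0 := ord_gt0 x.
have [sG _] := polygonP _ pG.
pose z k := p (ord_add k.+2 x).
have zz k : adj H (z k) (z k.+1).
  rewrite /z i (_ : ord_add k.+3 x = ordS (ord_add k.+2 x)) //.
  by apply: val_inj; rewrite /= -[((x + k.+2) %% n).+1]addn1 modnDml addn1 addnS.
have neq (k l : nat) : (k < n -> l < n -> k != l -> p (ord_add k x) != p (ord_add l x))%N.
  move=> kn ln kl; rewrite (inj_eq perm_inj) -val_eqE /=.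
  by rewrite eqn_modDl !modn_small.
have p0 : p x = p (ord_add 0 x).
  by congr (p _); apply: val_inj; rewrite /= addn0 modn_small.
have p1 : p (ordS x) = p (ord_add 1 x).
  by congr (p _); apply: val_inj; rewrite /= addn1.
have cover y : y != p x -> y != p (ordS x) -> exists2 k, (k < n.-2)%N & y = z k.
  move=> y0 y1; pose k := (((p^-1)%g y + (n - x)) %% n)%N.
  have kn : (k < n)%N by rewrite ltn_pmod.
  have yk : y = p (ord_add k x).
    apply: (canRL (permKV p)); apply: val_inj; rewrite /= /k modnDmr addnCA subnKC.
      by rewrite modnDr modn_small.
    exact: ltnW.
  case: k kn yk => [|[|k]] kn yk.
  - by rewrite p0 -yk eqxx in y0.
  - by rewrite p1 -yk eqxx in y1.
  - by exists k => //; lia.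
have main l r : adj H l r -> (l < r)%N ->
    (l == p x) && (r == p (ordS x)) || (r == p x) && (l == p (ordS x)) -> sidep l r.
  move=> lr ltlr lrp; apply/negPn/negP => nside.
  have nz k : (k < n.-2)%N -> (z k != l) && (z k != r).
    move=> kn; have k2n : (k.+2 < n)%N by clear -kn; lia.
    have k0 : z k != p x by rewrite p0 neq.
    have k1 : z k != p (ordS x) by rewrite p1 neq // (ltn_trans _ n2).
    by case/orP: lrp => /andP[/eqP-> /eqP->]; rewrite k0 k1.
  have cov y : y != l -> y != r -> exists2 k, (k < n.-2)%N & y = z k.
    by move=> yl yr; apply: cover; case/orP: lrp yl yr => /andP[/eqP-> /eqP->].
  have const k : (k < n.-2)%N -> (l < z k < r)%N = (l < z 0 < r)%N.
    elim: k => // k IHk kn; rewrite -IHk ?(ltnW kn) //; apply/idP/idP => lzr.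
      have /andP[? ?] := nz k (ltnW kn).
      by apply: (polygon_chord_cut pH lr _ _ _ lzr) => //; rewrite adjC.
    have /andP[? ?] := nz k.+1 kn.
    exact: (polygon_chord_cut pH lr (zz k)).
  case/norP: nside => s1 s2.
  have {}s1 : (r : nat) != (ordS l : nat) by exact: s1.
  have {}s2 : (l : nat) != (ordS r : nat) by exact: s2.
  rewrite !val_ordS in s1 s2; have rn := ltn_ord r; have l1n : (l.+1 < n)%N by lia.
  rewrite l1n in s1.
  (* The successor of [l] lies strictly between [l] and [r]. A vertex outside is the successor of
     [r], or 0 if [r] is the last vertex: then [l] is not 0, since [l] and [r] do not form the
     closing side. *)
  have ne_l : Ordinal l1n != l by rewrite -val_eqE /= neq_ltn ltnSn orbT.
  have ne_r : Ordinal l1n != r by rewrite -val_eqE /= eq_sym.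
  have [k kn e] := cov _ ne_l ne_r.
  have inside : (l < z k < r)%N by rewrite -e /=; lia.
  have [y /and3P[yl yr out]] : exists y : 'I_n, [&& y != l, y != r & ~~ (l < y < r)%N].
    case: (ltnP r.+1 n) s2 => [r1n _|r1n s2].
      by exists (Ordinal r1n); rewrite -!val_eqE /=; lia.
    by exists (Ordinal n0); rewrite -!val_eqE /=; lia.
  have [k' k'n e'] := cov y yl yr.
  by move: out; rewrite e' (const _ k'n) -(const _ kn) inside.
have pe : adj H (p x) (p (ordS x)) by rewrite i.
case: (ltngtP (p x) (p (ordS x))) => [lt|gt|e].
- by apply: main => //; rewrite !eqxx.
- by rewrite sidepC; apply: main; rewrite ?eqxx ?orbT // adjC.
- by move: pe; rewrite (val_inj e) adjxx.
Qed.

Lemma mem_dihedral n (p : 'S_n) : (2 < n)%N ->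
  (forall x, sidep (p x) (p (ordS x))) -> (forall x, sidep ((p^-1)%g x) ((p^-1)%g (ordS x))) ->
  p \in dihedral n.
Proof.
move=> n2 sp sV; rewrite inE; apply/is_isomP => x y.
rewrite !adj_cycle_graph (inj_eq perm_inj); congr (_ && _).
apply/idP/idP => /orP[/eqP e|/eqP e].
- by have := sV (p x); rewrite -e !permK.
- by have := sV (p y); rewrite -e !permK sidepC.
- by rewrite e.
- by rewrite e sidepC.
Qed.

Lemma polygon_isom_dihedral n (G H : sgraph n) p : (2 < n)%N ->
  polygon G -> polygon H -> is_isom G H p -> p \in dihedral n.
Proof.
move=> n2 pG pH i; apply: mem_dihedral => // x; first exact: polygon_isom_side i.
exact: polygon_isom_side (is_isomV i).
Qed.

Lemma ord_add_ordS n c (x : 'I_n) : ord_add c (ordS x) = ordS (ord_add c x).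
Proof.
apply: val_inj; rewrite /= modnDml -[((x + c) %% n).+1]addn1 modnDml.
by rewrite addSn addn1.
Qed.

Lemma ord_sub_ordS n c (x : 'I_n) : ordS (ord_sub c (ordS x)) = ord_sub c x.
Proof.
have := ltn_ord x => xn; apply: val_inj; rewrite [LHS]/= -[(_ %% n).+1]addn1 modnDml -addnA.
have [xn1|xn1] := ltnP x.+1 n; first by rewrite (modn_small xn1) addn1 subnSK.
have e : x.+1 = n by apply/eqP; rewrite eqn_leq xn xn1.
rewrite e modnn subn0 [RHS]/= (_ : n - x = 1)%N; last by move: e; clear; lia.
by rewrite (addnC n) addnA modnDr.
Qed.

Lemma rot_dihedral n c : (2 < n)%N -> rot_perm n c \in dihedral n.
Proof.
move=> n2; have rS y : rot_perm n c (ordS y) = ordS (rot_perm n c y).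
  by rewrite !permE ord_add_ordS.
apply: mem_dihedral => // x; rewrite /sidep; first by rewrite rS eqxx.
rewrite -(inj_eq (@perm_inj _ (rot_perm n c))) permKV rS permKV eqxx.
by [].
Qed.

Lemma refl_dihedral n c : (2 < n)%N -> refl_perm n c \in dihedral n.
Proof.
move=> n2; have rS y : ordS (refl_perm n c (ordS y)) = refl_perm n c y.
  by rewrite !permE ord_sub_ordS.
apply: mem_dihedral => // x; rewrite /sidep; first by rewrite rS eqxx orbT.
set y := ((refl_perm n c)^-1)%g (ordS x); have yE : refl_perm n c y = ordS x by rewrite permKV.
apply/orP; right; apply/eqP; apply: (@perm_inj _ (refl_perm n c)); rewrite permKV.
by apply: ordS_inj; rewrite rS.
Qed.

(** An automorphism of the cycle is determined by the image of 0 and the direction of its first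
    step: being injective, it cannot turn back when n > 2. *)
Lemma dihedralP n (p : 'S_n) : (2 < n)%N -> p \in dihedral n ->
  exists c : 'I_n, p = rot_perm n c \/ p = refl_perm n c.
Proof.
move=> n2; rewrite inE => /is_isomP pd.
have n0 : (0 < n)%N by lia. have n1 : (1 < n)%N by lia.
pose o := Ordinal n0; exists (p o).
have side x : p (ordS x) = ordS (p x) \/ p x = ordS (p (ordS x)).
  have := pd x (ordS x); rewrite !adj_cycle_graph (inj_eq perm_inj) /sidep eqxx /=.
  have -> : x != ordS x.
    by apply/eqP => /(congr1 (@nat_of_ord n)); rewrite val_ordS; have := ltn_ord x; case: ifP; lia.
  by rewrite !andbT => /orP[]/eqP; [left|right].
have ordSS x : ordS (ordS x) != x :> 'I_n.
  apply/eqP => /(congr1 (@nat_of_ord n)); rewrite !val_ordS.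
  by have := ltn_ord x; do 2 case: ifP; lia.
have ind (P : pred 'I_n) : P o -> (forall x, P x -> P (ordS x)) -> forall x, P x.
  move=> Po PS [k kn]; elim: k kn => [|k IHk] kn.
    by rewrite (_ : Ordinal kn = o) //; apply: val_inj.
  rewrite (_ : Ordinal kn = ordS (Ordinal (ltnW kn))); first exact/PS/IHk.
  by apply: ord_inj; rewrite val_ordS /= kn.
case: (side o) => o1; [left|right].
  have up x : p (ordS x) = ordS (p x).
    apply/eqP; apply: (ind (fun x => p (ordS x) == ordS (p x))) => {x}; first exact/eqP.
    move=> x /eqP IHx; case: (side (ordS x)) => [->//|]; rewrite IHx => /ordS_inj/perm_inj e.
    by have := ordSS x; rewrite -e eqxx.
  apply/permP => x; apply/eqP; apply: (ind (fun x => p x == rot_perm n (p o) x)) => {x}.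
    by rewrite -val_eqE /= rot_permE add0n modn_small.
  by move=> x /eqP e; rewrite up e !permE ord_add_ordS.
have down x : p x = ordS (p (ordS x)).
  apply/eqP; apply: (ind (fun x => p x == ordS (p (ordS x)))) => {x}; first exact/eqP.
  move=> x /eqP IHx; case: (side (ordS x)) => [|->//]; rewrite -IHx => /perm_inj e.
  by have := ordSS x; rewrite e eqxx.
apply/permP => x; apply/eqP; apply: (ind (fun x => p x == refl_perm n (p o) x)) => {x}.
  by rewrite -val_eqE /= refl_permE subn0 modnDr modn_small.
move=> x /eqP e; rewrite -(inj_eq (@ordS_inj n)) -down e !permE ord_sub_ordS.
by [].
Qed.

(** A rotation and a reflection with the same value at 0 differ at 1 because n > 2, so the two
    families are disjoint. *)
Lemma sum_dihedral (V : nmodType) n (F : 'S_n -> V) : (2 < n)%N ->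
  \sum_(p in dihedral n) F p = \sum_(c < n) F (rot_perm n c) + \sum_(c < n) F (refl_perm n c).
Proof.
move=> n2; have n0 : (0 < n)%N by lia. have n1 : (1 < n)%N by lia.
pose o := Ordinal n0; pose i := Ordinal n1.
pose rots := [set rot_perm n c | c : 'I_n]; pose refls := [set refl_perm n c | c : 'I_n].
have rotI : injective (fun c : 'I_n => rot_perm n c).
  move=> b c /(congr1 (fun p : 'S_n => p o : nat)); rewrite !rot_permE !add0n !modn_small //.
  exact: val_inj.
have reflI : injective (fun c : 'I_n => refl_perm n c).
  move=> b c /(congr1 (fun p : 'S_n => p o : nat)); rewrite !refl_permE subn0 !modnDr !modn_small //.
  exact: val_inj.
have -> : dihedral n = rots :|: refls :> {set 'S_n}.
  apply/setP => p; rewrite in_setU; apply/idP/orP => [/(dihedralP n2)[c [->|->]]|].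
  - by left; apply: imset_f.
  - by right; apply: imset_f.
  - by case=> /imsetP[c _ ->]; [apply: rot_dihedral|apply: refl_dihedral].
rewrite (eq_bigl [in [predU rots & refls]]); last by move=> p; rewrite in_setU.
rewrite bigU /=; last first.
  apply/pred0P => p; apply/negP => /andP[/imsetP[b _ ->] /imsetP[c _ e]].
  have := congr1 (fun p : 'S_n => p o : nat) e.
  rewrite /= rot_permE refl_permE add0n subn0 modnDr !modn_small // => /val_inj bc.
  have := congr1 (fun p : 'S_n => p i : nat) e; rewrite /= rot_permE refl_permE bc /=.
  rewrite !modn_wrap; have := ltn_ord c; try lia.
  by do 2 case: ifP; lia.
by rewrite !big_imset //=; move=> b c _ _; [apply: reflI|apply: rotI].
Qed.

Lemma card_dihedral n : (2 < n)%N -> #|dihedral n| = (2 * n)%N.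
Proof.
move=> n2; rewrite -sum1_card sum_dihedral // !sum_nat_const card_ord; lia.
Qed.

Lemma noncrossing_rev n (E : rel 'I_n) : symmetric E -> noncrossing E ->
  noncrossing (fun x y => E (rev_ord x) (rev_ord y)).
Proof.
move=> EC nc a b u v; rewrite EC (EC (rev_ord u)) => Eba Evu.
apply: contra (nc _ _ _ _ Evu Eba) => /and3P[au ub bv] /=.
have := ltn_ord v; clear -au ub bv; lia.
Qed.

(** Splits a reflection into the reversal of the order followed by a rotation, the two moves known
    to preserve noncrossing. *)
Lemma ord_sub_rev n c (x : 'I_n) : ord_sub c x = ord_add c.+1 (rev_ord x).
Proof.
apply: ord_inj => /=; congr (_ %% n)%N; have := ltn_ord x; lia.
Qed.

Lemma noncrossing_dihedral n (E : rel 'I_n) (p : 'S_n) : (2 < n)%N -> p \in dihedral n ->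
  symmetric E -> noncrossing E -> noncrossing (fun x y => E (p x) (p y)).
Proof.
move=> n2 /(dihedralP n2)[c [->|->]] EC nc a b u v; rewrite !permE.
  exact: (noncrossing_rot EC nc).
rewrite !ord_sub_rev.
exact: (noncrossing_rev (fun x y => EC _ _) (noncrossing_rot (c := c.+1) EC nc)).
Qed.

Lemma relabel_polygon n (G : sgraph n) p : (2 < n)%N -> polygon G -> p \in dihedral n ->
  polygon (relabel G p).
Proof.
move=> n2 /polygonP[side nc]; rewrite -groupV => pd; apply/polygonP.
split=> [x|a b u v]; rewrite !adj_relabel; last exact: (noncrossing_dihedral n2 pd (adjC G) nc).
case: (dihedralP n2 pd) => c [->|->]; rewrite !permE; first by rewrite ord_add_ordS.
by rewrite adjC -(ord_sub_ordS c x).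
Qed.

(** * Orbit counting *)

Definition fixed_polygons n (p : 'S_n) : {set sgraph n} :=
  [set H | polygon H && is_isom H H p].

Lemma isomorphic_equiv n (D : {set sgraph n}) : {in D & &, equivalence_rel (@isomorphic n)}.
Proof.
move=> G H K _ _ _; split=> [|GH]; first exact: isomorphic_refl.
apply/idP/idP; first by apply: isomorphic_trans; rewrite isomorphic_sym.
exact: isomorphic_trans.
Qed.

Lemma unlabeled_transversal n (K : pred (sgraph n)) (D := [set G | K G]) :
  is_transversal (unlabeled K) (equivalence_partition (@isomorphic n) D) D.
Proof. exact/transversalP/equivalence_partitionP/isomorphic_equiv. Qed.

Lemma unlabeled_sub n (K : pred (sgraph n)) G : G \in unlabeled K -> K G.
Proof.
move=> GX; have /subsetP/(_ G GX) := transversal_sub (unlabeled_transversal K).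
by rewrite inE.
Qed.

Lemma unlabeled_unique n (K : pred (sgraph n)) H : K H ->
  #|[set G in unlabeled K | isomorphic G H]| = 1%N.
Proof.
move=> KH; have /and3P[partP _ /forall_inP trB] := unlabeled_transversal K.
set D := [set G | K G] in partP trB; set P := equivalence_partition _ _ in partP trB.
have HD : H \in D by rewrite inE.
have coverD : cover P = D by case/and3P: partP => /eqP.
have BP : pblock P H \in P by rewrite pblock_mem ?coverD.
have /eqP <- := trB _ BP; apply: eq_card => G; rewrite !in_setI inE.
apply: andb_id2l => /unlabeled_sub KG.
by rewrite (pblock_equivalence_partition (@isomorphic_equiv n D)) ?inE // isomorphic_sym.
Qed.

(** The polygons isomorphic to a given dissection form a single dihedral orbit, and the stabiliser
    of one of them is its whole automorphism group. Hence 1 / |aut G| is the orbit size divided by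
    2n, and the average over aut G spreads evenly over the orbit. *)
Lemma burnside_dissections n : (2 < n)%N ->
  \sum_(G in unlabeled (@in_D n)) cycle_index (aut_group G) =
  (2 * n)%:R^-1 *: \sum_(p in dihedral n) #|fixed_polygons p|%:R *: cycle_weight p.
Proof.
move=> n2; have in_DE G : @in_D n G = is_dissection G.
  by rewrite /in_D /is_edge; case: eqP => // e; rewrite e in n2.
set X := unlabeled _.
pose W (H : sgraph n) := \sum_(p in aut H) cycle_weight p.
have class G : G \in X ->
    cycle_index (aut_group G) = \sum_(H | polygon H && isomorphic G H) (2 * n)%:R^-1 *: W H.
  move=> /unlabeled_sub; rewrite in_DE => /dissection_polygon[p0]; set H0 := relabel G p0 => pH0.
  have iH0 : is_isom G H0 p0 := is_isom_relabel G p0.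
  have orbE H : (H \in orbit (relabel_action n) (dihedral n) H0) = polygon H && isomorphic G H.
    apply/orbitP/andP => [[p pd <-]|[pH /existsP[p ip]]].
      split; first exact: relabel_polygon.
      by apply/existsP; exists (p0 * p)%g; apply: is_isomM iH0 (is_isom_relabel _ _).
    have i := is_isomM (is_isomV iH0) ip; exists (p0^-1 * p)%g.
      exact: polygon_isom_dihedral i.
    by apply/eqP; rewrite -is_isomE.
  have stabE : ('C_(dihedral n)[H0 | relabel_action n])%g = aut H0.
    apply/setP => p; rewrite in_setI [RHS]mem_aut [RHS]is_isomE.
    apply/andP/eqP => [[_ /astab1P]//|e]; split; last exact/astab1P.
    by apply: (polygon_isom_dihedral n2 pH0 pH0); rewrite is_isomE e.
  have cardE : (#|orbit (relabel_action n) (dihedral n) H0| * #|aut G| = 2 * n)%N.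
    rewrite -card_dihedral // -(card_orbit_stab (relabel_action n) (dihedral n) H0).
    by rewrite stabE /H0 aut_relabel cardJg.
  rewrite (eq_bigl _ _ (fun H => esym (orbE H))) (eq_bigr (fun=> (2 * n)%:R^-1 *: W G)); last first.
    move=> H; rewrite orbE => /andP[_ /existsP[p]]; rewrite is_isomE => /eqP <-.
    by rewrite /W sum_weight_relabel.
  rewrite sumr_const cycle_indexE -scaler_nat scalerA -cardE natrM invfM mulrA mulfV ?mul1r //.
  rewrite Num.Theory.pnatr_eq0; move: cardE; case: #|_| => //; lia.
(* Each polygon is isomorphic to exactly one representative, so the sum over representatives
   collapses to a sum over polygons. *)
rewrite (eq_bigr _ class) (exchange_big_dep (@polygon n)) /=; last by move=> G H _ /andP[].
rewrite (eq_bigr (fun H => (2 * n)%:R^-1 *: W H)) => [|H pH]; last first.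
  rewrite pH /= sumr_const (_ : #|_| = 1%N) //.
  rewrite -(@unlabeled_unique _ (@in_D n) H) ?in_DE ?polygon_dissection //.
  by apply: eq_card => G; rewrite !inE.
rewrite -scaler_sumr; congr (_ *: _).
rewrite /W (exchange_big_dep (mem (dihedral n))) /=; last first.
  by move=> H p pH; rewrite mem_aut; apply: polygon_isom_dihedral.
apply: eq_bigr => p _; rewrite sumr_const -scaler_nat.
rewrite (_ : #|_| = #|fixed_polygons p|) //; apply: eq_card => H.
by rewrite inE unfold_in /= mem_aut.
Qed.

(** * Dissections fixed by a rotation or a reflection *)

(** Turns a count of graphs into a count of independent sets: [u] is encoded by the elements of [s]
    that [f u] marks. The three conditions say that the encoding is injective, has independent
    values, and reaches every independent set. Induction on [s] splits [A] by the mark on the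
    head. *)
Lemma card_nindep (U : finType) (T : eqType) (c : rel T) (f : U -> pred T) (A : {set U}) s :
  symmetric c -> uniq s ->
  {in A &, forall u v, {in s, f u =1 f v} -> u = v} ->
  {in A, forall u, {in s &, forall x y, x != y -> f u x -> f u y -> ~~ c x y}} ->
  (forall P : pred T, {in s &, forall x y, x != y -> P x -> P y -> ~~ c x y} ->
     exists2 u, u \in A & {in s, f u =1 P}) ->
  #|A| = nindep c s.
Proof.
move=> cC; have [n] := ubnP (size s); elim: n A s => // n IHn A [|x s] /= sn.
  move=> _ det _ /(_ pred0)[//|u uA _]; rewrite (_ : A = [set u]) ?cards1 //.
  by apply/setP => v; rewrite inE; apply/idP/eqP => [vA|->//]; apply: det.
move=> /andP[xs us] det ind real; rewrite nindep_cons -(cardsID [set u | f u x] A) addnC.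
rewrite -[in RHS](IHn (A :\: [set u | f u x]) s) //; last first.
- move=> P Pc; have [|u uA uP] := real (predI P (predC1 x)).
    move=> y z ys zs yz /andP[Py yx] /andP[Pz zx].
    have ys' : y \in s by move: ys yx; rewrite inE /=; case: eqP.
    have zs' : z \in s by move: zs zx; rewrite inE /=; case: eqP.
    exact: Pc.
  exists u; first by rewrite !inE uA uP ?mem_head //= eqxx andbF.
  move=> y ys; rewrite uP ?inE ?ys ?orbT //=.
  by case: eqP => [yx|_]; [rewrite -yx ys in xs|rewrite andbT].
- move=> u; rewrite inE => /andP[_ uA] y z ys zs.
  by apply: ind => //; rewrite inE ?ys ?zs orbT.
- move=> u v; rewrite !inE => /andP[ux uA] /andP[vx vA] e; apply: det => // y.
  by rewrite inE => /orP[/eqP->|/e//]; rewrite (negbTE ux) (negbTE vx).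
congr (_ + _); apply: IHn; rewrite ?filter_uniq //.
- by rewrite size_filter; apply: leq_ltn_trans (count_size _ _) sn.
- move=> u v; rewrite !inE => /andP[uA ux] /andP[vA vx] e; apply: det => // y.
  rewrite inE => /predU1P[->|ys]; first by rewrite ux vx.
  have [cxy|cxy] := boolP (c x y); last by apply: e; rewrite mem_filter cxy.
  have xy : x != y by apply: contraNneq xs => ->.
  have no w : w \in A -> f w x -> f w y = false.
    move=> wA wx; apply/negP => wy.
    by have := ind w wA x y; rewrite mem_head inE ys orbT cxy => /(_ isT isT xy wx wy).
  by rewrite !no.
- move=> u; rewrite inE => /andP[uA _] y z; rewrite !mem_filter => /andP[_ ys] /andP[_ zs].
  by apply: ind => //; rewrite inE ?ys ?zs orbT.
move=> P Pc; pose Q y := (y == x) || [&& P y, ~~ c x y & y \in s].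
have [|u uA uQ] := real Q.
  move=> y z _ _ yz; rewrite /Q => /predU1P[yx|/and3P[Py cxy ys]] /predU1P[zx|/and3P[Pz cxz zs]].
  - by rewrite yx zx eqxx in yz.
  - by rewrite yx.
  - by rewrite zx cC.
  - by apply: Pc; rewrite // mem_filter ?cxy ?cxz.
exists u; first by rewrite !inE uA uQ ?mem_head // /Q eqxx.
move=> y; rewrite mem_filter => /andP[cxy ys]; rewrite uQ ?inE ?ys ?orbT // /Q cxy ys !andbT.
by case: eqP => // yx; rewrite -yx ys in xs.
Qed.

(** * Chords and the dissections fixed by a group *)

Definition chord n (x : 'I_n * 'I_n) : nat * nat := (minn x.1 x.2, maxn x.1 x.2).

Definition xcross n : rel ('I_n * 'I_n) := fun x y => cross (chord x) (chord y).

Definition pmap2 n (g : 'S_n) (x : 'I_n * 'I_n) : 'I_n * 'I_n := (g x.1, g x.2).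

Definition swap n (x : 'I_n * 'I_n) : 'I_n * 'I_n := (x.2, x.1).

Lemma xcrossC n : symmetric (@xcross n).
Proof. by move=> x y; apply: crossC. Qed.

Lemma xcross_swap n (x y : 'I_n * 'I_n) : xcross (swap x) y = xcross x y.
Proof. by rewrite /xcross /chord /= minnC maxnC. Qed.

Lemma noncrossingP n (E : rel 'I_n) : symmetric E ->
  noncrossing E <-> forall x y, E x.1 x.2 -> E y.1 y.2 -> ~~ xcross x y.
Proof.
move=> EC; split=> [nc [a b] [u v] /= ab uv|nc a b u v ab uv].
  have ba := ab; rewrite EC in ba; have vu := uv; rewrite EC in vu.
  rewrite /xcross /cross /chord /=.
  case: (leqP a b) => ?; case: (leqP u v) => ?; rewrite negb_or.
  - by rewrite !nc.
  - by rewrite !nc.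
  - by rewrite !nc.
  - by rewrite !nc.
have := nc (a, b) (u, v) ab uv; rewrite /xcross /cross /chord /=; apply: contra.
by move=> /and3P[au ub bv]; rewrite !minnE !maxnE; lia.
Qed.

Lemma xcross_swapr n (x y : 'I_n * 'I_n) : xcross x (swap y) = xcross x y.
Proof. by rewrite xcrossC xcross_swap xcrossC. Qed.

Lemma xcrossxx n (x : 'I_n * 'I_n) : xcross x x = false.
Proof. by rewrite /xcross /cross ltnn. Qed.

(** Dihedral invariance is already known for whole noncrossing graphs; a graph with only these two
    chords as edges carries it over to a single pair. *)
Lemma xcross_dihedral n (p : 'S_n) x y : (2 < n)%N -> p \in dihedral n ->
  xcross (pmap2 p x) (pmap2 p y) = xcross x y.
Proof.
move=> n2; have imp (q : 'S_n) z t : q \in dihedral n ->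
    ~~ xcross z t -> ~~ xcross (pmap2 q z) (pmap2 q t).
  move=> qd zt; pose E (a b : 'I_n) := (a, b) \in [:: z; swap z; t; swap t].
  have EC : symmetric E.
    have swE w a b : ((b, a) == w) = ((a, b) == swap w).
      by case: w => w1 w2; rewrite /swap !xpair_eqE andbC.
    have swK w : swap (swap w) = w by case: w.
    move=> a b; rewrite /E !inE !(swE _ _ b a) !swK !orbA (orbC (_ == swap z)) -!orbA.
    by rewrite (orbC (_ == swap t)).
  have nc : noncrossing E.
    apply/(noncrossingP EC) => -[a b] [u v] /=; rewrite /E !inE => abE uvE.
    by case/or4P: abE => /eqP ->; case/or4P: uvE => /eqP ->;
      rewrite ?xcross_swap ?xcross_swapr ?xcrossxx // xcrossC.
  have := qd; rewrite -groupV => Vd.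
  have /noncrossingP nc' := noncrossing_dihedral n2 Vd EC nc.
  apply: nc' => [a b||]; rewrite /= ?permK; first exact: EC.
    by rewrite /E -surjective_pairing !inE eqxx.
  by rewrite /E -surjective_pairing !inE eqxx !orbT.
move=> pd; apply/idP/idP; apply: contraLR; first exact: imp.
have Vd := pd; rewrite -groupV in Vd => nx.
have := imp _ _ _ Vd nx; rewrite /pmap2 /= !permK.
by case: (x) (y) => ? ? [? ?].
Qed.

Definition fixed_by n (C : {set 'S_n}) : {set sgraph n} :=
  [set H | polygon H && (C \subset aut H)].

Definition orbit_chord n (C : {group 'S_n}) : rel ('I_n * 'I_n) := fun x y =>
  [exists g in C, (y == pmap2 g x) || (y == swap (pmap2 g x))].

Lemma pmap2M n (g h : 'S_n) x : pmap2 (g * h)%g x = pmap2 h (pmap2 g x).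
Proof. by rewrite /pmap2 !permM. Qed.

Lemma pmap21 n (x : 'I_n * 'I_n) : pmap2 1%g x = x.
Proof. by rewrite /pmap2 !perm1; case: x. Qed.

Lemma adj_orbit_chord n (H : sgraph n) (C : {group 'S_n}) x y :
  C \subset aut H -> orbit_chord C x y -> adj H y.1 y.2 = adj H x.1 x.2.
Proof.
move=> /subsetP CH /exists_inP[g /CH]; rewrite mem_aut => /is_isomP gH.
by case/orP => /eqP -> /=; rewrite ?[adj H (g x.2) _]adjC gH.
Qed.

Lemma side_xcross n (x y : 'I_n * 'I_n) : sidep x.1 x.2 -> xcross x y = false.
Proof.
case: x y => [a b] [u v]; rewrite /sidep /xcross /cross /chord /= => s.
have {s} : (b : nat) == ordS a :> nat \/ (a : nat) == ordS b :> nat by case/orP: s; [left|right].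
rewrite !val_ordS; have := ltn_ord u; have := ltn_ord v; have := ltn_ord a; have := ltn_ord b.
move: (u : nat) (v : nat) (a : nat) (b : nat) => {}u {}v {}a {}b.
rewrite !minnE !maxnE => bn an vn un; by case=> /eqP; case: ifP; lia.
Qed.

Lemma orbit_chord_swap n (C : {group 'S_n}) x y :
  orbit_chord C x (swap y) = orbit_chord C x y.
Proof.
apply: eq_existsb => g; rewrite orbC; congr (_ && (_ || _)).
  by case: x y => [x1 x2] [y1 y2]; rewrite /swap /pmap2 /= !xpair_eqE andbC.
by case: x y => [x1 x2] [y1 y2]; rewrite /swap /pmap2 /= !xpair_eqE andbC.
Qed.

Lemma orbit_chord_refl n (C : {group 'S_n}) x : orbit_chord C x x.
Proof. by apply/exists_inP; exists 1%g; rewrite ?group1 // pmap21 eqxx. Qed.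

Lemma orbit_chord_act n (C : {group 'S_n}) (g : 'S_n) x y : g \in C ->
  orbit_chord C x (pmap2 g y) = orbit_chord C x y.
Proof.
move=> gC; have imp (h : 'S_n) z : h \in C -> orbit_chord C x z -> orbit_chord C x (pmap2 h z).
  move=> hC /exists_inP[k kC xk]; apply/exists_inP; exists (k * h)%g; first exact: groupM.
  by rewrite pmap2M; case/orP: xk => /eqP->; rewrite eqxx ?orbT.
apply/idP/idP => [o|]; last exact: imp.
by have := imp g^-1%g _ (groupVr gC) o; rewrite -pmap2M mulgV pmap21.
Qed.

(* s lists one chord for each C-orbit of chords that do not cross each other. *)
Lemma card_fixed_by n (C : {group 'S_n}) (T : eqType) (c : rel T) (r : T -> 'I_n * 'I_n) s :
  (2 < n)%N -> C \subset dihedral n -> symmetric c -> uniq s ->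
  (forall t, t \in s -> ((r t).1 != (r t).2) && ~~ sidep (r t).1 (r t).2) ->
  (forall t g, t \in s -> g \in C -> ~~ xcross (r t) (pmap2 g (r t))) ->
  {in s &, forall t u, orbit_chord C (r t) (r u) -> t = u} ->
  {in s &, forall t u, t != u -> c t u = [exists g in C, xcross (r t) (pmap2 g (r u))]} ->
  (forall x, x.1 != x.2 -> ~~ sidep x.1 x.2 ->
     (forall g, g \in C -> ~~ xcross x (pmap2 g x)) ->
     exists2 t, t \in s & orbit_chord C (r t) x) ->
  #|fixed_by C| = nindep c s.
Proof.
move=> n2 /subsetP Cd cC us chd self rI cE cov.
have sideC g a b : g \in C -> sidep (g a) (g b) && (g a != g b) = sidep a b && (a != b).
  by move=> /Cd; rewrite inE => /is_isomP/(_ a b); rewrite !adj_cycle_graph.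
have ncE (H : sgraph n) : polygon H ->
    forall x y, adj H x.1 x.2 -> adj H y.1 y.2 -> ~~ xcross x y.
  by case/polygonP => _ /(noncrossingP (adjC H)).
apply: (@card_nindep _ _ _ (fun H t => adj H (r t).1 (r t).2)) => //.
- suff sub H K : H \in fixed_by C -> K \in fixed_by C ->
      {in s, forall t, adj H (r t).1 (r t).2 = adj K (r t).1 (r t).2} ->
      forall a b, adj H a b -> adj K a b.
    move=> H K HA KA e; apply/sgraphP => a b.
    apply/idP/idP; first exact: sub.
    by apply: sub => // t ts; rewrite e.
  rewrite !inE => /andP[pH CH] /andP[pK CK] e a b ab.
  have [sK _] := polygonP _ pK.
  have [/orP[]/eqP-> //|nab] := boolP (sidep a b); first by rewrite adjC.
  have [||g gC|t ts o] := cov (a, b) => //=.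
  - by apply: contraTneq ab => ->; rewrite adjxx.
  - apply: (ncE H pH) => //=; have /subsetP/(_ g gC) := CH.
    by rewrite mem_aut => /is_isomP ->.
  have /= aH := adj_orbit_chord CH o; have /= aK := adj_orbit_chord CK o.
  by rewrite aK -e // -aH.
- move=> H; rewrite inE => /andP[pH CH] t u ts us' tu Ht Hu; rewrite cE //.
  apply/exists_inPn => g gC; apply: (ncE H pH) => //=.
  by have /subsetP/(_ g gC) := CH; rewrite mem_aut => /is_isomP ->.
move=> P Pc.
pose Q x := has (fun t => P t && orbit_chord C (r t) x) s.
(* The graph realising [P]: all sides, together with the full orbits of the chosen
   representatives. *)
pose E (a b : 'I_n) := (a != b) && (sidep a b || Q (a, b)).
have EC : symmetric E.
  move=> a b; rewrite /E eq_sym sidepC; congr (_ && (_ || _)).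
  by apply: eq_has => t; rewrite -(orbit_chord_swap C (r t) (a, b)).
have Kg : is_sgraph [set z : 'I_n * 'I_n | E z.1 z.2].
  apply/andP; split; first by apply/forallP => a; rewrite inE /E eqxx.
  by apply/forallP => a; apply/forallP => b; rewrite !inE EC.
pose K := SGraph Kg.
have adjK a b : adj K a b = E a b by rewrite /adj /= inE.
have EP t : t \in s -> E (r t).1 (r t).2 = P t.
  move=> ts; have /andP[ne ns] := chd t ts.
  rewrite /E ne (negbTE ns) /=; apply/hasP/idP => [[u us' /andP[Pu]]|Pt].
    by rewrite -surjective_pairing => /(rI u t us' ts) <-.
  by exists t; rewrite // Pt -surjective_pairing orbit_chord_refl.
exists K; last by move=> t ts; rewrite adjK EP.
rewrite inE; apply/andP; split; last first.
  apply/subsetP => g gC; rewrite mem_aut; apply/is_isomP => a b; rewrite !adjK /E.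
  rewrite (andb_orr _ (sidep (g a) _)) (andb_orr _ (sidep a _)).
  rewrite (andbC (g a != g b) (sidep _ _)) (andbC (a != b) (sidep _ _)) sideC // (inj_eq perm_inj).
  congr (_ || (_ && _)); apply: eq_has => t; congr (_ && _).
  exact: (orbit_chord_act (r t) (a, b) gC).
apply/polygonP; split=> [a|].
  rewrite adjK /E /sidep eqxx andbT; apply/eqP => /(congr1 (@nat_of_ord n)).
  by rewrite val_ordS; case: ifP; have := ltn_ord a; clear -n2; lia.
apply/(noncrossingP (adjC K)) => x y; rewrite !adjK /E.
case/andP=> xn /orP[xs|/hasP[t ts /andP[Pt]]]; first by rewrite side_xcross.
rewrite -surjective_pairing => xo.
case/andP=> yn /orP[ys|/hasP[u us' /andP[Pu]]]; first by rewrite xcrossC side_xcross.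
rewrite -surjective_pairing => yo.
(* Moving both chords back until the first is its representative leaves the crossing unchanged; only
   the relative motion [g] matters. *)
have [g gC ->] : exists2 g, g \in C & xcross x y = xcross (r t) (pmap2 g (r u)).
  case/exists_inP: xo => g gC xg; case/exists_inP: yo => h hC yh.
  exists (h * g^-1)%g; first by rewrite groupM ?groupV.
  rewrite -(xcross_dihedral (r t) _ n2 (Cd _ gC)) -pmap2M mulgKV.
  by case/orP: xg => /eqP->; case/orP: yh => /eqP->; rewrite ?xcross_swap ?xcross_swapr.
have [<-|tu] := eqVneq t u; first exact: self.
apply/negP => tgu; have := Pc t u ts us' tu Pt Pu; rewrite cE // => /exists_inPn/(_ g gC).
by rewrite tgu.
Qed.

Lemma sidepE n (a b : 'I_n) : (1 < n)%N -> sidep a b =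
  [|| b == a.+1 :> nat, a == b.+1 :> nat, (a == 0 :> nat) && (b == n.-1 :> nat) |
      (b == 0 :> nat) && (a == n.-1 :> nat)].
Proof.
move=> n1; have -> : sidep a b = (b == ordS a :> nat) || (a == ordS b :> nat) by [].
rewrite !val_ordS; have := ltn_ord a; have := ltn_ord b.
move: (a : nat) (b : nat) => {}a {}b; clear -n1 => bn an.
by case: ifP => ?; case: ifP => ?; lia.
Qed.

Local Open Scope nat_scope.

Definition minmax (a b : nat) := (minn a b, maxn a b).

Lemma minmaxl a b : a <= b -> minmax a b = (a, b).
Proof. by move=> ab; rewrite /minmax (minn_idPl ab) (maxn_idPr ab). Qed.

Lemma minmaxr a b : b <= a -> minmax a b = (b, a).
Proof. by move=> ba; rewrite /minmax (minn_idPr ba) (maxn_idPl ba). Qed.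

(** In the folded polygon the arc (i, h) stands for the chord from i to its mirror image c - i, and
    any other arc for itself. A crossing of folded arcs must account for the second chord and for
    its mirror image, whose ends are [K'] and [L']. The value 0 in [K'] occurs for k = 0 and c = n,
    where 0 is its own mirror image. *)
Lemma refl_cross_eq n c h i j k l : (c == n.-1) || (c == n) -> 2 < n ->
  2 * h - 2 <= c <= 2 * h - 1 -> (i.+1 < j) && (j <= h) && ~~ ((i == 0) && (j == h)) ->
  [&& k.+2 <= l, l <= h & ~~ ((k == 0) && (l == h))] -> ~~ ((i == k) && (j == l)) ->
  forall J L K' L',
  J = (if j < h then j else c - i) -> L = (if l < h then l else c - k) ->
  K' = (if c - k < n then c - k else 0) -> L' = (if c - L < n then c - L else 0) ->
  cross (i, j) (k, l) = cross (minmax i J) (minmax k L) || cross (minmax i J) (minmax K' L').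
Proof.
move=> H1 H2 H3 /andP[/andP[H4 H5] H6] /and3P[H7 H8 H9] H10 J L K' L' JE LE.
have i2 : i.+2 <= h by lia.
have k2 : k.+2 <= h by lia.
have {H1} cn : n.-1 <= c <= n by lia.
have iJ : i < J by rewrite JE; case: ifP => _; lia.
have kL : k < L by rewrite LE; case: ifP => _; lia.
have Lk : c - L < n by lia.
rewrite Lk => KE L'E; rewrite (minmaxl (ltnW iJ)) (minmaxl (ltnW kL)).
have {KE} KE : K' = c - k /\ k + K' = c \/ c = n /\ k = 0 /\ K' = 0.
  by rewrite KE; case: ifP; lia.
have LL : L' + L = c by rewrite L'E LE; case: ifP; lia.
have cr : cross (i, J) (minmax K' L') -> cross (i, j) (k, l).
  have [KL|KL] := leqP K' L'; rewrite ?(minmaxl KL) ?(minmaxr (ltnW KL)) /cross /=;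
    case: KE => [[? ?]|[? [? ?]]]; move: LE JE; case: (ltnP l h) => ? ?;
    case: (ltnP j h) => ? ?; lia.
apply/idP/orP => [H|[|/cr //]].
  left; move: H LE JE; rewrite /cross /=.
  by case: (ltnP l h) => ? ? ?; case: (ltnP j h) => ? ?; lia.
move: LE JE; rewrite /cross /=.
by case: (ltnP l h) => ? ?; case: (ltnP j h) => ? ?; lia.
Qed.

Local Open Scope ring_scope.

Lemma xcrossE n (x y : 'I_n * 'I_n) : xcross x y = cross (minmax x.1 x.2) (minmax y.1 y.2).
Proof. by []. Qed.

Definition ordm n (n0 : (0 < n)%N) k : 'I_n := Ordinal (ltn_pmod k n0).

Lemma ordmE n (n0 : (0 < n)%N) k : (k < n)%N -> ordm n0 k = k :> nat.
Proof. exact: modn_small. Qed.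

Lemma mem_inner_arcs n i j :
  ((i, j) \in inner_arcs n) = [&& (i.+2 <= j)%N, (j <= n)%N & ~~ ((i == 0) && (j == n))]%N.
Proof. by rewrite mem_filter mem_arcs xpair_eqE /= andbC andbA. Qed.

Lemma uniq_inner_arcs n : uniq (inner_arcs n).
Proof. by rewrite filter_uniq ?uniq_arcs. Qed.

Lemma ndissect_inner n : (0 < n)%N -> ndissect n = nindep cross (inner_arcs n).
Proof. by case: n. Qed.

Lemma orbit_chordP n (C : {group 'S_n}) x y : orbit_chord C x y ->
  exists2 g, g \in C & [/\ (y.1 : nat) = g x.1 & (y.2 : nat) = g x.2] \/
                       [/\ (y.1 : nat) = g x.2 & (y.2 : nat) = g x.1].
Proof.
by case/exists_inP => g gC /orP[]/eqP->; exists g => //; [left|right].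
Qed.

Lemma card_polygons n : (2 < n)%N ->
  #|fixed_by [1 'S_n]%g| = ndissect n.-1.
Proof.
move=> n2; have n0 : (0 < n)%N by lia.
rewrite ndissect_inner; last by lia.
pose r (t : nat * nat) := (ordm n0 t.1, ordm n0 t.2).
have rE i j : (i, j) \in inner_arcs n.-1 -> [/\ (r (i, j)).1 = i :> nat & (r (i, j)).2 = j :> nat].
  by rewrite mem_inner_arcs => /and3P[*]; rewrite !ordmE //=; lia.
apply: (@card_fixed_by n 1%G _ _ r) => //; rewrite ?sub1G ?uniq_inner_arcs //.
- exact: crossC.
- move=> [i j] ij; rewrite -val_eqE sidepE; last by lia.
  have [/= -> ->] := rE _ _ ij; move: ij; rewrite mem_inner_arcs; lia.
- by move=> t g _ /set1gP ->; rewrite pmap21 xcrossxx.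
- move=> [i j] [k l] ij kl /orbit_chordP[g /set1gP->]; rewrite !perm1.
  have [-> ->] := rE _ _ ij; have [-> ->] := rE _ _ kl.
  move: ij kl; rewrite !mem_inner_arcs => ? ? H; congr pair; lia.
- move=> [i j] [k l] ij kl _.
  transitivity (xcross (r (i, j)) (r (k, l))); last first.
    apply/idP/exists_inP => [x|[g /set1gP ->]]; last by rewrite pmap21.
    by exists 1%g; rewrite ?pmap21 ?set1gE ?inE.
  rewrite xcrossE; have [-> ->] := rE _ _ ij; have [-> ->] := rE _ _ kl.
  move: ij kl; rewrite !mem_inner_arcs => /and3P[? _ _] /and3P[? _ _].
  by rewrite !minmaxl //; lia.
move=> [a b] /=; rewrite -val_eqE sidepE /=; last by lia.
have := ltn_ord a; have := ltn_ord b => bn an ab nside _.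
have t_in : (minn a b, maxn a b) \in inner_arcs n.-1.
  by rewrite mem_inner_arcs; lia.
exists (minn a b, maxn a b) => //; apply/exists_inP; exists 1%g; rewrite ?group1 // pmap21.
have [e1 e2] := rE _ _ t_in; move: (r _) e1 e2 => [u v] /= e1 e2.
have [ab'|ba] := leqP a b; apply/orP; [left|right]; apply/eqP; congr pair; apply: ord_inj => /=; lia.
Qed.

Lemma val_refl n c (x : 'I_n) : (c <= n)%N -> refl_perm n c x =
  (if x <= c then (if c - x < n then c - x else 0) else c + (n - x))%N :> nat.
Proof.
move=> cn; rewrite refl_permE; have := ltn_ord x => xn.
have [xc|cx] := leqP x c; last by rewrite modn_small //; lia.
rewrite (_ : c + (n - x) = c - x + n)%N ?modnDr; last by lia.
case: ltnP => [/modn_small //|nc]; rewrite (_ : c - x = n)%N ?modnn //; lia.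
Qed.

Lemma refl_permK n c : (c <= n)%N -> (refl_perm n c * refl_perm n c)%g = 1%g.
Proof.
move=> cn; apply/permP => x; apply: ord_inj; rewrite permM perm1 !val_refl //.
have := ltn_ord x; move: (x : nat) => {}x xn.
by case: (leqP x c) => ?; [case: (ltnP (c - x) n) => ?|]; case: ifP => ?; try case: ifP => ?; lia.
Qed.

Lemma cycle_refl n c g : (c <= n)%N ->
  reflect (g = 1%g \/ g = refl_perm n c) (g \in <[refl_perm n c]>%g).
Proof.
move=> cn; apply: (iffP idP) => [/cycleP[k ->]|[]->]; rewrite ?group1 ?cycle_id //.
rewrite -(odd_double_half k) expgD -mul2n expgM (_ : _ ^+ 2 = 1)%g; last first.
  by rewrite expgS expg1 refl_permK.
by rewrite expg1n mulg1; case: (odd k); [right|left]; rewrite ?expg1 ?expg0.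
Qed.

(* A reflection-symmetric dissection is folded along its axis onto a polygon with h + 1
   vertices, the last of which stands for the reflected half. *)
Lemma card_fixed_refl n c : (2 < n)%N -> c \in [:: n.-1; n] ->
  #|fixed_by <[refl_perm n c]>%g| = ndissect (c./2).+1.
Proof.
move=> n2; rewrite !inE => cn; have n0 : (0 < n)%N by lia.
have cn' : (c <= n)%N by lia.
set h := (c./2).+1; have hc : (2 * h - 2 <= c <= 2 * h - 1)%N by rewrite /h; lia.
rewrite ndissect_inner //.
pose r (t : nat * nat) := (ordm n0 t.1, if (t.2 < h)%N then ordm n0 t.2 else ordm n0 (c - t.1)).
have rE i j : (i, j) \in inner_arcs h ->
    [/\ (r (i, j)).1 = i :> nat & (r (i, j)).2 = (if j < h then j else c - i)%N :> nat].
  rewrite mem_inner_arcs => /and3P[*]; rewrite /r /= modn_small; last by lia.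
  by split=> //; case: ifP => ?; rewrite ordmE //; lia.
clearbody r; have xr (x y : 'I_n * 'I_n) : xcross x y || xcross x (pmap2 (refl_perm n c) y) =
    [exists g in <[refl_perm n c]>%g, xcross x (pmap2 g y)].
  apply/orP/exists_inP => [[]xy|[g /(cycle_refl _ cn')[]-> xy]].
  - by exists 1%g; rewrite ?group1 ?pmap21.
  - by exists (refl_perm n c); rewrite ?cycle_id.
  - by left; rewrite pmap21 in xy.
  - by right.
apply: (@card_fixed_by n _ _ _ r) => //; rewrite ?uniq_inner_arcs //.
- by rewrite cycle_subG refl_dihedral.
- exact: crossC.
- move=> [i j] ij; rewrite -val_eqE sidepE; last by lia.
  have [/= -> ->] := rE _ _ ij; move: ij; rewrite mem_inner_arcs.
  by case: ifP; lia.
- move=> [i j] g ij /(cycle_refl _ cn')[]->; first by rewrite pmap21 xcrossxx.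
  rewrite xcrossE /= !val_refl //; have [-> ->] := rE _ _ ij; move: ij.
  rewrite mem_inner_arcs /minmax /cross /=; clearbody h; clear rE xr r.
  by case: (ltnP j h) => ?; do ?[case: ifP => ?]; lia.
- move=> [i j] [k l] ij kl /orbit_chordP[g gC H].
  suff [-> ->] : i = k /\ j = l by [].
  case/(cycle_refl _ cn'): gC H => ->; rewrite ?perm1 ?val_refl //;
    have [-> ->] := rE _ _ ij; have [-> ->] := rE _ _ kl; move: ij kl;
    rewrite !mem_inner_arcs; clearbody h; clear rE xr r;
    case: (ltnP j h) => ?; case: (ltnP l h) => ? ? ?; do ?[case: ifP => ?]; lia.
- move=> [i j] [k l] ij kl ne; rewrite -xr !xcrossE /= !val_refl //.
  have [-> rt2] := rE _ _ ij; have [-> ru2] := rE _ _ kl.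
  move: ij kl ne; rewrite !mem_inner_arcs xpair_eqE => ij kl ne.
  have kc : (k <= c)%N by lia.
  have Lc : ((r (k, l)).2 <= c)%N by rewrite ru2; case: ifP; lia.
  by rewrite kc Lc; apply: (refl_cross_eq cn n2 hc) ne _ _ _ _ rt2 ru2 _ _ => //; rewrite -andbA.
have orbI g t (a b : 'I_n) : g \in <[refl_perm n c]>%g ->
    (a = g (r t).1 :> nat) /\ (b = g (r t).2 :> nat) \/
    (a = g (r t).2 :> nat) /\ (b = g (r t).1 :> nat) ->
    orbit_chord <[refl_perm n c]> (r t) (a, b).
  move=> gC H; apply/exists_inP; exists g => //; apply/orP.
  by case: H => -[/ord_inj-> /ord_inj->]; [left|right].
suff cov (a b : 'I_n) : (a < b)%N -> ~~ sidep a b ->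
    ~~ xcross (a, b) (pmap2 (refl_perm n c) (a, b)) ->
    exists2 t, t \in inner_arcs h & orbit_chord <[refl_perm n c]> (r t) (a, b).
  move=> [a b] /= ab nside self; case: (ltngtP a b) => [lt|lt|/ord_inj e].
  - by apply: cov => //; apply: self (cycle_id _).
  - have [|||t ts o] := cov b a => //; first by rewrite sidepC.
      by have := self _ (cycle_id _); rewrite -xcross_swap -xcross_swapr.
    by exists t; rewrite // -orbit_chord_swap.
  - by rewrite e eqxx in ab.
rewrite sidepE; last by lia.
rewrite xcrossE /= !val_refl // => ab nside.
have an := ltn_ord a; have bn := ltn_ord b.
have [ac bc] : (a <= c)%N /\ (b <= c)%N by lia.
rewrite ac bc => self; have [bh|hb] := ltnP b h.
  have t : (a : nat, b : nat) \in inner_arcs h by rewrite mem_inner_arcs; lia.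
  exists (a : nat, b : nat) => //; apply: (orbI 1%g); rewrite ?group1 ?perm1 //.
  by have [-> ->] := rE _ _ t; rewrite bh; left.
have cb : (c - (c - b) = b)%N by lia.
(* For c = n the vertex 0 lies on the axis, so a chord from 0 to the far half is the mirror image of
   one to the near half. *)
have [[a0 c_n]|a0] : (a = 0 :> nat /\ c = n) \/ (c - a < n)%N by lia.
  have t : (0, c - b)%N \in inner_arcs h by rewrite mem_inner_arcs; lia.
  exists (0, c - b)%N => //; apply: (orbI (refl_perm n c)); rewrite ?cycle_id //.
  rewrite !val_refl //; have [-> ->] := rE _ _ t.
  have -> : (c - b < h)%N by lia.
  by rewrite subn0 leq_subr cb bn c_n ltnn a0 leq0n; left.
(* With ends on both sides of the axis, a chord crosses its mirror image unless it is its own image,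
   that is, b = c - a. In the other case [a] is on the axis or beyond it, and the mirror image lies
   in the near half. *)
have [ah|ha] := leqP h (c - a).
  have e : (b = c - a :> nat)%N.
    apply/eqP; move: self; rewrite a0 (_ : (c - b < n)%N); last by lia.
    rewrite (minmaxl (ltnW ab)) minmaxr; last by lia.
    by apply: contraNT; rewrite /cross /=; clear -ab hb ah hc ac bc; lia.
  have t : (a : nat, h) \in inner_arcs h by rewrite mem_inner_arcs; lia.
  exists (a : nat, h) => //; apply: (orbI 1%g); rewrite ?group1 ?perm1 //.
  by have [-> ->] := rE _ _ t; rewrite ltnn; left.
have t : (c - b, c - a)%N \in inner_arcs h by rewrite mem_inner_arcs; lia.
exists (c - b, c - a)%N => //; apply: (orbI (refl_perm n c)); rewrite ?cycle_id //.
rewrite !val_refl //; have [-> ->] := rE _ _ t; rewrite ha !leq_subr cb bn.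
by rewrite (_ : c - (c - a) = a)%N ?an; [right|lia].
Qed.

(** * Rotations: chords of the polygon and arcs around the puncture *)

Local Open Scope nat_scope.

Definition wrap n x := if x < n then x else x - n.

(** An arc of length at most m cannot overlap its translate by m or more. Here and below, multiples
    [K] of m enter only through case distinctions and linear bounds, so that all goals stay
    linear. *)
Lemma rot_self_cross n m i l K : 2 * m <= n -> i < m -> 1 < l <= m -> K = 0 \/ m <= K -> K + m <= n ->
  ~~ cross (i, i + l) (minmax (wrap n (i + K)) (wrap n (i + l + K))).
Proof.
move=> nm im lm Km Kn; rewrite /wrap.
case: ltnP => w1; case: ltnP => w2; try (exfalso; lia).
- by rewrite minmaxl /cross /=; lia.
- by rewrite minmaxr /cross /=; lia.
Qed.

(** Only the translates by 0, m and n - m can meet an arc that starts below m and has length at most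
    m; they correspond to the three lifts in [annular_cross]. *)
Lemma rot_cross_annular n m i l j k K : 2 * m <= n -> i < m -> 1 < l <= m -> j < m -> 1 < k <= m ->
  n = 2 * m \/ 3 * m <= n -> K = 0 \/ K = m \/ 2 * m <= K -> K + m = n \/ K + 2 * m <= n ->
  cross (i, i + l) (minmax (wrap n (j + K)) (wrap n (j + k + K))) -> annular_cross m (i, l) (j, k).
Proof.
move=> nm im lm jm km n3 K2 Kn; rewrite /wrap.
case: ltnP => w1; case: ltnP => w2; try (exfalso; lia).
- rewrite minmaxl; last lia. rewrite /cross /= => /orP[]/and3P[h1 h2 h3].
    case: K2 => [K0|[Km|K2]]; last by exfalso; lia.
      by apply/or3P/Or31; rewrite /cross /=; lia.
    by apply/or3P/Or32; rewrite /cross /=; lia.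
  have K0 : K = 0 by lia.
  by apply/or3P/Or31; rewrite /cross /=; lia.
- rewrite minmaxr; last lia. rewrite /cross /= => /orP[]/and3P[h1 h2 h3].
    by apply/or3P/Or33; rewrite /cross /=; lia.
  have Km : K = m by lia.
  by apply/or3P/Or32; rewrite /cross /=; lia.
Qed.

Lemma annular_cross_rot_shift n m i l j k : 2 * m <= n -> i < m -> 1 < l <= m -> j < m -> 1 < k <= m ->
  annular_cross m (i, l) (j, k) ->
  exists2 K, K = 0 \/ K = m \/ K = n - m &
    cross (i, i + l) (minmax (wrap n (j + K)) (wrap n (j + k + K))).
Proof.
move=> nm im lm jm km /or3P[].
- move=> x; exists 0; first by left.
  have [h1 h2 h3] : [/\ j < n, j + k < n & j <= j + k] by split; lia.
  by rewrite /wrap !addn0 h1 h2 minmaxl.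
- move=> x; rewrite /cross /= in x; exists m; first by right; left.
  rewrite /wrap (_ : j + m < n); last by lia.
  by case: ltnP => w; [rewrite minmaxl|rewrite minmaxr]; rewrite /cross /=; lia.
- move=> x; rewrite /cross /= in x; exists (n - m); first by right; right.
  rewrite /wrap (_ : j + (n - m) < n); last by lia.
  by case: ltnP => w; [rewrite minmaxl|rewrite minmaxr]; rewrite /cross /=; lia.
Qed.

Lemma rot_orbit_inj n m i l j k K : 2 * m <= n -> i < m -> 1 < l <= m -> j < m -> 1 < k <= m ->
  K = 0 \/ K = m \/ 2 * m <= K -> K + m <= n ->
  j = wrap n (i + K) /\ j + k = wrap n (i + l + K) \/
  j = wrap n (i + l + K) /\ j + k = wrap n (i + K) -> (i, l) = (j, k).
Proof.
move=> nm im lm jm km K2 Kn; rewrite /wrap => H.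
by suff [-> ->] : i = j /\ l = k by []; move: H; case: ltnP => w1; case: ltnP => w2; lia.
Qed.

(** Shows that a chord of a dissection fixed by the rotation spans at most m sides on its shorter
    side, which is why arcs of length at most m around a puncture suffice. *)
Lemma rot_long_cross n m e l : 2 * m <= n -> 0 < m -> e < n -> m < l -> 2 * l <= n ->
  cross (minmax e (wrap n (e + l))) (minmax (wrap n (e + m)) (wrap n (wrap n (e + l) + m))).
Proof.
move=> nm m0 en ml ln; rewrite /wrap.
case: (ltnP (e + l)) => w1; case: ltnP => w2; case: ltnP => w3; try (exfalso; lia).
- by rewrite !minmaxl /cross /=; lia.
- by rewrite minmaxl ?minmaxr /cross /=; lia.
- by rewrite !minmaxr /cross /=; lia.
- by rewrite minmaxr ?minmaxl /cross /=; lia.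
Qed.

Local Open Scope ring_scope.

Lemma val_rot n K (x : 'I_n) : (K <= n)%N -> rot_perm n K x = wrap n (x + K) :> nat.
Proof. by move=> Kn; rewrite rot_permE modn_wrap //; have := ltn_ord x; lia. Qed.

Lemma cycle_rotP n m g : (0 < n)%N -> (m %| n)%N ->
  reflect (exists K, [/\ (K < n)%N, (m %| K)%N & g = rot_perm n K]) (g \in <[rot_perm n m]>%g).
Proof.
move=> n0 mn; have rot_mod K : rot_perm n K = rot_perm n (K %% n).
  by apply/permP => x; apply: ord_inj; rewrite !rot_permE modnDmr.
apply: (iffP (cycleP _ _)) => [[k ->]|[K [Kn /dvdnP[k ->] ->]]].
  exists ((m * k) %% n)%N; rewrite ltn_pmod // rot_permX -rot_mod; split=> //.
  by rewrite /dvdn modn_dvdm // modnMr.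
by exists k; rewrite rot_permX mulnC.
Qed.

(** The identity must be left out by m < n: its fixed dissections may contain chords of any length,
    since no chord crosses itself. *)
Lemma card_fixed_rot n m : (2 < n)%N -> (m %| n)%N -> (m < n)%N ->
  #|fixed_by <[rot_perm n m]>%g| = nannular m.
Proof.
move=> n2 mn ltmn; have n0 : (0 < n)%N by lia.
have m0 : (0 < m)%N by rewrite (dvdn_gt0 n0).
have mult K : (m %| K)%N -> K = 0%N \/ K = m \/ (2 * m <= K)%N.
  case/dvdnP=> -[|[|k]] ->; [left|right; left|right; right]; rewrite ?mul1n //.
  by rewrite leq_mul2r orbT.
have nm : (2 * m <= n)%N by have := mult n mn; lia.
have comult K : (m %| K)%N -> (K < n)%N -> (K + m = n \/ K + 2 * m <= n)%N.
  by move=> mK Kn; have := mult (n - K)%N; rewrite dvdn_subr ?(ltnW Kn) // => /(_ mK); lia.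
have n3 : (n = 2 * m \/ 3 * m <= n)%N by have := comult m (dvdnn m) ltmn; lia.
pose r (t : nat * nat) := (ordm n0 t.1, ordm n0 (t.1 + t.2)).
have rE i l : (i, l) \in annular_arcs m ->
    [/\ (i < m)%N, (1 < l <= m)%N, (r (i, l)).1 = i :> nat & (r (i, l)).2 = (i + l)%N :> nat].
  rewrite mem_annular_arcs => /and3P[/= im l1 lm].
  by split; rewrite ?l1 /r /= ?modn_small //; lia.
clearbody r; apply: (@card_fixed_by n _ _ _ r) => //; rewrite ?uniq_annular_arcs //.
- by rewrite cycle_subG rot_dihedral.
- exact: annular_crossC.
- move=> [i l] /rE[im lm e1 e2]; rewrite -val_eqE sidepE ?(ltnW n2) // /= e1 e2; clear -im lm n2 nm.
  by lia.
- move=> [i l] g /rE[im lm e1 e2] /(cycle_rotP _ n0 mn)[K [Kn mK ->]].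
  rewrite xcrossE /= !val_rot ?(ltnW Kn) // e1 e2 minmaxl ?leq_addr //.
  by apply: (rot_self_cross nm im lm); have := mult K mK; have := comult K mK Kn; lia.
- move=> [i l] [j k] /rE[im lm e1 e2] /rE[jm km f1 f2] /orbit_chordP[g].
  move=> /(cycle_rotP _ n0 mn)[K [Kn mK ->]].
  rewrite !val_rot ?(ltnW Kn) // e1 e2 f1 f2 => H.
  apply: (rot_orbit_inj nm im lm jm km (mult K mK)); last by case: H => -[h1 h2]; [left|right].
  by have := comult K mK Kn; lia.
- move=> [i l] [j k] /rE[im lm e1 e2] /rE[jm km f1 f2] _.
  apply/idP/exists_inP => [x|[g /(cycle_rotP _ n0 mn)[K [Kn mK ->]]]].
    have [K K3 xK] := annular_cross_rot_shift nm im lm jm km x.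
    have [Kn mK] : (K < n)%N /\ (m %| K)%N.
      by case: K3 => [->|[->|->]]; split; rewrite ?dvdn0 ?dvdnn ?dvdn_subr ?(ltnW ltmn) //; lia.
    exists (rot_perm n K); first by apply/(cycle_rotP _ n0 mn); exists K.
    by rewrite xcrossE /= !val_rot ?(ltnW Kn) // e1 e2 f1 f2 minmaxl ?leq_addr.
  rewrite xcrossE /= !val_rot ?(ltnW Kn) // e1 e2 f1 f2 minmaxl ?leq_addr //.
  exact: (rot_cross_annular nm im lm jm km n3 (mult K mK) (comult K mK Kn)).
move=> [a b] /=; rewrite -val_eqE /= => ab nside self.
(* A chord may be read from either end; it is oriented so that its shorter side, of length [l], runs
   from [e] to [f]. *)
suff cov (e f : 'I_n) l : (1 < l)%N -> (2 * l <= n)%N -> f = wrap n (e + l) :> nat ->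
    (forall g, g \in <[rot_perm n m]>%g -> ~~ xcross (e, f) (pmap2 g (e, f))) ->
    exists2 t, t \in annular_arcs m & orbit_chord <[rot_perm n m]> (r t) (e, f).
  have cov' (e f : 'I_n) : (e < f)%N -> ~~ sidep e f ->
      (forall g, g \in <[rot_perm n m]>%g -> ~~ xcross (e, f) (pmap2 g (e, f))) ->
      exists2 t, t \in annular_arcs m & orbit_chord <[rot_perm n m]> (r t) (e, f).
    rewrite sidepE ?(ltnW n2) // => ef ns sf; have := ltn_ord f => fn.
    have [half|half] := leqP (2 * (f - e)) n.
      by apply: (cov e f (f - e)%N) sf => //; rewrite /wrap; clear -ef ns fn; [lia|case: ifP; lia].
    have [|||g gC|t ts o] := cov f e (n - (f - e))%N.
    - by clear -ef ns fn; lia.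
    - by clear -half fn; lia.
    - by rewrite /wrap; clear -ef fn; case: ifP; lia.
    - by have := sf g gC; rewrite -xcross_swap -xcross_swapr.
    - by exists t; rewrite // -orbit_chord_swap.
  case: (ltngtP a b) => [lt|lt|e].
  - exact: cov'.
  - have [||t ts o] := cov' b a lt; first by rewrite sidepC.
      by move=> g gC; have := self _ gC; rewrite -xcross_swap -xcross_swapr.
    by exists t; rewrite // -orbit_chord_swap.
  - by rewrite e eqxx in ab.
move=> {a b ab nside self} l1 ln fE self; have en := ltn_ord e.
have lm : (l <= m)%N.
  rewrite leqNgt; apply/negP => ml; have := self _ (cycle_id _).
  rewrite xcrossE /= !val_rot ?(ltnW ltmn) // fE.
  by rewrite (rot_long_cross nm m0 en ml ln).
have im : (e %% m < m)%N by rewrite ltn_pmod.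
have t : ((e %% m)%N, l) \in annular_arcs m by rewrite mem_annular_arcs /= im l1 lm.
exists ((e %% m)%N, l) => //; have [_ _ r1 r2] := rE _ _ t.
have eE := divn_eq e m; set K := (e %/ m * m)%N in eE.
have Kn : (K < n)%N by clear -eE en; lia.
apply/exists_inP; exists (rot_perm n K).
  by apply/(cycle_rotP _ n0 mn); exists K; rewrite dvdn_mull.
apply/orP; left; apply/eqP; congr pair; apply: ord_inj; rewrite /= val_rot ?(ltnW Kn) //.
  by rewrite r1 addnC -eE /wrap en.
by rewrite fE r2; congr wrap; clear -eE; lia.
Qed.

Lemma fixed_polygonsE n (p : 'S_n) : fixed_polygons p = fixed_by <[p]>%g.
Proof.
apply/setP => H; rewrite !inE; congr (_ && _).
by rewrite cycle_subG mem_aut.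
Qed.

Lemma card_fixed_polygons_conj n (p q : 'S_n) : (2 < n)%N -> p \in dihedral n ->
  #|fixed_polygons (q ^ p)%g| = #|fixed_polygons q|.
Proof.
move=> n2 pd; have relI : injective (fun H : sgraph n => relabel H p).
  by case: (relabel_is_action n) => inj _; apply: inj.
rewrite -[RHS](card_imset _ relI); apply: eq_card => H.
have sub (K : sgraph n) (u v : 'S_n) : u \in dihedral n ->
    K \in fixed_polygons v -> relabel K u \in fixed_polygons (v ^ u)%g.
  move=> ud; rewrite !inE => /andP[pK iK]; rewrite relabel_polygon //=.
  by rewrite -mem_aut aut_relabel memJ_conjg mem_aut.
have relM (p1 p2 : 'S_n) : relabel H (p1 * p2)%g = relabel (relabel H p1) p2.
  apply/eqP; rewrite -is_isomE.
  exact: is_isomM (is_isom_relabel H p1) (is_isom_relabel _ p2).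
apply/idP/imsetP => [Hf|[K Kf ->]]; last exact: sub.
exists (relabel H p^-1%g).
  by have := sub H p^-1%g _ _ Hf; rewrite groupV conjgK; apply.
rewrite -relM mulVg; apply/esym/eqP; rewrite -is_isomE; exact: is_isom1.
Qed.

(** * Cycle types, and the contribution of each symmetry *)

Lemma porbits_partition n (p : 'S_n) : partition (porbits p) [set: 'I_n].
Proof.
have -> : porbits p = preim_partition (porbit p) [set: 'I_n].
  apply/setP => C; apply/imsetP/imsetP => -[x _ ->]; exists x; rewrite ?inE //;
    by apply/setP => y; rewrite !inE eq_porbit_mem porbit_sym.
exact: preim_partitionP.
Qed.

Lemma cycle_weight_cycle n (p q : 'S_n) : <[p]>%g = <[q]>%g -> cycle_weight p = cycle_weight q.
Proof.
move=> pq; have e : porbits p = porbits q.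
  by apply: eq_imset => x; rewrite !porbit.unlock pq.
by apply: eq_bigr => k _; rewrite /num_cycles e.
Qed.

Lemma cycle_weight_uniform n (p : 'S_n) d : (0 < n)%N -> (0 < d)%N ->
  (forall x, #|porbit p x| = d) -> cycle_weight p = 's_d ^+ (n %/ d).
Proof.
move=> n0 d0 pd; have porbd : {in porbits p, forall C : {set 'I_n}, #|C| = d}.
  by move=> C /imsetP[x _ ->].
have := card_uniform_partition porbd (porbits_partition p); rewrite cardsT card_ord => nE.
have nd : (n %/ d)%N = #|porbits p|.
  by have := congr1 (fun k => k %/ d)%N nE; rewrite mulnK.
have nc k : num_cycles k p = if k == d then (n %/ d)%N else 0%N.
  rewrite /num_cycles; case: eqP => [->|kd].
    rewrite nd; apply: eq_card => C; rewrite inE.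
    by case CP: (C \in _) => //=; rewrite porbd ?eqxx.
  apply: eq_card0 => C; rewrite !inE; apply/negP => /andP[/porbd -> /eqP].
  by apply: nesym.
have dn : (d <= n)%N by rewrite nE leq_pmull //; move: n0; rewrite {1}nE; case: #|_|.
rewrite /cycle_weight (bigD1_seq d) ?iota_uniq ?mem_index_iota ?d0 //= nc eqxx.
by rewrite big1 ?mulr1 // => k kd; rewrite nc (negbTE kd) expr0.
Qed.

Lemma cycle_weight_invol n (p : 'S_n) f : (2 < n)%N -> (p * p = 1)%g ->
  #|[set x | p x == x]| = f -> cycle_weight p = 's_1 ^+ f * 's_2 ^+ ((n - f)./2).
Proof.
move=> n2 pp fE; have ppx x : p (p x) = x by rewrite -permM pp perm1.
have orb x : porbit p x = [set x; p x].
  apply/setP => y; rewrite !inE; apply/porbitP/orP => [[i ->]|[]/eqP->].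
  - rewrite permX; elim: i => [|i IHi]; first by left.
    by rewrite iterS; case: IHi => /eqP ->; [right|left]; rewrite ?ppx.
  - by exists 0%N; rewrite expg0 perm1.
  - by exists 1%N; rewrite expg1.
have cardo x : #|porbit p x| = (if p x == x then 1 else 2)%N.
  by rewrite orb cards2 eq_sym; case: eqP.
have nc1 : num_cycles 1 p = f.
  rewrite -fE /num_cycles -(card_in_imset (f := porbit p)) => [|x y]; last first.
    rewrite 2!inE !orb => /eqP px /eqP py; rewrite px py !setUid; exact: set1_inj.
  apply: eq_card => C; rewrite inE; apply/andP/imsetP => [[/imsetP[x _ ->]]|[x]].
    by rewrite cardo; case: (eqVneq (p x) x) => // px _; exists x; rewrite ?inE ?px.
  by rewrite inE => px ->; rewrite cardo px imset_f.
have nE : n = (f + 2 * num_cycles 2 p)%N.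
  have := card_partition (porbits_partition p); rewrite cardsT card_ord => {1}->.
  rewrite (bigID (fun C : {set 'I_n} => #|C| == 1%N)) /= -nc1 /num_cycles; congr (_ + _)%N.
    rewrite (eq_bigr (fun=> 1%N)) => [|C /andP[_ /eqP//]]; rewrite sum_nat_const muln1.
    by apply: eq_card => C; rewrite !inE.
  rewrite (eq_bigr (fun=> 2%N)) => [|C /andP[/imsetP[x _ ->]]]; last by rewrite cardo; case: ifP.
  rewrite sum_nat_const mulnC; congr (_ * _)%N; apply: eq_card => C; rewrite unfold_in inE.
  by case CP: (C \in _) => //=; case/imsetP: CP => x _ ->; rewrite cardo; case: ifP.
have nc2 : num_cycles 2 p = ((n - f)./2)%N by lia.
have [h1 h2] : (1 < n.+1)%N /\ (2 < n.+1)%N by split; lia.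
rewrite /cycle_weight (big_ltn h1) (big_ltn h2) nc1 nc2 mulrA big1_seq ?mulr1 // => k.
rewrite mem_index_iota => /andP[_ /andP[k3 _]]; rewrite /num_cycles eq_card0 ?expr0 // => C.
rewrite !inE; apply/negP => /andP[/imsetP[x _ ->] /eqP]; rewrite cardo; case: ifP => _ e; lia.
Qed.

Lemma rot_perm_eq1 n K : (0 < n)%N -> (rot_perm n K == 1%g) = (n %| K)%N.
Proof.
move=> n0; apply/eqP/idP => [/permP/(_ (Ordinal n0))/(congr1 (@nat_of_ord n))|nK].
  by rewrite rot_permE perm1 add0n /= => /eqP.
apply/permP => x; apply: ord_inj; rewrite rot_permE perm1.
by rewrite -modnDmr (eqP nK) addn0 modn_small.
Qed.

(** The fixed dissections and the cycle monomial depend only on the cyclic group generated, so each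
    rotation may be replaced by one whose amount divides n. *)
Lemma cycle_rot_gcd n c : (0 < n)%N -> <[rot_perm n c]>%g = <[rot_perm n (gcdn c n)]>%g.
Proof.
move=> n0; apply/eqP; rewrite eqEsubset !cycle_subG; apply/andP; split.
  have /dvdnP[k kE] := dvdn_gcdl c n.
  by apply/cycleP; exists k; rewrite rot_permX mulnC -kE.
have [a _ na] := Bezoutl c n0; rewrite gcdnC in na.
have : (rot_perm n (gcdn c n) * rot_perm n c ^+ a)%g = 1%g.
  by apply/eqP; rewrite rot_permX rot_permD rot_perm_eq1 // mulnC.
by move/(canRL (mulgK _)) => ->; rewrite mul1g groupV mem_cycle.
Qed.

Lemma card_porbit_rot n m x : (0 < n)%N -> (m %| n)%N ->
  #|porbit (rot_perm n m) x| = (n %/ m)%N.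
Proof.
move=> n0 mn; have m0 : (0 < m)%N by rewrite (dvdn_gt0 n0).
have -> : #|porbit (rot_perm n m) x| = #[rot_perm n m]%g.
  rewrite porbit.unlock card_in_imset ?orderE // => g h.
  move=> /(cycle_rotP _ n0 mn)[K [Kn _ ->]] /(cycle_rotP _ n0 mn)[L [Ln _ ->]].
  move/(congr1 (@nat_of_ord n))/eqP; rewrite /aperm /= !rot_permE eqn_modDl !modn_small //.
  by move/eqP->.
apply/eqP; rewrite eqn_dvd; apply/andP; split.
  by rewrite order_dvdn rot_permX rot_perm_eq1 // mulnC divnK.
rewrite -(dvdn_pmul2r m0) divnK // mulnC -rot_perm_eq1 // -rot_permX expg_order.
by [].
Qed.

Lemma cycle_weight_rot n m : (0 < n)%N -> (m %| n)%N ->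
  cycle_weight (rot_perm n m) = 's_(n %/ m) ^+ m.
Proof.
move=> n0 mn; have m0 : (0 < m)%N by rewrite (dvdn_gt0 n0).
have d0 : (0 < n %/ m)%N by rewrite divn_gt0 // dvdn_leq.
rewrite (cycle_weight_uniform n0 d0) => [|x]; last exact: card_porbit_rot.
by rewrite divnA // mulKn.
Qed.

(** Here m is the gcd of n and the rotation amount; m = n is the identity, the one rotation not
    described by annular systems. *)
Definition rot_term n m : fps :=
  (if m == n then ndissect n.-1 else nannular m)%:R *: 's_(n %/ m) ^+ m.

Lemma fixed_rot_term n c : (2 < n)%N ->
  #|fixed_polygons (rot_perm n c)|%:R *: cycle_weight (rot_perm n c) = rot_term n (gcdn c n).
Proof.
move=> n2; have n0 : (0 < n)%N by lia.
rewrite fixed_polygonsE (cycle_weight_cycle (cycle_rot_gcd c n0)) cycle_rot_gcd //.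
rewrite cycle_weight_rot ?dvdn_gcdr // /rot_term; case: eqP => [->|/eqP mn].
  have -> : <[rot_perm n n]>%g = 1%g.
    by apply/eqP; rewrite cycle_eq1 rot_perm_eq1.
  by rewrite card_polygons.
rewrite card_fixed_rot ?dvdn_gcdr //.
by rewrite ltn_neqAle mn dvdn_leq ?dvdn_gcdr.
Qed.

(** The c < n with gcd n / d are the multiples (n / d) e with e < d coprime to d, which is where the
    totient comes from. *)
Lemma sum_gcd (V : nmodType) n (F : nat -> V) : (0 < n)%N ->
  \sum_(c < n) F (gcdn c n) = \sum_(d < n.+1 | (d %| n)%N) F (n %/ d)%N *+ totient d.
Proof.
move=> n0; pose g (c : 'I_n) : 'I_n.+1 := inord (n %/ gcdn c n).
have gcd0 (c : 'I_n) : (0 < gcdn c n)%N by rewrite gcdn_gt0 n0 orbT.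
have gE (c : 'I_n) : g c = (n %/ gcdn c n)%N :> nat by rewrite inordK // ltnS leq_div.
rewrite (partition_big g (fun d : 'I_n.+1 => (d %| n)%N)) /=; last first.
  by move=> c _; rewrite gE; apply/dvdnP; exists (gcdn c n); rewrite mulnC divnK ?dvdn_gcdr.
apply: eq_bigr => d dn; have d0 := dvdn_gt0 n0 dn.
have dd k : (k %| n)%N -> (n %/ (n %/ k) = k)%N by move=> kn; rewrite divnA // mulKn.
pose m := (n %/ d)%N; have nE : (m * d = n)%N by rewrite divnK.
have m0 : (0 < m)%N by rewrite divn_gt0 // dvdn_leq.
have gd c : (g c == d) = (gcdn c n == m).
  rewrite -val_eqE /= gE; apply/eqP/eqP => e; last by rewrite e dd.
  by rewrite /m -e dd ?dvdn_gcdr.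
rewrite (eq_bigr (fun=> F m)) => [|c]; last by rewrite gd => /eqP ->.
rewrite sumr_const; congr (_ *+ _).
have lt (c : 'I_d) : (m * c < n)%N by rewrite -[X in (_ < X)%N]nE ltn_pmul2l.
pose h (c : 'I_d) : 'I_n := Ordinal (lt c).
have hI : injective h.
  by move=> a b /(congr1 (@nat_of_ord n)) /eqP; rewrite /= eqn_pmul2l // => /eqP /ord_inj.
have -> : totient d = #|[set c : 'I_d | coprime d c]|.
  rewrite totient_count_coprime big_mkord -sum1dep_card [RHS]big_mkcond /=.
  by apply: eq_bigr => c _; case: coprime.
rewrite -[RHS](card_imset _ hI); apply: eq_card => c; rewrite unfold_in -[eqn _ _]/(g c == d) gd.
have gm (e : 'I_d) : gcdn (h e) n = (m * gcdn d e)%N.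
  by rewrite -[X in gcdn _ X]nE -muln_gcdr gcdnC.
apply/eqP/imsetP => [e|[e + ->]]; last first.
  by rewrite inE gm => /eqP ->; rewrite muln1.
have mc : (m %| c)%N by rewrite -e dvdn_gcdl.
have cd : (c %/ m < d)%N by rewrite ltn_divLR // mulnC nE.
have cE : c = h (Ordinal cd) by apply: ord_inj; rewrite /= mulnC divnK.
exists (Ordinal cd) => //; rewrite inE /coprime -(eqn_pmul2l m0) -gm -cE e muln1.
by [].
Qed.

(** Conjugating by a rotation shifts c by an even amount, so every reflection reduces to c = n - 1
    or c = n, the two axes for which the folding is done. *)
Lemma refl_perm_conj n b c c' : (c + 2 * b = c' %[mod n])%N ->
  (refl_perm n c ^ rot_perm n b)%g = refl_perm n c'.
Proof.
move=> cb; rewrite conjgE; apply: (canLR (mulKg _)); apply/permP => x; apply: ord_inj.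
rewrite !permM rot_permE !refl_permE rot_permE modnDml.
set y := ((x + b) %% n)%N; have yn : (y < n)%N by rewrite ltn_pmod // (ord_gt0 x).
have xn := ltn_ord x; apply/eqP; rewrite -(eqn_modDr (x + y)).
have -> : (c + (n - x) + b + (x + y) = n + (y + (c + b)))%N by lia.
have -> : (c' + (n - y) + (x + y) = n + (x + c'))%N by lia.
have -> : ((n + (x + c')) %% n = (x + (c + 2 * b)) %% n)%N.
  by rewrite modnDl -modnDmr -cb modnDmr.
by rewrite modnDl /y modnDml; apply/eqP; congr (_ %% n)%N; lia.
Qed.

Definition refl_fixed n c : nat := #|[set x | refl_perm n c x == x]|.

(** Fixed vertices solve 2x = c modulo n. There is one solution for odd n; for even n the solutions
    are 0 and n / 2 if c = n, and none if c = n - 1. *)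
Lemma refl_fixed_axis n c : (2 < n)%N ->
  c \in [:: n.-1; n] -> refl_fixed n c =
  (if odd n then 1 else if c == n then 2 else 0)%N.
Proof.
move=> n2; rewrite !inE => cn; have n0 : (0 < n)%N by lia.
have cn' : (c <= n)%N by lia.
have fE (x : 'I_n) : (refl_perm n c x == x) = (2 * x == c)%N || (c == n) && (x == 0 :> nat).
  rewrite -val_eqE /= val_refl //; have := ltn_ord x; move: (x : nat) => {}x xn.
  by case: ifP => h1; try case: ifP => h2; lia.
have [on|en] := boolP (odd n).
  pose k := if c == n then 0%N else c./2.
  have kn : (k < n)%N by rewrite /k; case: ifP => _; lia.
  rewrite -(cards1 (Ordinal kn)); apply: eq_card => x; rewrite !inE fE -val_eqE /=.
  by rewrite /k; have := ltn_ord x; case: ifP; lia.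
have [ecn|necn] := eqVneq c n; last first.
  by apply: eq_card0 => x; rewrite !inE fE (negbTE necn) /=; move: cn; rewrite (negbTE necn) orbF; lia.
have kn : (n./2 < n)%N by lia.
have -> : 2%N = #|[set Ordinal n0; Ordinal kn]|.
  by rewrite cards2 -val_eqE /= (_ : (0 != n./2)%N) //; lia.
apply: eq_card => x; rewrite !inE fE -!val_eqE /=; lia.
Qed.

Definition refl_term n c : fps :=
  (ndissect (c./2).+1)%:R *: ('s_1 ^+ refl_fixed n c * 's_2 ^+ ((n - refl_fixed n c)./2)).

Lemma fixed_refl_term n c : (2 < n)%N -> (c < n)%N ->
  #|fixed_polygons (refl_perm n c)|%:R *: cycle_weight (refl_perm n c) =
  refl_term n (if odd c == odd n then n else n.-1).
Proof.
move=> n2 cn; set c0 := if _ then _ else _.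
have c0n : c0 \in [:: n.-1; n] by rewrite /c0; case: ifP => _; rewrite !inE eqxx ?orbT.
have c0n' : (c0 <= n)%N by move: c0n; rewrite !inE; lia.
(* The difference [c0 - c] is even, and this choice makes [c0 + 2 * b] equal to [c + n + n] without
   any subtraction below zero. *)
pose b := (n - (c0 - c)./2)%N.
have e : (c0 + 2 * b = c %[mod n])%N.
  rewrite (_ : c0 + 2 * b = c + n + n)%N ?modnDr //.
  by rewrite /b /c0; case: ifP; lia.
rewrite -(refl_perm_conj e) cycle_weight_conj card_fixed_polygons_conj ?rot_dihedral //.
rewrite fixed_polygonsE card_fixed_refl // (@cycle_weight_invol _ _ (refl_fixed n c0)) //.
exact: refl_permK.
Qed.

(* Unification must never be asked to compare distinct variables, which would unfold them. *)
Lemma eq_scale_mono (s t : fps) a b i j k l : a = b -> i = j -> k = l ->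
  a%:R *: (s ^+ i * t ^+ k) = b%:R *: (s ^+ j * t ^+ l).
Proof. by move=> -> -> ->. Qed.

Lemma sum_refl_odd n : (2 < n)%N -> odd n ->
  \sum_(c < n) #|fixed_polygons (refl_perm n c)|%:R *: cycle_weight (refl_perm n c) =
  (n * ndissect (n./2).+1)%:R *: ('s_1 * 's_2 ^+ n./2).
Proof.
move=> n2 on; rewrite (eq_bigr (fun=> (ndissect (n./2).+1)%:R *: ('s_1 * 's_2 ^+ n./2))).
  by rewrite sumr_const card_ord -scaler_nat scalerA natrM.
move=> c _; rewrite fixed_refl_term // /refl_term refl_fixed_axis //; last first.
  by case: ifP => _; rewrite !inE eqxx ?orbT.
rewrite -[in RHS](expr1 's_1); apply: eq_scale_mono; rewrite ?on //; last by lia.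
by case: ifP => _; congr ndissect; lia.
Qed.

(** For even n the axes alternate: through two sides for odd c, through two vertices for even c. *)
Lemma sum_refl_even n : (2 < n)%N -> ~~ odd n ->
  \sum_(c < n) #|fixed_polygons (refl_perm n c)|%:R *: cycle_weight (refl_perm n c) =
  (n./2)%:R *: ((ndissect n./2)%:R *: 's_2 ^+ n./2 +
                (ndissect (n./2).+1)%:R *: ('s_1 ^+ 2 * 's_2 ^+ (n./2).-1)).
Proof.
move=> n2 en; pose A c := if odd c then (ndissect n./2)%:R *: 's_2 ^+ n./2 else
  (ndissect (n./2).+1)%:R *: ('s_1 ^+ 2 * 's_2 ^+ (n./2).-1) : fps.
transitivity (\sum_(c < n) A c).
  apply: eq_bigr => c _; rewrite fixed_refl_term // /refl_term refl_fixed_axis //; last first.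
    by case: ifP => _; rewrite !inE eqxx ?orbT.
  rewrite /A (negbTE en) eqbF_neg; case: (odd c).
    rewrite -[if ~~ true then n else _]/(n.-1) -[RHS](mul1r (_ *: _)) -(expr0 's_1) -scalerAr.
    have [e1 e2] : (n.-1 == n) = false /\ ((n.-1)./2).+1 = n./2 by split; lia.
    by apply: eq_scale_mono; rewrite ?e1 ?e2 ?subn0.
  rewrite -[if ~~ false then n else _]/n eqxx; apply: eq_scale_mono => //; lia.
have nE : n = (n./2 * 2)%N by lia.
suff S k : \sum_(c < k * 2) A c = k%:R *: (A 1%N + A 0%N)
  by rewrite -(big_mkord xpredT A) [in LHS]nE big_mkord S.
elim: k => [|k IHk]; first by rewrite big_ord0 scale0r.
rewrite mulSn !addSn add0n 2!big_ord_recr /= IHk /A /= !oddM andbF /=.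
by rewrite -addrA -natr1 scalerDl scale1r [X in _ = _ + X]addrC.
Qed.

Definition refl_sum n : fps := (2 * n)%:R^-1 *:
  if odd n then (n * ndissect (n./2).+1)%:R *: ('s_1 * 's_2 ^+ n./2)
  else (n./2)%:R *: ((ndissect n./2)%:R *: 's_2 ^+ n./2 +
                (ndissect (n./2).+1)%:R *: ('s_1 ^+ 2 * 's_2 ^+ (n./2).-1)).

Lemma sum_unlabeled_dissections n : (2 < n)%N ->
  \sum_(G in unlabeled (@in_D n)) cycle_index (aut_group G) =
  (2 * n)%:R^-1 *: (\sum_(d < n.+1 | (d %| n)%N) rot_term n (n %/ d)%N *+ totient d) + refl_sum n.
Proof.
move=> n2; have n0 : (0 < n)%N by lia.
rewrite burnside_dissections // sum_dihedral // scalerDr; congr (_ *: _ + _ *: _).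
  rewrite -(sum_gcd (rot_term n) n0); apply: eq_bigr => c _; exact: fixed_rot_term.
by case: ifP => [on|/negbT en]; [apply: sum_refl_odd|apply: sum_refl_even].
Qed.

Lemma sum_unlabeled_small n : (n < 2)%N ->
  \sum_(G in unlabeled (@in_D n)) cycle_index (aut_group G) = 0.
Proof.
move=> n2; apply: big_pred0 => G; apply/negP => /unlabeled_sub.
rewrite /in_D /is_edge /is_dissection; lia.
Qed.

Lemma sum_unlabeled_edge :
  \sum_(G in unlabeled (@in_D 2)) cycle_index (aut_group G) = 2^-1 *: ('s_1 ^+ 2 + 's_2).
Proof.
pose i0 : 'I_2 := ord0; pose i1 : 'I_2 := ord_max.
have ord2 (x : 'I_2) : x = i0 \/ x = i1.
  by case: x => -[|[|//]] i; [left|right]; apply: ord_inj.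
have edge G : in_D G -> forall x y : 'I_2, adj G x y = (x != y).
  rewrite /in_D orbF => /existsP[a /existsP[b ab]] x y.
  have ne : a != b by apply: contraTneq ab => ->; rewrite adjxx.
  have [xy|xy] := eqVneq x y; first by rewrite xy adjxx.
  have [[-> ->]|[-> ->]] : (x = a /\ y = b) \/ (x = b /\ y = a).
    by move: ne xy; case: (ord2 a) (ord2 b) (ord2 x) (ord2 y) => -> [] -> [] -> [] ->; auto.
  - by rewrite ab.
  - by rewrite adjC ab.
have K2g : is_sgraph [set z : 'I_2 * 'I_2 | z.1 != z.2].
  apply/andP; split; first by apply/forallP => x; rewrite inE eqxx.
  by apply/forallP => x; apply/forallP => y; rewrite !inE /= (eq_sym x).
pose K := SGraph K2g.
have adjK x y : adj K x y = (x != y) by rewrite /adj /= inE.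
have KD : in_D K by apply/orP; left; apply/existsP; exists i0; apply/existsP; exists i1; rewrite adjK.
have -> : unlabeled (@in_D 2) = [set K].
  apply/setP => G; rewrite inE; apply/idP/eqP => [/unlabeled_sub GD|->].
    by apply/sgraphP => x y; rewrite adjK edge.
  have /eqP/cards1P[H /setP HE] := unlabeled_unique KD.
  have := HE H; rewrite !inE eqxx => /andP[HX _]; have HD := unlabeled_sub HX.
  have -> : K = H by apply/sgraphP => x y; rewrite adjK edge.
  exact: HX.
rewrite big_set1 cycle_indexE /=.
have autK : aut K = [set rot_perm 2 2; rot_perm 2 1].
  apply/setP => p; rewrite mem_aut !inE; apply/idP/orP => [_|_]; last first.
    by apply/is_isomP => x y; rewrite !adjK (inj_eq perm_inj).
  have pP (q : 'S_2) : p i0 = q i0 -> p == q.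
    move=> e; apply/eqP/permP => x; case: (ord2 x) => -> //.
    have := perm_inj (s := p) (x1 := i0) (x2 := i1); have := perm_inj (s := q) (x1 := i0) (x2 := i1).
    by case: (ord2 (p i0)) (ord2 (p i1)) (ord2 (q i0)) (ord2 (q i1)) e => -> [] -> [] -> [] -> //;
      intuition.
  by case: (ord2 (p i0)) => e; [left|right]; apply: pP; rewrite e; apply: ord_inj; rewrite rot_permE.
have ne : rot_perm 2 2 != rot_perm 2 1.
  by apply/eqP => /permP/(_ i0)/(congr1 (@nat_of_ord 2)); rewrite !rot_permE.
rewrite autK cards2 ne big_setU1 ?inE //= big_set1.
by rewrite !cycle_weight_rot // expr1.
Qed.

(** * Formal power series *)

From mathcomp Require Import finmap boolp classical_sets cardinality fsbigop monalg.

Local Notation mon := {cmonom nat}.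
Local Notation one := (onecm nat).

Lemma mem_antidiag (m : mon) p :
  (p \in fset_set (antidiag m)) = (mulcm p.1 p.2 == m).
Proof. by rewrite (in_fset_set (finite_antidiag m)); apply/idP/eqP; rewrite inE. Qed.

Lemma mdeg_mulcm (m d : mon) : mdeg (mulcm m d) = (mdeg m + mdeg d)%N.
Proof. exact: mdegM. Qed.

Lemma fcoefM (f g : fps) m :
  fcoef (f * g) m = \sum_(p <- fset_set (antidiag m)) fcoef f p.1 * fcoef g p.2.
Proof. exact: fcoef_mul. Qed.

Lemma fcoefD (f g : fps) m : fcoef (f + g) m = fcoef f m + fcoef g m.
Proof. by []. Qed.

Lemma fcoefN (f : fps) m : fcoef (- f) m = - fcoef f m.
Proof. by []. Qed.

Lemma fcoefZ a (f : fps) m : fcoef (a *: f) m = a * fcoef f m.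
Proof. by []. Qed.

Lemma fcoef1 m : fcoef 1 m = (m == one)%:R.
Proof. by []. Qed.

Lemma fcoef_sum I r (P : pred I) (F : I -> fps) m :
  fcoef (\sum_(i <- r | P i) F i) m = \sum_(i <- r | P i) fcoef (F i) m.
Proof. by apply: (big_morph (fcoef^~ m)). Qed.

Lemma fcoefM0 (f g : fps) : fcoef (f * g) one = fcoef f one * fcoef g one.
Proof.
rewrite fcoefM (big_fsetD1 (one, one)) /=; last by rewrite mem_antidiag /= mul0cm.
rewrite big_seq big1 ?addr0 // => -[a b].
rewrite in_fsetD1 mem_antidiag /= => /andP[ne /eqP/mulcm_eq0[a1 b1]].
by rewrite a1 b1 eqxx in ne.
Qed.

(** * The Euler derivation, and substitution into univariate series *)

(** This is the sum of the operators s_k d/ds_k. It is a derivation, and over the rationals it kills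
    only constants, so an identity may be checked after applying it. *)
Definition euler (f : fps) : fps := Fps (fun m => (mdeg m)%:R * fcoef f m).

Lemma fcoef_euler f m : fcoef (euler f) m = (mdeg m)%:R * fcoef f m.
Proof. by []. Qed.

Lemma eulerD f g : euler (f + g) = euler f + euler g.
Proof. by apply/fpsP => m /=; rewrite mulrDr. Qed.

Lemma eulerN f : euler (- f) = - euler f.
Proof. by apply/fpsP => m /=; rewrite mulrN. Qed.

Lemma eulerB f g : euler (f - g) = euler f - euler g.
Proof. by rewrite eulerD eulerN. Qed.

Lemma eulerZ a f : euler (a *: f) = a *: euler f.
Proof. by apply/fpsP => m /=; rewrite mulrCA. Qed.

Lemma eulerM f g : euler (f * g) = euler f * g + f * euler g.
Proof.
apply/fpsP => m; rewrite fcoefD fcoef_euler !fcoefM -big_split mulr_sumr.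
rewrite big_seq [RHS]big_seq; apply: eq_bigr => -[a b]; rewrite mem_antidiag /= => /eqP<-.
by rewrite mdeg_mulcm natrD; ring.
Qed.

Lemma euler1 : euler 1 = 0.
Proof.
apply/fpsP => m; rewrite /= ; case: eqP => [->|]; last by rewrite mulr0.
by rewrite mdeg1 mul0r.
Qed.

Lemma euler_nat n : euler n%:R = 0.
Proof.
elim: n => [|n IHn]; last by rewrite -natr1 eulerD IHn euler1 addr0.
by apply/fpsP => m; rewrite fcoef_euler mulr0.
Qed.

Lemma eulerX f k : euler (f ^+ k.+1) = k.+1%:R * f ^+ k * euler f.
Proof.
elim: k => [|k IHk]; first by rewrite expr0 expr1 !mul1r.
by rewrite exprS eulerM IHk -natr1 !exprS; ring.
Qed.

Lemma euler_var k : euler 's_k = 's_k.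
Proof.
apply/fpsP => m /=; case: eqP => [->|]; last by rewrite mulr0.
by rewrite mdegU mulr1.
Qed.

Lemma euler_inj f g : euler f = euler g -> fcoef f one = fcoef g one -> f = g.
Proof.
move=> /fpsP e e0; apply/fpsP => m; have [->//|m0] := eqVneq m one.
have := e m; rewrite /= => /mulfI; apply.
by rewrite Num.Theory.pnatr_eq0 mdeg_eq0.
Qed.

(** Agreement below total degree N. A series without constant term has a k-th power vanishing below
    degree k, so at this precision infinite sums become finite ones. *)
Definition fps_eqm N (f g : fps) :=
  forall m : mon, (mdeg m < N)%N -> fcoef f m = fcoef g m.

Lemma fps_eqmP f g : (forall N, fps_eqm N f g) -> f = g.
Proof. by move=> e; apply/fpsP => m; apply: (e (mdeg m).+1). Qed.

Lemma fps_eqmM N f1 f2 g1 g2 :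
  fps_eqm N f1 f2 -> fps_eqm N g1 g2 -> fps_eqm N (f1 * g1) (f2 * g2).
Proof.
move=> ef eg m mN; rewrite !fcoefM big_seq [RHS]big_seq.
apply: eq_bigr => -[a b]; rewrite mem_antidiag /= => /eqP abm.
by move: mN; rewrite -abm mdeg_mulcm => mN; rewrite ef ?eg //; lia.
Qed.

Lemma fcoefX_small u k (m : mon) : fcoef u one = 0 -> (mdeg m < k)%N -> fcoef (u ^+ k) m = 0.
Proof.
move=> u0; elim: k m => // k IHk m mk; rewrite exprS fcoefM big_seq big1 // => -[a b].
rewrite mem_antidiag /= => /eqP abm; have [->|a1] := eqVneq a one; first by rewrite u0 mul0r.
rewrite IHk ?mulr0 //; move: mk; rewrite -abm mdeg_mulcm.
have : (mdeg a != 0)%N by rewrite mdeg_eq0.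
by lia.
Qed.

Definition ser (c : nat -> rat) u := fps_sum setT (fun k => c k *: u ^+ k).

Lemma serE c u N : fcoef u one = 0 -> fps_eqm N (ser c u) (\sum_(k < N) c k *: u ^+ k).
Proof.
move=> u0 m mN; rewrite fcoef_sum /ser /= (@fsbig_ord _ _ _ N (fun k => fcoef (c k *: u ^+ k) m)).
apply/esym/fsbig_widen => // k [_ /= /negP]; rewrite -leqNgt => kN.
by rewrite fcoefX_small ?mulr0 //; apply: leq_trans mN kN.
Qed.

Lemma ser0 c u : fcoef u one = 0 -> fcoef (ser c u) one = c 0%N.
Proof.
move=> u0; rewrite (@serE c u 1) ?mdeg1 //.
by rewrite big_ord1 expr0 fcoefZ fcoef1 eqxx mulr1.
Qed.

Lemma eq_ser c d u : c =1 d -> ser c u = ser d u.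
Proof. by move=> e; rewrite (funext e). Qed.

Lemma ser_shift c u : fcoef u one = 0 ->
  ser c u = (c 0%N)%:A + u * ser (fun k => c k.+1) u.
Proof.
move=> u0; apply: fps_eqmP => N m mN.
rewrite (@serE c u N.+1) //; last by rewrite ltnS ltnW.
rewrite big_ord_recl expr0 !fcoefD; congr (_ + _).
rewrite (@fps_eqmM N u u _ _ _ (serE (fun k => c k.+1) u0)) // mulr_sumr.
by congr fcoef; apply: eq_bigr => k _; rewrite exprS scalerAr.
Qed.

Lemma serD c d u : fcoef u one = 0 ->
  ser (fun k => c k + d k) u = ser c u + ser d u.
Proof.
move=> u0; apply: fps_eqmP => N m mN.
rewrite fcoefD !(@serE _ u N) // -fcoefD -big_split.
by congr fcoef; apply: eq_bigr => k _; rewrite scalerDl.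
Qed.

Lemma serZ a c u : fcoef u one = 0 -> ser (fun k => a * c k) u = a *: ser c u.
Proof.
move=> u0; apply: fps_eqmP => N m mN.
rewrite fcoefZ !(@serE _ u N) // -fcoefZ scaler_sumr.
by congr fcoef; apply: eq_bigr => k _; rewrite scalerA.
Qed.

Lemma euler_ser c u : fcoef u one = 0 ->
  euler (ser c u) = ser (fun k => k.+1%:R * c k.+1) u * euler u.
Proof.
move=> u0; apply: fps_eqmP => N m mN.
rewrite fcoef_euler (@serE c u N.+1) //; last by rewrite ltnS ltnW.
rewrite (@fps_eqmM N _ _ (euler u) (euler u) (serE (fun k => k.+1%:R * c k.+1) u0)) //.
rewrite -fcoef_euler big_ord_recl eulerD expr0 eulerZ euler1 scaler0 add0r.
rewrite (big_morph _ eulerD (_ : euler 0 = 0)); last by apply/fpsP => ? /=; rewrite mulr0.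
rewrite mulr_suml; congr fcoef; apply: eq_bigr => k _.
by rewrite eulerZ eulerX -!scalerAl -mulrA mulr_natl -scaler_nat scalerA mulrC.
Qed.

Lemma fps_geometric f : fcoef f one = 1 -> f * ser (fun k => (-1) ^+ k) (f - 1) = 1.
Proof.
move=> f1; set u := f - 1.
have u0 : fcoef u one = 0 by rewrite fcoefD fcoefN f1 fcoef1 eqxx subrr.
rewrite (_ : f = 1 + u); last by rewrite /u addrC subrK.
rewrite mulrDl mul1r {1}ser_shift // expr0 scale1r.
rewrite (@eq_ser _ (fun k => -1 * (-1) ^+ k)); last by move=> k; rewrite exprS.
by rewrite serZ // scaleN1r mulrN subrK.
Qed.

Lemma fps_sqrtE f : fps_sqrt f =
  ser (fun k => (\prod_(i < k) (1 / 2%:R - i%:R)) / (k`!)%:R) (f - 1).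
Proof. by []. Qed.

Lemma fps_sqrt0 f : fcoef f one = 1 -> fcoef (fps_sqrt f) one = 1.
Proof.
move=> f1; rewrite fps_sqrtE ser0 ?fcoefD ?fcoefN ?f1 ?fcoef1 ?eqxx ?subrr //.
by rewrite big_ord0 fact0 divr1.
Qed.

(** The binomial coefficients satisfy (k + 1) c_(k+1) + k c_k = c_k / 2, which says 2 f S' = S for
    the formal derivative S'. So S^2 and f obey the same first order equation; the difference
    divided by f then has derivative zero and constant term zero, hence vanishes. *)
Lemma fps_sqr_sqrt f : fcoef f one = 1 -> fps_sqrt f ^+ 2 = f.
Proof.
move=> f1; pose S := fps_sqrt f; pose u := f - 1.
have u0 : fcoef u one = 0 by rewrite fcoefD fcoefN f1 fcoef1 eqxx subrr.
have fE : f = 1 + u by rewrite /u addrC subrK.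
have euf : euler u = euler f by rewrite eulerB euler1 subr0.
have [S' S'E ode] : exists2 S', euler S = S' * euler f & 2 * (f * S') = S.
  rewrite /S fps_sqrtE -/u; set c := fun k : nat => _.
  exists (ser (fun k => k.+1%:R * c k.+1) u); first by rewrite euler_ser ?euf.
  have uS : u * ser (fun k => k.+1%:R * c k.+1) u = ser (fun k => k%:R * c k) u.
    by rewrite [RHS]ser_shift // mul0r scale0r add0r.
  rewrite mulr_natl -scaler_nat {1}fE mulrDl mul1r uS -serD // -serZ //.
  apply: eq_ser => k; rewrite /c big_ord_recr /= factS natrM.
  have k1 : k.+1%:R != 0 :> rat by rewrite Num.Theory.pnatr_eq0.
  have kf : (k`!)%:R != 0 :> rat by rewrite Num.Theory.pnatr_eq0 -lt0n fact_gt0.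
  by rewrite -natr1 in k1 *; field; rewrite k1 kf.
have f0 : f != 0.
  by apply/eqP => f0; move: f1; rewrite f0 => /esym/eqP; rewrite oner_eq0.
have eS : f * euler (S ^+ 2) = S ^+ 2 * euler f.
  rewrite expr2 eulerM S'E; transitivity (S * (2 * (f * S')) * euler f); first by ring.
  by rewrite ode.
pose T := S ^+ 2 - f.
have T0 : fcoef T one = 0.
  by rewrite fcoefD fcoefN f1 expr2 fcoefM0 fps_sqrt0 // mulr1 subrr.
have eT : f * euler T = T * euler f by rewrite /T eulerB mulrBr eS; ring.
have := fps_geometric f1; set g := ser _ _ => fg.
have eg : f * euler g = - (euler f * g).
  by apply/eqP; rewrite -addr_eq0 addrC -eulerM fg euler1.
have Tg : T * g = 0.
  apply: euler_inj; last by rewrite fcoefM0 T0 mul0r.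
  apply: (mulfI f0); have := congr1 (fun h => h * g) eT => /= {}eT.
  have -> : euler 0 = 0 by apply/fpsP => m; rewrite fcoef_euler mulr0.
  by rewrite mulr0 eulerM mulrDr mulrA eT mulrCA eg; ring.
by apply/eqP; rewrite -subr_eq0 -/T -[T]mulr1 -fg mulrCA Tg mulr0.
Qed.

(* The added term at k = 0 vanishes because 0^-1 = 0. *)
Lemma fps_logE f : fps_log f = ser (fun k => (-1) ^+ k.+1 / k%:R) (f - 1).
Proof.
apply/fpsP => m; apply: fsbig_widen => // -[|k] [_ /= /negP //] _.
by rewrite invr0 mulr0 mul0r.
Qed.

Lemma euler_log f : fcoef f one = 1 -> f * euler (fps_log f) = euler f.
Proof.
move=> f1; pose u := f - 1.
have u0 : fcoef u one = 0 by rewrite fcoefD fcoefN f1 fcoef1 eqxx subrr.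
have euf : euler u = euler f by rewrite eulerB euler1 subr0.
rewrite fps_logE euler_ser // euf mulrA.
rewrite (@eq_ser _ (fun k => (-1) ^+ k)) ?fps_geometric ?mul1r // => k.
by rewrite mulrCA mulfV ?Num.Theory.pnatr_eq0 // mulr1 !exprS !mulN1r opprK.
Qed.

Lemma fps_log0 f : fcoef f one = 1 -> fcoef (fps_log f) one = 0.
Proof.
move=> f1; rewrite fps_logE ser0 ?invr0 ?mulr0 //.
by rewrite fcoefD fcoefN f1 fcoef1 eqxx subrr.
Qed.

(** * Series in a single variable s_k *)

Definition mpow k n : mon := iter n (mulcm (ucm k)) one.

Lemma mpowE k n i : mpow k n i = (if k == i then n else 0)%N.
Proof.
elim: n => [|n IHn] /=; first by rewrite onecmE; case: eqP.
by rewrite mulcmE IHn ucmE; case: eqP.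
Qed.

Lemma mpowD k n p : mulcm (mpow k n) (mpow k p) = mpow k (n + p).
Proof. by apply/eqP/cmP => i; rewrite mulcmE !mpowE; case: eqP. Qed.

Lemma mdeg_mpow k n : mdeg (mpow k n) = n.
Proof.
elim: n => [|n IHn]; first by rewrite mdeg1.
by rewrite /= mdeg_mulcm IHn mdegU.
Qed.

Lemma mpow_inj k : injective (mpow k).
Proof. by move=> n p e; rewrite -(mdeg_mpow k n) e mdeg_mpow. Qed.

(* The series obtained from sum_n a_n x^n by substituting s_k for x. *)
Definition uni k (a : nat -> rat) : fps :=
  Fps (fun m => if m == mpow k (m k) then a (m k) else 0).

Lemma uniE k a m : fcoef (uni k a) m = if m == mpow k (m k) then a (m k) else 0.
Proof. by []. Qed.

Lemma uni_mpow k a n : fcoef (uni k a) (mpow k n) = a n.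
Proof. by rewrite uniE mpowE eqxx eqxx. Qed.

Lemma uni_neq k a m : (forall n, m <> mpow k n) -> fcoef (uni k a) m = 0.
Proof. by move=> ne; rewrite uniE; case: eqP => // /ne. Qed.

Lemma uni0 k a : fcoef (uni k a) one = a 0%N.
Proof. exact: (uni_mpow k a 0). Qed.

Lemma uniP k a f : (forall n, fcoef f (mpow k n) = a n) ->
  (forall m, (forall n, m <> mpow k n) -> fcoef f m = 0) -> f = uni k a.
Proof.
move=> pure mixed; apply/fpsP => m; rewrite uniE; case: eqP => [{1}->|ne]; first by rewrite pure.
by apply: mixed => n mE; apply: ne; rewrite mE mpowE eqxx.
Qed.

Lemma uniD k a b : uni k a + uni k b = uni k (fun n => a n + b n).
Proof. by apply/fpsP => m; rewrite fcoefD !uniE; case: eqP; rewrite ?addr0. Qed.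

Lemma uniZ k c a : c *: uni k a = uni k (fun n => c * a n).
Proof. by apply/fpsP => m; rewrite fcoefZ !uniE; case: eqP; rewrite ?mulr0. Qed.

Lemma eq_uni k a b : a =1 b -> uni k a = uni k b.
Proof. by move=> e; rewrite (funext e). Qed.

Lemma uni_var k : 's_k = uni k (fun n => (n == 1)%:R).
Proof.
have s : ucm k = mpow k 1 by rewrite /= mulcm0.
apply: uniP => [n|m ne] /=; rewrite s ?(inj_eq (@mpow_inj k)) //.
by case: eqP => // /ne.
Qed.

Lemma uni_one k : 1 = uni k (fun n => (n == 0)%:R).
Proof.
apply: uniP => [n|m ne]; rewrite fcoef1 -[one]/(mpow k 0) ?(inj_eq (@mpow_inj k)) //.
by case: eqP => // /ne.
Qed.

Lemma euler_uni k a : euler (uni k a) = uni k (fun n => n%:R * a n).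
Proof.
apply: uniP => [n|m ne]; first by rewrite fcoef_euler uni_mpow mdeg_mpow.
by rewrite fcoef_euler uni_neq ?mulr0.
Qed.

Lemma perm_antidiag_mpow k n :
  perm_eq (fset_set (antidiag (mpow k n)))
          [seq (mpow k i, mpow k (n - i)) | i <- iota 0 n.+1].
Proof.
apply: uniq_perm; rewrite ?fset_uniq ?map_inj_uniq ?iota_uniq //.
  by move=> i j [/mpow_inj].
move=> [a b]; rewrite mem_antidiag; apply/eqP/mapP => [abn|[i]]; last first.
  by rewrite mem_iota add0n ltnS => /andP[_ le] [-> ->]; rewrite mpowD subnKC.
rewrite /= in abn; have absum i : (a i + b i = mpow k n i)%N by rewrite -abn mulcmE.
have aE : a = mpow k (a k).
  apply/eqP/cmP => i; rewrite mpowE; case: eqP => [->//|/eqP ki].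
  by have := absum i; rewrite mpowE (negbTE ki); lia.
have ak := absum k; rewrite mpowE eqxx in ak.
exists (a k); first by rewrite mem_iota; lia.
rewrite {1}aE; congr pair; apply/eqP/cmP => i; rewrite mpowE.
by have := absum i; rewrite mpowE {1}aE mpowE; case: eqP => [<-|_]; lia.
Qed.

Lemma uniM k a b :
  uni k a * uni k b = uni k (fun n => \sum_(i < n.+1) a i * b (n - i)%N).
Proof.
apply: uniP => [n|m ne]; rewrite fcoefM.
  rewrite (perm_big _ (perm_antidiag_mpow k n)) big_map -[iota _ _]/(index_iota 0 n.+1).
  by rewrite big_mkord; apply: eq_bigr => i _; rewrite !uni_mpow.
rewrite big_seq big1 // => -[c d]; rewrite mem_antidiag /= => /eqP cdm.
rewrite -[LHS]/(fcoef (uni k a) c * fcoef (uni k b) d).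
have [cE|/eqP cE] := eqVneq c (mpow k (c k)); last first.
  by rewrite uni_neq ?mul0r // => n cn; apply: cE; rewrite cn mpowE eqxx.
have [dE|/eqP dE] := eqVneq d (mpow k (d k)); last first.
  by rewrite [fcoef _ d]uni_neq ?mulr0 // => n dn; apply: dE; rewrite dn mpowE eqxx.
by case: (ne (c k + d k)%N); rewrite -cdm {1}cE {1}dE mpowD.
Qed.

Lemma uni_varM k a : 's_k * uni k a = uni k (fun n => if n is n'.+1 then a n' else 0).
Proof.
rewrite uni_var uniM; apply: eq_uni => -[|n]; first by rewrite big_ord1 mul0r.
rewrite big_ord_recl mul0r add0r big_ord_recl mul1r subSS subn0.
by rewrite big1 ?addr0 // => i _; rewrite mul0r.
Qed.

(** * Generating functions *)

Definition dissect_gf k := uni k (fun n => (ndissect n)%:R).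
Definition arcset_gf k := uni k (fun n => (narcsets n)%:R).

Lemma dissect_gf0 k : fcoef (dissect_gf k) one = 0. Proof. exact: uni0. Qed.

(** The recursion for arc systems fails at n = 0, where its right side is 0 and the count is 1; this
    is the summand 1. *)
Lemma arcset_gf_fix k : arcset_gf k = 1 + dissect_gf k * arcset_gf k.
Proof.
rewrite (uni_one k) uniM uniD; apply: eq_uni => -[|n].
  by rewrite big_ord1 mul0r addr0.
rewrite narcsets_rec // natr_sum add0r.
by apply: eq_bigr => i _; rewrite natrM.
Qed.

(** Doubling holds from n = 2 on. The corrections are 1 at n = 0, and -1 at n = 1, where the count
    is 1 and not 2. *)
Lemma arcset_gf_dissect k : arcset_gf k = 1 + 2 * dissect_gf k - 's_k.
Proof.
rewrite mulr_natl -scaler_nat -scaleN1r (uni_one k) uni_var !uniZ !uniD.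
apply: eq_uni => -[|[|n]] //.
by rewrite narcsetsE // natrM /= mulr0 !addr0 add0r.
Qed.

Lemma dissect_gf_quad k :
  2 * dissect_gf k ^+ 2 - (1 + 's_k) * dissect_gf k + 's_k = 0.
Proof.
have := arcset_gf_fix k; rewrite arcset_gf_dissect => e.
transitivity (1 + dissect_gf k * (1 + 2 * dissect_gf k - 's_k) - (1 + 2 * dissect_gf k - 's_k)).
  by ring.
by rewrite -e subrr.
Qed.

Lemma fcoef_root0 (s D : fps) : fcoef s one = 0 -> fcoef D one = 0 ->
  fcoef (1 + s - 4 * D) one = 1.
Proof.
by move=> s0 D0; rewrite 2!fcoefD fcoefN fcoefM0 fcoef1 eqxx s0 D0 mulr0 subr0 addr0.
Qed.

(** Completing the square in the quadratic equation for D shows that R is a root of f. In an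
    integral domain two roots agree up to sign, and the constant terms 1 fix the sign. *)
Lemma sqrt_dissect_gf k :
  fps_sqrt ('s_k ^+ 2 - 6 * 's_k + 1) = 1 + 's_k - 4 * dissect_gf k.
Proof.
set f := _ + 1; set R := 1 + _ - _.
have s0 : fcoef 's_k one = 0 by rewrite uni_var uni0.
have R1 : fcoef R one = 1 := fcoef_root0 s0 (dissect_gf0 k).
have f1 : fcoef f one = 1.
  rewrite /f; move: 's_k s0; clear => s s0.
  by rewrite 2!fcoefD fcoefN expr2 2!fcoefM0 fcoef1 eqxx s0 !mulr0 subr0 add0r.
have fR : f = R ^+ 2.
  apply/eqP; rewrite -subr_eq0 /f /R; apply/eqP.
  have := dissect_gf_quad k; move: 's_k (dissect_gf k); clear => s D q.
  transitivity (- 8 * (2 * D ^+ 2 - (1 + s) * D + s)); first by ring.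
  by rewrite q mulr0.
have : (fps_sqrt f - R) * (fps_sqrt f + R) == 0.
  by rewrite -subr_sqr fps_sqr_sqrt // fR subrr.
rewrite mulf_eq0 => /orP[|/eqP e]; first by rewrite subr_eq0 => /eqP.
have : fcoef (fps_sqrt f + R) one = 0 by rewrite e.
by rewrite fcoefD fps_sqrt0 // R1 => /eqP; rewrite Num.Theory.paddr_eq0.
Qed.

Lemma dissect_gfE k :
  (3 / 4) *: 1 - (1 / 4) *: 's_k + (1 / 4) *: fps_sqrt ('s_k ^+ 2 - 6 * 's_k + 1)
  = 1 - dissect_gf k.
Proof.
rewrite sqrt_dissect_gf /dissect_gf [4 * _]mulr_natl -scaler_nat -!scaleN1r (uni_one k) uni_var.
rewrite !(uniD, uniZ); apply: eq_uni => n /=.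
by field.
Qed.

(** The factor i in [nannularE] is what the derivation contributes to D, while the division by m is
    undone by the derivation on the left. *)
Lemma euler_annular_gf k :
  euler (uni k (fun m => (nannular m)%:R / m%:R)) = euler (dissect_gf k) * arcset_gf k.
Proof.
rewrite !euler_uni uniM; apply: eq_uni => -[|n].
  by rewrite big_ord1 !mul0r.
rewrite mulrC divfK ?Num.Theory.pnatr_eq0 // nannularE // natr_sum.
by apply: eq_bigr => i _; rewrite !natrM.
Qed.

Lemma arcset_gf_inverse k : (1 - dissect_gf k) * arcset_gf k = 1.
Proof. by rewrite mulrBl mul1r {1}arcset_gf_fix addrK. Qed.

Lemma log_dissect_gf k :
  fps_log (1 - dissect_gf k) = - uni k (fun m => (nannular m)%:R / m%:R).
Proof.
have D1 : fcoef (1 - dissect_gf k) one = 1.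
  by have := dissect_gf0 k; move: (dissect_gf k) => D D0; rewrite fcoefD fcoefN fcoef1 eqxx D0 subr0.
apply: euler_inj; last by rewrite fps_log0 // fcoefN uni0 invr0 mulr0 oppr0.
have D0 : 1 - dissect_gf k != 0.
  by apply/eqP => D0; move: D1; rewrite D0 => /esym/eqP; rewrite oner_eq0.
apply: (mulfI D0); rewrite euler_log // eulerB euler1 sub0r eulerN mulrN; congr (- _).
by rewrite euler_annular_gf mulrCA arcset_gf_inverse mulr1.
Qed.

Lemma euler_quad (s D : fps) : euler s = s -> 2 * D ^+ 2 - (1 + s) * D + s = 0 ->
  euler D * (1 + s - 4 * D) = s * (1 - D).
Proof.
move=> es /(congr1 euler); rewrite eulerD eulerB expr2 !eulerM.
rewrite (euler_nat 0) (euler_nat 2) eulerD euler1 es.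
move=> q; apply/eqP; rewrite -subr_eq0 -oppr_eq0; apply/eqP.
by rewrite -[RHS]q; move: (euler D); clear => E; ring.
Qed.

(** The left side has derivative 2 x D, so this is the integration of D in closed form; it is
    verified by applying the derivation to both sides. *)
Lemma unrooted_dissect_gf k :
  4 *: uni k (fun n => if (1 < n)%N then (ndissect n.-1)%:R / (2 * n)%:R else 0) =
  2 *: uni k (fun m => (nannular m)%:R / m%:R) +
  ('s_k - 3 * dissect_gf k + 's_k * dissect_gf k).
Proof.
set D := dissect_gf k; set V := arcset_gf k.
have e0 : fcoef 's_k one = 0 by rewrite uni_var uni0.
apply: euler_inj; last first.
  have := dissect_gf0 k; rewrite -/D fcoefZ uni0 mulr0 fcoefD fcoefZ uni0 invr0 !mulr0 add0r.
  move: 's_k D e0; clear => s D s0 D0.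
  by rewrite 2!fcoefD fcoefN 2!fcoefM0 s0 D0 !mulr0 subr0 addr0.
rewrite eulerZ euler_uni eulerD eulerZ euler_annular_gf eulerD eulerB !eulerM euler_var.
rewrite euler_nat mul0r add0r.
have -> : 4 *: uni k (fun n => n%:R * if (1 < n)%N then (ndissect n.-1)%:R / (2 * n)%:R else 0)
    = 2 * ('s_k * D).
  rewrite uni_varM uniZ mulr_natl -scaler_nat uniZ; apply: eq_uni => -[|[|n]] /=.
  - by rewrite mul0r !mulr0.
  - by rewrite !mulr0.
  have : n.+2%:R != 0 :> rat by rewrite Num.Theory.pnatr_eq0.
  by rewrite natrM; move: n.+2%:R => c c0; field.
rewrite scaler_nat -mulr_natl -/D -/V.
(* The quadratic equation determines [euler D] only after multiplication by [R]. Since [R] is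
   nonzero, both sides are multiplied by it, and what remains follows from the quadratic and V (1 -
   D) = 1. *)
pose R := 1 + 's_k - 4 * D.
have R0 : R != 0.
  have R1 : fcoef R one = 1 := fcoef_root0 e0 (dissect_gf0 k).
  by apply/eqP => R0; move: R1; rewrite R0 => /esym/eqP; rewrite oner_eq0.
have q := dissect_gf_quad k; rewrite -/D in q.
have dR : euler D * R = 's_k * (1 - D) := euler_quad (euler_var k) q.
have VD := arcset_gf_inverse k; rewrite -/D -/V in VD.
apply: (mulIf R0); apply/eqP; rewrite -subr_eq0; apply/eqP; rewrite /R in dR *; clear R R0.
move: (euler D) ('s_k) V q dR VD; clearbody D; clear => E s V q dR VD.
transitivity (- ((2 * V + s - 3) * (E * (1 + s - 4 * D)) + (s - s * D) * (1 + s - 4 * D))).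
  by ring.
rewrite dR; transitivity (- (2 * s * ((1 - D) * V - 1) +
    2 * s * (2 * D ^+ 2 - (1 + s) * D + s))).
  by ring.
by rewrite VD q subrr !mulr0 addr0 oppr0.
Qed.

(* The weight of s_1^(m 1) s_2^(m 2) ... is the degree of the permutations it describes. *)
Definition wt (m : mon) := (\sum_(k <- finsupp m) k * m k)%N.

Lemma wt_widen (m : mon) (d : {fset nat}) : (finsupp m `<=` d)%fset ->
  wt m = (\sum_(k <- d) k * m k)%N.
Proof.
move=> le; rewrite /wt (big_fset_incl _ le) // => k _ km.
by rewrite (fsfun_dflt km) muln0.
Qed.

Lemma wtM (m d : mon) : wt (mulcm m d) = (wt m + wt d)%N.
Proof.
pose u := (finsupp m `|` finsupp d)%fset.
rewrite (@wt_widen m u) ?fsubsetUl // (@wt_widen d u) ?fsubsetUr // (@wt_widen _ u).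
  by rewrite -big_split; apply: eq_bigr => k _; rewrite mulcmE mulnDr.
apply/fsubsetP => k; rewrite !mem_finsupp inE !mem_finsupp mulcmE.
by rewrite -negb_and; apply: contra => /andP[/eqP-> /eqP->].
Qed.

Lemma wt_ucm k : wt (ucm k) = k.
Proof.
rewrite (@wt_widen _ [fset k]%fset); first by rewrite big_seq_fset1 ucmE eqxx muln1.
by apply/fsubsetP => j; rewrite mem_finsupp ucmE inE (eq_sym j); case: (k == j).
Qed.

Lemma wt_mpow k n : wt (mpow k n) = (k * n)%N.
Proof.
elim: n => [|n IHn]; last by rewrite /= wtM IHn wt_ucm mulnS.
rewrite muln0 (@wt_widen _ fset0) ?big_seq_fset0 //.
by apply/fsubsetP => j; rewrite mem_finsupp onecmE.
Qed.

(** The part carried by graphs on n vertices: the cycle lengths of a permutation of n points sum to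
    n. *)
Definition component n (f : fps) : fps := Fps (fun m => if wt m == n then fcoef f m else 0).

Lemma fcoef_component n f m :
  fcoef (component n f) m = if wt m == n then fcoef f m else 0.
Proof. by []. Qed.

Lemma componentD n f g : component n (f + g) = component n f + component n g.
Proof.
by apply/fpsP => m; rewrite fcoefD !fcoef_component; case: eqP; rewrite ?addr0.
Qed.

Lemma componentZ n a f : component n (a *: f) = a *: component n f.
Proof.
by apply/fpsP => m; rewrite fcoefZ !fcoef_component; case: eqP; rewrite ?mulr0.
Qed.

Lemma sum_component f : fps_sum setT (component^~ f) = f.
Proof.
apply/fpsP => m; rewrite /fps_sum /=.
rewrite -(@fsbig_widen _ _ _ _ [set wt m]) //; last first.
  by move=> k [_ kn] /=; case: eqP => // e; case: kn; rewrite /= e.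
by rewrite fsbig_set1 eqxx.
Qed.

Lemma var_exp k j : 's_k ^+ j = uni k (fun i => (i == j)%:R).
Proof.
elim: j => [|j IHj]; first by rewrite expr0 (uni_one k).
by rewrite exprS IHj uni_varM; apply: eq_uni => -[].
Qed.

Lemma component_uni n k a : (0 < k)%N -> component n (uni k a) =
  if (k %| n)%N then a (n %/ k)%N *: 's_k ^+ (n %/ k) else 0.
Proof.
move=> k0; have kE i j : ((k * i == k * j) = (i == j))%N by rewrite eqn_pmul2l.
case: ifP => [/dvdnP[j ->]|kn].
  rewrite mulnK // var_exp uniZ; apply: uniP => [i|m ne].
    rewrite fcoef_component wt_mpow uni_mpow (mulnC j) kE.
    by case: eqP => [->|]; rewrite ?mulr1 ?mulr0.
  by rewrite fcoef_component uni_neq // if_same.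
apply/fpsP => m; rewrite fcoef_component uniE; case: eqP => // mn; case: eqP => // mE.
by rewrite mE wt_mpow in mn; rewrite -mn dvdn_mulr in kn.
Qed.

Lemma component_varM n k f : component (k + n)%N ('s_k * f) = 's_k * component n f.
Proof.
apply/fpsP => m; rewrite fcoef_component !fcoefM.
rewrite [X in if _ then X else _]big_seq [RHS]big_seq.
case: eqP => mn; [apply: eq_bigr|apply/esym/big1] => -[a b] /=;
  rewrite mem_antidiag /= => /eqP abm; case: (eqVneq a (ucm k)) => [ak|]; rewrite ?mul0r //.
- by have -> : wt b == n by move: mn; rewrite -abm wtM ak wt_ucm => /addnI ->.
- by case: eqP => [bn|]; rewrite ?mulr0 //; case: mn; rewrite -abm wtM ak wt_ucm bn.
Qed.

Lemma component_varM_small n k f : (n < k)%N -> component n ('s_k * f) = 0.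
Proof.
move=> nk; apply/fpsP => m; rewrite fcoef_component fcoefM.
case: eqP => // mn; rewrite big_seq big1 // => -[a b]; rewrite mem_antidiag /= => /eqP abm.
case: (eqVneq a (ucm k)) => [ak|]; last by rewrite mul0r.
by move: nk; rewrite -mn -abm wtM ak wt_ucm ltnNge leq_addr.
Qed.

(** A power of s_d has weight n > 0 only if d divides n, so the infinite sum becomes finite. In
    weight 0 every d contributes its constant term, and that case is treated separately. *)
Lemma component_fps_sum n c a : (0 < n)%N ->
  component n (fps_sum [set d | (0 < d)%N]%classic (fun d => c d *: uni d a)) =
  \sum_(d < n.+1 | (d %| n)%N) (c d * a (n %/ d)%N) *: 's_d ^+ (n %/ d).
Proof.
move=> n0; apply/fpsP => m; rewrite fcoef_component fcoef_sum.
case: eqP => [mn|mn]; last first.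
  apply/esym/big1 => d dn; rewrite fcoefZ var_exp uniE; case: eqP => [mE|]; last by rewrite mulr0.
  case: eqP => [md|]; last by rewrite mulr0.
  by case: mn; rewrite mE wt_mpow md mulnC divnK.
have zero d : ~~ (d %| n)%N -> fcoef (c d *: uni d a) m = 0.
  rewrite fcoefZ uniE; case: eqP => [mE|]; last by rewrite mulr0.
  by rewrite -mn mE wt_mpow dvdn_mulr.
transitivity (\sum_(d \in [set d | (0 < d < n.+1)%N]%classic) fcoef (c d *: uni d a) m).
  apply/esym/fsbig_widen => d /=; first by case/andP.
  case=> d0 dn; apply: zero; apply: contraPN dn => /(dvdn_leq n0).
  by rewrite ltnS => ->; rewrite d0.
rewrite (@fsbig_widen _ _ _ _ _ `I_n.+1) => [|d /= /andP[]//|d /= [dn /negP]]; last first.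
  by rewrite dn andbT -eqn0Ngt => /eqP d0; apply: zero; rewrite d0 dvd0n -lt0n.
rewrite -(@fsbig_ord _ _ _ n.+1 (fun d => fcoef (c d *: uni d a) m)).
rewrite [RHS]big_mkcond; apply: eq_bigr => d _; case: ifPn => [dn|/zero //].
rewrite !fcoefZ -mulrA var_exp !uniE; case: eqP => [mE|]; last by rewrite !mulr0.
have md : (d * m d = n)%N by rewrite -[RHS]mn [in RHS]mE wt_mpow.
have -> : m d = (n %/ d)%N.
  by apply/eqP; rewrite -(eqn_pmul2l (dvdn_gt0 n0 dn)) md mulnC divnK.
by rewrite eqxx mulr1.
Qed.

(** * The cycle index sum through generating functions *)

Definition annular_log k := uni k (fun m => (nannular m)%:R / m%:R).
Definition annular_sum := fps_sum [set d | (0 < d)%N]%classic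
  (fun d => ((totient d)%:R / d%:R) *: annular_log d).
(** This is (D(s_2) - s_2) / s_2^2, introduced through its coefficients because s_2 has no inverse
    among the series. The exponent of s_2 counts the pairs of vertices exchanged by a reflection. *)
Definition symmetric_gf := uni 2 (fun m => (ndissect m.+2)%:R).

Lemma dissect_gf_symmetric : dissect_gf 2 = 's_2 + 's_2 * ('s_2 * symmetric_gf).
Proof.
rewrite !uni_varM [X in X + _]uni_var uniD; apply: eq_uni => -[|[|n]] //.
by rewrite add0r.
Qed.

Lemma component_annular_sum0 : component 0 annular_sum = 0.
Proof.
apply/fpsP => m; rewrite fcoef_component; case: eqP => // m0.
rewrite /annular_sum /fps_sum /=; apply: fsbig1 => d /= d0; case: eqP => [mE|]; last by rewrite mulr0.
move: m0; rewrite mE wt_mpow => /eqP; rewrite muln_eq0 -[d == 0]negbK -lt0n d0 /= => /eqP ->.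
(* The constant coefficient of every summand is [nannular 0] divided by 0, which is 0. *)
by rewrite mpowE eqxx invr0 !mulr0.
Qed.

Definition unrooted_gf := uni 1 (fun n => if (1 < n)%N then (ndissect n.-1)%:R / (2 * n)%:R else 0).

(** The summand d of [annular_sum] supplies the rotations of order d. At d = 1 it would count
    annular systems for the identity; removing [annular_log 1] and adding [unrooted_gf] puts
    dissections in their place. *)
Lemma component_rotations n : (0 < n)%N ->
  component n (2^-1 *: annular_sum + (unrooted_gf - 2^-1 *: annular_log 1)) =
  (2 * n)%:R^-1 *: (\sum_(d < n.+1 | (d %| n)%N) rot_term n (n %/ d)%N *+ totient d).
Proof.
move=> n0; have nn : n%:R != 0 :> rat by rewrite Num.Theory.pnatr_eq0 -lt0n.
rewrite -scaleN1r !componentD !componentZ /annular_sum.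
rewrite (component_fps_sum _ (fun m => (nannular m)%:R / m%:R)) //.
rewrite !component_uni // dvd1n divn1 !scalerA -scalerDl.
pose d1 : 'I_n.+1 := Ordinal (n0 : (1 < n.+1)%N).
rewrite (bigD1 d1) ?dvd1n // [in RHS](bigD1 d1) ?dvd1n //= divn1 !scalerDr !scaler_sumr addrAC.
congr (_ + _).
  rewrite scalerA -scalerDl /rot_term eqxx divnn n0 mulr1n scalerA; congr (_ *: _).
  have -> : (if (1 < n)%N then (ndissect n.-1)%:R / (2 * n)%:R else 0) =
      (ndissect n.-1)%:R / (2 * n)%:R :> rat.
    by case: ltnP => // n1; rewrite (_ : n.-1 = 0)%N ?mul0r //; clear -n0 n1; lia.
  by rewrite natrM; field.
apply: eq_bigr => d /andP[dn d_ne1]; have d0 := dvdn_gt0 n0 dn.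
have nd0 : (0 < n %/ d)%N by rewrite divn_gt0 // dvdn_leq.
have nE := divnK dn.
have -> : rot_term n (n %/ d)%N = (nannular (n %/ d)%N)%:R *: 's_d ^+ (n %/ d).
  have dd : (n %/ (n %/ d) = d)%N by rewrite divnA // mulKn.
  have ne : (n %/ d == n)%N = false.
    apply/eqP => e; case/eqP: d_ne1; apply: ord_inj => /=.
    by apply/eqP; rewrite -(eqn_pmul2l nd0) nE muln1 e.
  by rewrite /rot_term dd ne.
rewrite -scaler_nat !scalerA; congr (_ *: _).
have : d%:R != 0 :> rat by rewrite Num.Theory.pnatr_eq0 -lt0n.
have : (n %/ d)%N%:R != 0 :> rat by rewrite Num.Theory.pnatr_eq0 -lt0n.
rewrite natrM -[in n%:R]nE natrM.
move: (d : nat)%:R (n %/ d)%N%:R (totient d)%:R (nannular _)%:R => x y z t y0 x0.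
by field; rewrite x0 y0.
Qed.

Lemma component_combination n (f g h f' g' h' : fps) :
  component n f = f' -> component n g = g' -> component n h = h' ->
  component n (4^-1 *: (f + 2 *: g + h)) = 4^-1 *: (f' + 2 *: g' + h').
Proof. by move=> <- <- <-; rewrite componentZ !componentD componentZ. Qed.

Lemma uni_varM_symmetric : 's_2 * symmetric_gf =
  uni 2 (fun m => if m is m'.+1 then (ndissect m'.+2)%:R else 0).
Proof. exact: uni_varM. Qed.

Lemma component_varM_eq n k f g : component n f = g ->
  component (k + n)%N ('s_k * f) = 's_k * g.
Proof. by move=> <-; apply: component_varM. Qed.

(** The summands belong to no fixed vertex, one (odd n) and two. The middle one is doubled: for odd
    n all n reflections are alike, while for even n there are n / 2 of each kind. *)
Definition reflection_gf : fps :=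
  4^-1 *: (dissect_gf 2 + 2 *: ('s_1 * ('s_2 * symmetric_gf)) + 's_1 * ('s_1 * symmetric_gf)).

Lemma component_reflections_odd k : (0 < k)%N ->
  component (1 + 2 * k)%N reflection_gf = refl_sum (1 + 2 * k)%N.
Proof.
move=> k0; have nd : (2 %| 1 + 2 * k)%N = false by rewrite dvdn_addl ?dvdn_mulr.
transitivity (4^-1 *: (0 + 2 *: ('s_1 * ((ndissect k.+1)%:R *: 's_2 ^+ k)) + 0)).
  apply: component_combination; first by rewrite component_uni // nd.
    apply: component_varM_eq; rewrite uni_varM_symmetric component_uni // dvdn_mulr // mulKn //.
    by case: k k0 nd.
  rewrite -[RHS](mulr0 's_1); apply: component_varM_eq.
  rewrite (_ : 2 * k = 1 + (2 * k - 1))%N; last by lia.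
  rewrite -[RHS](mulr0 's_1); apply: component_varM_eq.
  by rewrite component_uni // ifF //; lia.
rewrite add0r addr0 /refl_sum ifT; last by lia.
rewrite (_ : (1 + 2 * k)./2 = k)%N; last by lia.
have : (1 + 2 * k)%N%:R != 0 :> rat by rewrite Num.Theory.pnatr_eq0.
move: ('s_1) => s; move: ('s_2 ^+ k) => t; rewrite -scalerAr !scalerA !natrM.
move: (1 + _)%N%:R (ndissect _)%:R => x y x0; congr (_ *: _).
by field.
Qed.

Lemma scale_even (s t u : fps) (x a b : rat) : x != 0 ->
  4^-1 *: (a *: u + s * (s * (b *: t))) = (4 * x)^-1 *: (x *: (a *: u + b *: (s ^+ 2 * t))).
Proof.
move=> x0; rewrite scalerA (_ : (4 * x)^-1 * x = 4^-1); last by field.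
by congr (_ *: (_ + _)); rewrite expr2 -!scalerAr mulrA.
Qed.

Lemma component_reflections_even k :
  component (1 + (1 + 2 * k))%N reflection_gf = refl_sum (1 + (1 + 2 * k))%N.
Proof.
transitivity (4^-1 *: ((ndissect k.+1)%:R *: 's_2 ^+ k.+1 + 2 *: 0 +
    's_1 * ('s_1 * ((ndissect k.+2)%:R *: 's_2 ^+ k)))).
  apply: component_combination.
  - rewrite component_uni // ifT; last by lia.
    by rewrite (_ : (1 + (1 + 2 * k)) %/ 2 = k.+1)%N //; lia.
  - rewrite -[RHS](mulr0 's_1); apply: component_varM_eq.
    by rewrite uni_varM_symmetric component_uni // ifF //; lia.
  - do 2 apply: component_varM_eq.
    by rewrite component_uni // dvdn_mulr // mulKn.
rewrite scaler0 addr0 /refl_sum ifF; last by lia.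
have [-> ->] : ((1 + (1 + 2 * k))./2 = k.+1)%N /\ (k.+1).-1 = k by split; lia.
have -> : (2 * (1 + (1 + 2 * k)) = 4 * k.+1)%N by lia.
have k0 : k.+1%:R != 0 :> rat by rewrite Num.Theory.pnatr_eq0.
by rewrite natrM; apply: scale_even.
Qed.

Lemma component_reflections n : (1 < n)%N -> component n reflection_gf = refl_sum n.
Proof.
move=> n1; have [on|en] := boolP (odd n).
  have [k0 nE] : (0 < n./2)%N /\ n = (1 + 2 * n./2)%N by split; lia.
  by rewrite nE component_reflections_odd.
have nE : n = (1 + (1 + 2 * (n./2).-1))%N by lia.
by rewrite nE component_reflections_even.
Qed.

Lemma component_reflections_small n : (n < 2)%N -> component n reflection_gf = 0.
Proof.
move=> n2; have a0 f : component n ('s_1 * ('s_2 * f)) = 0.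
  case: n n2 => [|[|//]] _; first exact: component_varM_small.
  rewrite -[1%N]/(1 + 0)%N -[RHS](mulr0 's_1); apply: component_varM_eq.
  exact: component_varM_small.
have b0 f : component n ('s_1 * ('s_1 * f)) = 0.
  case: n n2 {a0} => [|[|//]] _; first exact: component_varM_small.
  rewrite -[1%N]/(1 + 0)%N -[RHS](mulr0 's_1); apply: component_varM_eq.
  exact: component_varM_small.
transitivity (4^-1 *: (0 + 2 *: 0 + 0 : fps)); last by rewrite !scaler0 ?addr0 ?scaler0.
apply: component_combination; [|exact: a0|exact: b0].
by case: n n2 {a0 b0} => [|[|//]] _; rewrite component_uni //= scale0r.
Qed.

Definition rotation_gf : fps := 2^-1 *: annular_sum + (unrooted_gf - 2^-1 *: annular_log 1).

Lemma component_rotations0 : component 0 rotation_gf = 0.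
Proof.
rewrite /rotation_gf -scaleN1r !componentD !componentZ component_annular_sum0 !component_uni //.
by rewrite mul0r !scale0r !scaler0 !addr0.
Qed.

Lemma scale_edge (x y : fps) : 2^-1 *: (x + y) =
  (2 * 2)%:R^-1 *: (0 + (x *+ 1 + (y *+ 1 + 0))) + 4^-1 *: (y + x).
Proof.
by rewrite add0r addr0 !mulr1n (addrC y) -scalerDl; congr (_ *: _).
Qed.

(** Compared weight by weight. At n = 2 the edge behaves as a digon: rotations and reflections each
    give a quarter of s_1^2 + s_2. At n = 1 the convention [ndissect 0 = 0] makes both sides
    vanish. *)
Lemma cycle_index_sumE : cycle_index_sum in_D = rotation_gf + reflection_gf.
Proof.
rewrite -[RHS]sum_component; congr fps_sum; apply: funext => n; rewrite componentD.
case: (ltnP 2 n) => [n2|].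
  rewrite sum_unlabeled_dissections // component_rotations ?component_reflections //; lia.
rewrite leq_eqVlt => /orP[/eqP->|n2]; last first.
  rewrite sum_unlabeled_small // component_reflections_small // addr0.
  case: n n2 => [|[|//]] _; first by rewrite component_rotations0.
  rewrite component_rotations // big_mkcond 2!big_ord_recl big_ord0 /= /rot_term.
  by rewrite !(mulr0n, scale0r, mul0rn, addr0, scaler0).
rewrite sum_unlabeled_edge component_rotations // component_reflections //.
have r1 : rot_term 2 2 = 's_1 ^+ 2 by apply: scale1r.
have r2 : rot_term 2 1 = 's_2 by apply: scale1r.
have r3 : refl_sum 2 = 4^-1 *: ('s_2 + 's_1 ^+ 2).
  rewrite /refl_sum; congr (_ *: _); rewrite [LHS]scale1r.
  apply: (congr2 +%R); first exact: scale1r.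
  by transitivity ('s_1 ^+ 2 * 1 : fps); [apply: scale1r|apply: mulr1].
rewrite r3 big_mkcond 3!big_ord_recl big_ord0.
transitivity ((2 * 2)%:R^-1 *: (0 + ('s_1 ^+ 2 *+ 1 + ('s_2 *+ 1 + 0))) + 4^-1 *: ('s_2 + 's_1 ^+ 2)).
  exact: scale_edge.
by rewrite -r1 -r2.
Qed.

Lemma sum_rotations_reflections (Z S U A s1 s2 D1 D2 E : fps) :
  Z = 2^-1 *: S + (U - 2^-1 *: A) +
      4^-1 *: (D2 + 2 *: (s1 * (s2 * E)) + s1 * (s1 * E)) ->
  4 *: U = 2 *: A + (s1 - 3 * D1 + s1 * D1) -> D2 = s2 + s2 * (s2 * E) ->
  4 * Z = 2 * S + (s1 - 3 * D1 + s1 * D1) + (s2 + s2 * (s2 * E)) +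
          2 * (s1 * (s2 * E)) + s1 * (s1 * E).
Proof.
move=> ZE UE <-; have scal n (f : fps) : n%:R * f = n%:R *: f.
  by rewrite mulr_natl scaler_nat.
rewrite ZE !(scal 4) !(scal 2) scalerDr scalerDr scalerBr UE !scalerA.
rewrite (_ : 4 * 2^-1 = 2) ?divff // scale1r (addrC (2 *: A)) addrK.
by rewrite !addrA.
Qed.

(** * The closed form in the field of fractions *)

(** The hypotheses express D1, D2 and E through the roots Q1, Q2: each D costs a factor 1/4, and E
    costs s2^2 in the denominator. Stating this for an arbitrary ring morphism into a field keeps
    all series opaque to the field computation. *)
Lemma fraction_identity (R : comNzRingType) (F : fieldType) (f : {rmorphism R -> F})
    (Z S L s1 s2 D1 D2 Q1 Q2 E : R) : 2 != 0 :> F -> f s2 != 0 ->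
  4 * Z = 2 * S + (s1 - 3 * D1 + s1 * D1) + (s2 + s2 * (s2 * E)) +
          2 * (s1 * (s2 * E)) + s1 * (s1 * E) ->
  L = - S -> Q1 = 1 + s1 - 4 * D1 -> Q2 = 1 + s2 - 4 * D2 ->
  D2 = s2 + s2 * (s2 * E) ->
  f Z = - (1 / 2) * f L + (f s2 + f s1 ^+ 2 - 4 * f s1 - 2) / 16
    + (f s1 ^+ 2 - 3 * f s1 ^+ 2 * f s2 + 2 * f s1 * f s2) / (16 * f s2 ^+ 2)
    + (3 - f s1) / 16 * f Q1
    - 1 / 16 * (1 + f s1 ^+ 2 / f s2 ^+ 2 + 2 * f s1 / f s2) * f Q2.
Proof.
move=> two0 s0 /(congr1 f) ZE -> -> -> ->.
have pow n : (2 ^ n)%N%:R != 0 :> F by rewrite natrX expf_neq0.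
move: ZE; rewrite !(rmorphD, rmorphN, rmorphM, rmorph_nat) /= rmorph1 => ZE.
apply: (mulfI (pow 2)); rewrite ZE.
by field; rewrite s0 (pow 4) (pow 1).
Qed.

Lemma two_fraction_neq0 : 2 != 0 :> {fraction fps}.
Proof.
rewrite -(rmorph_nat (@tofrac fps)) tofrac_eq0 -scaler_nat scaler_eq0 oner_eq0.
by [].
Qed.

Lemma log_sum_annular :
  fps_sum [set d | (0 < d)%N]%classic (fun d => ((totient d)%:R / d%:R) *:
    fps_log ((3 / 4) *: 1 - (1 / 4) *: 's_d
             + (1 / 4) *: fps_sqrt ('s_d ^+ 2 - 6 * 's_d + 1))) = - annular_sum.
Proof.
transitivity (fps_sum [set d | (0 < d)%N]%classic
    (fun d => - (((totient d)%:R / d%:R) *: annular_log d))).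
  by congr fps_sum; apply: funext => d; rewrite dissect_gfE log_dissect_gf scalerN.
by apply/fpsP => m; rewrite fcoefN -mulN1r mulr_fsumr; apply: eq_fsbigr => d _; rewrite mulN1r.
Qed.

Theorem theorem9 :
  (cycle_index_sum in_D)%:F =
    - (1 / 2) *
      (fps_sum [set d | (0 < d)%N]%classic (fun d =>
         ((totient d)%:R / d%:R) *:
         fps_log ((3 / 4) *: 1 - (1 / 4) *: 's_d
                  + (1 / 4) *: fps_sqrt ('s_d ^+ 2 - 6 * 's_d + 1))))%:F
    + ('s_2%:F + 's_1%:F ^+ 2 - 4 * 's_1%:F - 2) / 16
    + ('s_1%:F ^+ 2 - 3 * 's_1%:F ^+ 2 * 's_2%:F + 2 * 's_1%:F * 's_2%:F)
      / (16 * 's_2%:F ^+ 2)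
    + (3 - 's_1%:F) / 16 * (fps_sqrt ('s_1 ^+ 2 - 6 * 's_1 + 1))%:F
    - 1 / 16 * (1 + 's_1%:F ^+ 2 / 's_2%:F ^+ 2 + 2 * 's_1%:F / 's_2%:F)
      * (fps_sqrt ('s_2 ^+ 2 - 6 * 's_2 + 1))%:F
    :> {fraction fps}.
Proof.
have s0 : 's_2 != 0 by apply/eqP => /fpsP/(_ (ucm 2)) /=; rewrite eqxx.
have ZE := sum_rotations_reflections cycle_index_sumE (unrooted_dissect_gf 1) dissect_gf_symmetric.
apply: (fraction_identity two_fraction_neq0 _ ZE log_sum_annular (sqrt_dissect_gf 1)
  (sqrt_dissect_gf 2) dissect_gf_symmetric).
by rewrite tofrac_eq0.
Qed.
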